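(* Let $d,d'\ge1$ be integers. (1) Let $\Omega$ be a bounded open set of $\mathbb{R}^d$ and let $\Omega'$ be an open set of $\mathbb{R}^{d'}$. Let $(x,y)\mapsto k(x,y)$ be in $L^2(\Omega'\times\Omega)$ and assume that $k$ is analytic in $y$ in a neighborhood of $\overline{\Omega}$ as a function valued in $L^2(\Omega')$. Let $K:L^2(\Omega)\to L^2(\Omega')$ be defined by $K\varphi(x)=\int_\Omega k(x,y)\varphi(y)\,dy$. Then there exist $\tau\in(0,1)$ and $C>0$ such that $$s_n(K)\le C\,\tau^{\,n^{1/d}}$$ for all positive integers $n$. (2) This estimate is optimal in the following sense: for any nonempty bounded open set $\Omega$ of $\mathbb{R}^d$, any nonempty open set $\Omega'$ of $\mathbb{R}^{d'}$, and any $\tau\in(0,1)$, there exist a kernel $k\in L^2(\Omega'\times\Omega)$ which is analytic in $y$ in a neighborhood of $\overline{\Omega}$ as a function valued in $L^2(\Omega')$, and $c>0$, such that the operator $K:L^2(\Omega)\to L^2(\Omega')$, $K\varphi(x)=\int_\Omega k(x,y)\varphi(y)\,dy$, satisfies $$c\,\tau^{\,n^{1/d}}\le s_n(K)$$ for all positive integers $n$.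
   Context: For a compact linear operator $T$ between separable Hilbert spaces, $s_n(T)$, $n\ge 1$, denotes the $n$-th singular value of $T$: the sequence $(s_n(T))_{n\ge1}$ is the sequence of square roots of the eigenvalues of $T^*T$ in decreasing order, repeated according to multiplicity. All functions are real valued. For $y\in\mathbb{R}^d$ and a multi-index $I=(i_1,\dots,i_d)$ of nonnegative integers, $y^I=y_1^{i_1}\cdots y_d^{i_d}$, $|I|=i_1+\dots+i_d$, and $|y|_\infty=\max\{|y_1|,\dots,|y_d|\}$. The kernel $k(x,y)$ is said to be analytic in $y$ in a neighborhood of $\overline{\Omega}$ as a function valued in $L^2(\Omega')$ if there is an open set $U$ of $\mathbb{R}^d$ with $\overline{\Omega}\subset U$ such that $k$ extends to $y\in U$ and, for all $y'\in U$, there are a multi-indexed sequence $(a_{I,y'})_I$ in $L^2(\Omega')$ and a radius $R_{y'}>0$ such that $\sum_I\|a_{I,y'}\|_{L^2(\Omega')}R_{y'}^{|I|}<\infty$ and $k(x,y)=\sum_I a_{I,y'}(x)(y-y')^I$ for all $y\in\mathbb{R}^d$ with $|y-y'|_\infty<R_{y'}$. *)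

(* Defs.v *)
From HB Require Import structures.
From mathcomp Require Import all_boot all_order all_algebra finmap.
From mathcomp Require Import all_classical all_reals all_analysis.

Set Implicit Arguments.
Unset Strict Implicit.
Unset Printing Implicit Defensive.
Import Order.TTheory GRing.Theory Num.Theory.
Import numFieldTopology.Exports numFieldNormedType.Exports.

Local Open Scope classical_set_scope.
Local Open Scope ring_scope.

Definition measure_rV_display : measure_display -> measure_display.
Proof. exact. Qed.

Section measurable_rV.
Context {d : measure_display} {T : measurableType d} (n : nat).

Let coors : 'I_n -> 'rV[T]_n -> T := fun i x => x ord0 i.

Let rV_set0 : g_sigma_preimage coors set0.
Proof. exact: sigma_algebra0. Qed.

Let rV_setC A : g_sigma_preimage coors A -> g_sigma_preimage coors (~` A).
Proof. exact: sigma_algebraC. Qed.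

Let rV_bigcup (F : (set 'rV[T]_n)^nat) :
  (forall i, g_sigma_preimage coors (F i)) ->
  g_sigma_preimage coors (\bigcup_i (F i)).
Proof. exact: sigma_algebra_bigcup. Qed.

(* The sigma-algebra generated by the coordinates, as for [n.-tuple T] in the
   library; for T = R it is the Borel sigma-algebra of 'rV[R]_n. *)
HB.instance Definition _ := @isMeasurable.Build (measure_rV_display d)
  'rV[T]_n (g_sigma_preimage coors) rV_set0 rV_setC rV_bigcup.

Lemma measurable_coord (i : 'I_n) :
  measurable_fun [set: 'rV[T]_n] (fun x => x ord0 i).
Proof.
move=> _ Y mY; rewrite setTI; apply: sub_sigma_algebra => /=.
rewrite -bigcup_seq/=; exists i => /=; first by rewrite mem_index_enum.
by exists Y => //; rewrite setTI.
Qed.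

Lemma measurable_fun_rV d' (U : measurableType d') (f : U -> 'rV[T]_n) :
  (forall i, measurable_fun setT (fun u => f u ord0 i)) ->
  measurable_fun setT f.
Proof.
move=> mf.
suff prefS : g_sigma_preimage (fun i => coors i \o f) `<=` measurable.
  move=> _ A mA; apply: prefS.
  rewrite g_sigma_preimage_comp.
  by exists A.
apply: smallest_sub; first exact: sigma_algebra_measurable.
rewrite -bigcup_seq; apply: bigcup_sub => i _.
by move=> A [B mB <-]; exact: (mf i).
Qed.

End measurable_rV.

Definition rVcons (T : Type) n (p : T * 'rV[T]_n) : 'rV[T]_n.+1 :=
  \row_i (if unlift ord0 i is Some j then p.2 ord0 j else p.1).

Section lebesgue_rV.
Context {R : realType}.
Local Open Scope ereal_scope.

Section step.
Variables (n : nat) (mu : {sigma_finite_measure set 'rV[R]_n -> \bar R}).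

Lemma measurable_rVcons : measurable_fun setT (@rVcons R n).
Proof.
apply: measurable_fun_rV => i.
rewrite (_ : (fun u => _) = fun u : R * 'rV[R]_n => if unlift ord0 i is Some j
  then u.2 ord0 j else u.1)//; last by apply/funext => u; rewrite mxE.
case: (unlift ord0 i) => [j|]; last exact: measurable_fst.
by apply: (measurableT_comp (measurable_coord j)); exact: measurable_snd.
Qed.

Definition lebesgue_rVS : set 'rV[R]_n.+1 -> \bar R :=
  pushforward (@lebesgue_measure R \x mu) (@rVcons R n).

Let lebesgue_rVS0 : lebesgue_rVS set0 = 0.
Proof. by rewrite /lebesgue_rVS /pushforward preimage_set0 measure0. Qed.

Let mpre A : measurable A -> measurable (@rVcons R n @^-1` A).
Proof. by move=> mA; rewrite -[X in measurable X]setTI; exact: measurable_rVcons. Qed.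

Let lebesgue_rVS_ge0 A : 0 <= lebesgue_rVS A.
Proof. by rewrite /lebesgue_rVS /pushforward; exact: measure_ge0. Qed.

Let lebesgue_rVS_sigma_additive : semi_sigma_additive lebesgue_rVS.
Proof.
move=> F mF tF mUF; rewrite /lebesgue_rVS /pushforward preimage_bigcup.
apply: measure_semi_sigma_additive.
- by move=> k; exact: mpre.
- apply/trivIsetP => /= i j _ _ ij; rewrite -preimage_setI.
  by move/trivIsetP : tF => /(_ _ _ _ _ ij) ->//; rewrite preimage_set0.
- by rewrite -preimage_bigcup; exact: mpre.
Qed.

HB.instance Definition _ := isMeasure.Build _ _ _ lebesgue_rVS
  lebesgue_rVS0 lebesgue_rVS_ge0 lebesgue_rVS_sigma_additive.

Let uncons (v : 'rV[R]_n.+1) : R * 'rV[R]_n :=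
  (v ord0 ord0, \row_j v ord0 (lift ord0 j)).

Let rVconsK : cancel (@rVcons R n) uncons.
Proof.
move=> [x v]; rewrite /uncons /rVcons /= mxE unlift_none; congr pair.
by apply/rowP => j; rewrite !mxE liftK.
Qed.

Let measurable_uncons : measurable_fun setT uncons.
Proof.
apply: measurable_fun_pair; first exact: measurable_coord.
apply: measurable_fun_rV => j.
rewrite (_ : (fun u => _) = fun u : 'rV[R]_n.+1 => u ord0 (lift ord0 j)).
  exact: measurable_coord.
by apply/funext => u; rewrite mxE.
Qed.

Let lebesgue_rVS_sigma_finite : sigma_finite setT lebesgue_rVS.
Proof.
have /sigma_finiteP[F [TF ndF Foo]] := sigma_finiteT (@lebesgue_measure R).
have /sigma_finiteP[G [TG ndG Goo]] := sigma_finiteT mu.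
exists (fun k => uncons @^-1` (F k `*` G k)).
  rewrite -preimage_bigcup; apply/esym/seteqP; split => // v _.
  have [k _ Fk] : (\bigcup_k F k) (uncons v).1 by rewrite -TF.
  have [l _ Gl] : (\bigcup_k G k) (uncons v).2 by rewrite -TG.
  exists (maxn k l) => //; split.
    by move: Fk; exact/subsetPset/ndF/leq_maxl.
  by move: Gl; exact/subsetPset/ndG/leq_maxr.
move=> k; have [mF Fk] := Foo k; have [mG Gk] := Goo k; split.
  by rewrite -[X in measurable X]setTI; apply: measurable_uncons => //;
    exact: measurableX.
rewrite /lebesgue_rVS /pushforward -comp_preimage.
rewrite (_ : uncons \o _ = id); last by apply/funext => p /=; rewrite rVconsK.
by rewrite preimage_id product_measure1E// lte_mul_pinfty// ge0_fin_numE.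
Qed.

HB.instance Definition _ := Measure_isSigmaFinite.Build _ _ _ lebesgue_rVS
  lebesgue_rVS_sigma_finite.

End step.

Fixpoint lebesgue_rV (n : nat) : {sigma_finite_measure set 'rV[R]_n -> \bar R} :=
  if n is m.+1 then lebesgue_rVS (lebesgue_rV m) else dirac (0 : 'rV[R]_0)%R.

Lemma lebesgue_rV_box n (A : 'I_n -> set R) : (forall i, measurable (A i)) ->
  lebesgue_rV n [set v | forall i, A i (v ord0 i)] =
  \prod_(i < n) lebesgue_measure (A i).
Proof.
elim: n A => [|n IHn] A mA.
  by rewrite big_ord0 /= diracE mem_set// => -[].
rewrite big_ord_recl -IHn//.
rewrite /= /lebesgue_rVS /pushforward -product_measure1E//.
  congr (_ _); apply/seteqP; split => [[x v] /= H|[x v] /= [H0 H] i].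
    split => [|j].
      by have := H ord0; rewrite mxE unlift_none.
    by have := H (lift ord0 j); rewrite mxE liftK.
  by rewrite mxE; case: unliftP => [j ->|->].
  by exact: mA.
pose B := \bigcap_(i in [set: 'I_n])
  ((fun v : 'rV[R]_n => v ord0 i) @^-1` A (lift ord0 i)).
rewrite (_ : (fun v => _) = B); last first.
  by apply/seteqP; split => v /= H i; [move=> _|]; exact: H.
apply: fin_bigcap_measurable => // i _.
by rewrite -[X in measurable X]setTI; exact: measurable_coord.
Qed.

End lebesgue_rV.

(* L^2(D, mu) is the set of functions f whose extension by 0 outside D is
   square integrable; its elements are identified when they agree
   mu-almost everywhere on D. *)
Section L2.
Context d (T : measurableType d) {R : realType}.
Variables (mu : {measure set T -> \bar R}) (D : set T).
Implicit Types (f g : T -> R) (E : set (T -> R)).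

Definition L2 : set (T -> R) := [set f | f \_ D \in Lfun mu 2%:E].

Definition L2norm f : \bar R := 'N[mu]_2%:E[EFin \o (f \_ D)].

Definition L2dot f g : R := \int[mu]_(x in D) (f x * g x).

Definition L2free n (f : 'I_n -> T -> R) :=
  forall c : 'I_n -> R,
    (fun x => \sum_(i < n) c i * f i x) = (fun=> 0) %[ae mu in D] ->
    forall i, c i = 0.

Definition L2has_dim E (n : nat) :=
  (exists f : 'I_n -> T -> R, (forall i, E (f i)) /\ L2free f) /\
  (forall f : 'I_n.+1 -> T -> R, (forall i, E (f i)) -> ~ L2free f).

Definition L2eigenspace (A : (T -> R) -> (T -> R)) (lam : R) : set (T -> R) :=
  [set f | L2 f /\ A f = (fun x => lam * f x) %[ae mu in D]].

(* sum of a family in L^2(D, mu), as the limit of the net of finite sums *)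
Definition L2is_sum (I : choiceType) (u : I -> T -> R) f :=
  forall e : R, 0 < e -> exists F0 : {fset I}, forall F : {fset I},
    (F0 `<=` F)%fset ->
    (L2norm (fun x => (f x - \sum_(i <- F) u i x)%R) < e%:E)%E.

End L2.

Section singular_values.
Context d1 d2 (X : measurableType d1) (Y : measurableType d2) {R : realType}.
Variables (mu : {measure set X -> \bar R}) (D : set X).
Variables (nu : {measure set Y -> \bar R}) (E : set Y).
Implicit Types (A : (X -> R) -> (Y -> R)) (B : (Y -> R) -> (X -> R)).

Definition L2adjoint A B :=
  [/\ forall f, L2 mu D f -> L2 nu E (A f),
      forall g, L2 nu E g -> L2 mu D (B g) &
      forall f g, L2 mu D f -> L2 nu E g ->
        L2dot nu E (A f) g = L2dot mu D f (B g)].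

(* [s n], n >= 1, is the sequence of singular values of A (s 0 is unused), where
   A is meant to be a compact linear operator from L^2(D, mu) to L^2(E, nu):
   it is nonincreasing and takes each value sigma > 0 exactly as many times as
   the multiplicity of sigma ^+ 2 as an eigenvalue of A^* A. If A has finite
   rank, this forces s to be 0 from some index on. *)
Definition singular_values A (s : nat -> R) :=
  exists2 B, L2adjoint A B &
    [/\ forall n, (0 < n)%N -> 0 <= s n,
        forall m n, (0 < m)%N -> (m <= n)%N -> s n <= s m &
        forall lam : R, 0 < lam ->
          exists2 m, L2has_dim mu D (L2eigenspace mu D (B \o A) lam) m &
            ([set n | (0 < n)%N /\ s n ^+ 2 = lam] #= `I_m)%card].

End singular_values.

Section kernels.
Context {R : realType} (d' d : nat).
Variables (Om' : set 'rV[R]_d') (Om : set 'rV[R]_d).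
Variable k : 'rV[R]_d' -> 'rV[R]_d -> R.

Definition L2kernel :=
  L2 (lebesgue_rV d' \x lebesgue_rV d)%E (Om' `*` Om) (fun z => k z.1 z.2).

Definition integral_operator (phi : 'rV[R]_d -> R) : 'rV[R]_d' -> R :=
  fun x => \int[lebesgue_rV d]_(y in Om) (k x y * phi y).

Definition monomial (y : 'rV[R]_d) (I : {ffun 'I_d -> nat}) : R :=
  \prod_(i < d) y ord0 i ^+ I i.

Definition mdegree (I : {ffun 'I_d -> nat}) : nat := (\sum_(i < d) I i)%N.

(* [kt] is the extension of k to y in U; the norm `|_| of 'rV[R]_d is the sup
   norm. *)
Definition analytic_kernel :=
  exists (U : set 'rV[R]_d) (kt : 'rV[R]_d' -> 'rV[R]_d -> R),
  [/\ open U /\ closure Om `<=` U,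
      forall y, U y -> L2 (lebesgue_rV d') Om' (kt ^~ y),
      forall y, Om y -> kt ^~ y = k ^~ y %[ae lebesgue_rV d' in Om'] &
      forall y0, U y0 ->
      exists (a : {ffun 'I_d -> nat} -> 'rV[R]_d' -> R) (r : R),
      [/\ 0 < r,
          forall I, L2 (lebesgue_rV d') Om' (a I),
          (\esum_(I in [set: {ffun 'I_d -> nat}])
             (L2norm (lebesgue_rV d') Om' (a I) * (r ^+ mdegree I)%:E)
             < +oo)%E &
          forall y, `|y - y0| < r -> U y /\
            L2is_sum (lebesgue_rV d') Om'
              (fun I x => a I x * monomial (y - y0) I) (kt ^~ y)]].

End kernels.

(* Main.v *)
Require Import Defs.
From HB Require Import structures.
From mathcomp Require Import all_boot all_order all_algebra finmap.
From mathcomp Require Import all_classical all_reals all_analysis.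
From mathcomp Require Import measurable_realfun.
From mathcomp Require Import ring lra.

Set Implicit Arguments.
Unset Strict Implicit.
Unset Printing Implicit Defensive.
Import Order.TTheory GRing.Theory Num.Theory.
Import numFieldTopology.Exports numFieldNormedType.Exports.

Local Open Scope classical_set_scope.
Local Open Scope ring_scope.

(** Write <f, g> for the inner product of L^2(Om) and b f g = <K f, K g>. The
squares of the singular values of K are the eigenvalues of the form b relative
to the inner product, and everything is done with these two forms.

Spectral theory. Compactness of K says that, for every eps > 0, b f f is at most
eps <f, f> plus finitely many squares <f, v_i>^2. Under this condition b f f has
a maximizer on the unit ball [max_eigenvector]; it is an eigenvector, and
subtracting it from b and starting again gives orthogonal eigenvectors e_n with
nonincreasing eigenvalues lam_n that exhaust b [exists_eigen_system]. Since the
eigenvalues with their multiplicities depend only on b, every sequence of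
singular values is n |-> sqrt lam_(n-1) [singular_values_unique]. Counting
dimensions gives the two halves of the min-max principle: lam_n <= eps if n
vectors v_i suffice for eps [eigen_val_le_approx], and lam_n >= t if
b f f >= t <f, f> on a space of dimension n + 1 [eigen_val_ge].

Upper bound. Near each point of the closure of Om the kernel is a power series
in y; on the ball of half the radius, keeping the multi-indices with entries
smaller than N leaves an error O(2^-N) in L^2(Om'). Finitely many such balls
cover Om, say L, so K is at Hilbert-Schmidt distance O(2^-N) from a kernel that
is a sum of L N^d products [approximable_analytic]. Thus s_n(K) = O(2^-N) for
n > L N^d, and the largest such N is at least of the order of n^(1/d)
[stretched_exponential_bound].

Optimality. Let e_J be the products of cosines indexed by multi-indices J that
are orthogonal on a cube inside Om, let v_J be normalized indicators of disjoint
subsets of Om', and put k(x, y) = sum_J tau^(max J) v_J(x) e_J(y). The Taylor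
coefficients of e_J are bounded on polydiscs of small radius by rho^-(max J),
with rho < 1 as close to 1 as needed, which the factor tau^(max J) absorbs:
k is analytic in y on the whole of R^d [optimal_analytic_kernel]. On the span of
the N^d functions e_J with max J < N, cut off to the cube, K is bounded below by
c tau^(N-1) [kernel_form_waves_ge], hence s_n(K) >= c tau^(N-1) for n <= N^d;
for the least such N one has (N - 1)^d < n. *)

(** * Positive forms and maximal eigenvectors *)

Section forms.
Context {R : realType} {E : lmodType R}.

Record psd_form := PSDForm {
  form :> E -> E -> R;
  form_sym : forall f g, form f g = form g f;
  form_lin : forall a f g h, form (a *: f + g) h = a * form f h + form g h;
  form_ge0 : forall f, 0 <= form f f }.

Section theory.
Variable b : psd_form.
Implicit Types f g h : E.

Lemma formDl f g h : b (f + g) h = b f h + b g h.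
Proof. by rewrite -[f]scale1r form_lin mul1r scale1r. Qed.

Lemma form0l h : b 0 h = 0.
Proof. by apply: (addIr (b 0 h)); rewrite -formDl addr0 add0r. Qed.

Lemma formZl a f h : b (a *: f) h = a * b f h.
Proof. by rewrite -[a *: f]addr0 form_lin form0l addr0. Qed.

Lemma formBl f g h : b (f - g) h = b f h - b g h.
Proof. by rewrite formDl -scaleN1r formZl mulN1r. Qed.

Lemma formDr f g h : b h (f + g) = b h f + b h g.
Proof. by rewrite form_sym formDl !(form_sym b h). Qed.

Lemma formZr a f h : b h (a *: f) = a * b h f.
Proof. by rewrite form_sym formZl (form_sym b h). Qed.

Lemma formBr f g h : b h (f - g) = b h f - b h g.
Proof. by rewrite form_sym formBl !(form_sym b h). Qed.

Lemma form_suml n (u : 'I_n -> E) h :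
  b (\sum_i u i) h = \sum_i b (u i) h.
Proof.
by apply: (big_morph (b ^~ h)) => [f g|]; [exact: formDl|exact: form0l].
Qed.

Lemma form_lincombl n (c : 'I_n -> R) (u : 'I_n -> E) h :
  b (\sum_i c i *: u i) h = \sum_i c i * b (u i) h.
Proof. by rewrite form_suml; apply: eq_bigr => i _; rewrite formZl. Qed.

Lemma form_addsq_le f g : b (f + g) (f + g) <= 2 * b f f + 2 * b g g.
Proof.
have := form_ge0 b (f - g).
by rewrite formBl !formBr formDl !formDr (form_sym b g f); lra.
Qed.

Lemma form_subsq_le f g : b (f - g) (f - g) <= 2 * b f f + 2 * b g g.
Proof.
have := form_ge0 b (f + g).
by rewrite formBl !formBr formDl !formDr (form_sym b g f); lra.
Qed.

Lemma form_cauchy_schwarz f g : b f g ^+ 2 <= b f f * b g g.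
Proof.
have Q t : 0 <= b f f + 2 * t * b f g + t ^+ 2 * b g g.
  have := form_ge0 b (f + t *: g).
  rewrite formDl !formDr !formZl !formZr (form_sym b g f).
  by move/le_trans; apply; rewrite le_eqVlt; apply/orP; left; apply/eqP; ring.
have := form_ge0 b g; rewrite le_eqVlt => /predU1P[g0|g0].
  rewrite -g0 mulr0; have [->|fg0] := eqVneq (b f g) 0; first by rewrite expr0n.
  have := Q (- (b f f + 1) / (2 * b f g)); rewrite -g0 mulr0 addr0.
  rewrite (_ : 2 * _ * _ = - (b f f + 1)); last by field.
  by lra.
have := Q (- b f g / b g g).
rewrite (_ : b f f + _ + _ = (b f f * b g g - b f g ^+ 2) / b g g); last first.
  by field; rewrite gt_eqF.
by rewrite pmulr_lge0 ?invr_gt0// subr_ge0.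
Qed.

Lemma form_null f g : b f f = 0 -> b f g = 0.
Proof.
move=> f0; have := form_cauchy_schwarz f g; rewrite f0 mul0r => fg.
by apply/eqP; rewrite -sqrf_eq0 eq_le fg sqr_ge0.
Qed.

End theory.

(** For b of the form (f, g) |-> <K f, K g> this expresses, without mentioning
the codomain of K, that K is within sqrt eps of an operator of rank at most n;
compactness of K is approximability for every eps > 0. *)
Definition approximable (dot b : psd_form) n (eps : R) :=
  exists v : 'I_n -> E,
    forall f, b f f <= eps * dot f f + \sum_i dot f (v i) ^+ 2.

(** Every Cauchy sequence has a subsequence of this rate; 16^-k leaves room for
the factor 4^k by which the proof for L^2 weights the squares of the increments. *)
Definition dot_complete (dot : psd_form) := forall (C : R) (u : nat -> E),
  (forall k, dot (u k.+1 - u k) (u k.+1 - u k) <= C * 16^-1 ^+ k) ->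
  exists f, forall e : R, 0 < e -> exists k0, forall k, (k0 <= k)%N ->
    dot (u k - f) (u k - f) < e.

(** Eigenvectors, freeness and dimension are expressed through the forms alone,
hence insensitive to vectors of norm 0: no quotient of E is needed when E is a
space of functions, those equal almost everywhere not being identified. *)
Definition form_eigen (dot b : psd_form) (lam : R) : set E :=
  [set f | forall g, b f g = lam * dot f g].

Definition form_free (dot : psd_form) n (f : 'I_n -> E) := forall c : 'I_n -> R,
  dot (\sum_i c i *: f i) (\sum_i c i *: f i) = 0 -> forall i, c i = 0.

Definition form_has_dim (dot : psd_form) (V : set E) n :=
  (exists f : 'I_n -> E, (forall i, V (f i)) /\ form_free dot f) /\
  (forall f : 'I_n.+1 -> E, (forall i, V (f i)) -> ~ form_free dot f).

End forms.
Arguments psd_form {R} E.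

Lemma nontrivial_relation (F : fieldType) n m (A : 'I_n -> 'I_m -> F) :
  (m < n)%N ->
  exists2 c : 'I_n -> F, (exists i, c i != 0) &
    forall j, \sum_i c i * A i j = 0.
Proof.
move=> mn; pose M := \matrix_(i, j) A i j.
have : kermx M != 0.
  rewrite -mxrank_eq0 mxrank_ker -lt0n subn_gt0.
  exact: leq_ltn_trans (rank_leq_col M) mn.
case/rowV0Pn => v /sub_kermxP vM /rV0Pn[i vi0].
exists (v ord0) => [|j]; first by exists i.
have /rowP/(_ j) := vM; rewrite !mxE => vMj.
rewrite -[RHS]vMj; by under [RHS]eq_bigr do rewrite mxE.
Qed.

Section maximum.
Context {R : realType} {E : lmodType R}.
Variables dot b : psd_form E.
Hypothesis dotC : dot_complete dot.
Hypothesis bC : forall e : R, 0 < e -> exists n, approximable dot b n e.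

Lemma form_bounded : exists2 C : R, 0 <= C & forall f, b f f <= C * dot f f.
Proof.
have [n [v vP]] := bC ltr01.
exists (1 + \sum_i dot (v i) (v i)) => [|f].
  by rewrite addr_ge0// sumr_ge0// => i _; exact: form_ge0.
apply: (le_trans (vP f)); rewrite mulrDl lerD2l mulr_suml ler_sum// => i _.
by rewrite mulrC; exact: form_cauchy_schwarz.
Qed.

(** A maximizing sequence of f |-> b f f on the unit ball need not converge, but
if the numbers <f, v_i> attached to an approximation of b of quality M / 2
cluster, then a subsequence does: q = M <.,.> - b is a positive form, q (f_k)
tends to 0, hence so does q (f_k - f_l), which dominates M / 2 |f_k - f_l|^2 up
to the small numbers <f_k - f_l, v_i>. The limit f satisfies q (f) = 0, and the
Cauchy-Schwarz inequality for q turns this into the eigenvector equation. *)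
Lemma max_eigenvector : exists (e : E) (M : R),
  [/\ 0 <= M, 0 < M -> dot e e = 1, M = 0 -> e = 0, form_eigen dot b M e &
      forall f, b f f <= M * dot f f].
Proof.
have [C C0 CP] := form_bounded.
pose A := [set b f f | f in [set f | dot f f <= 1]].
have A0 : A 0 by exists 0; rewrite /= form0l.
have supA : has_sup A.
  split; first by exists 0.
  exists C => _ [f f1 <-]; apply: (le_trans (CP f)).
  by rewrite -[leRHS]mulr1 ler_wpM2l.
pose M := sup A; have M0 : 0 <= M by exact: sup_upper_bound.
have bM f : b f f <= M * dot f f.
  have := form_ge0 dot f; rewrite le_eqVlt => /predU1P[f0|f0].
    by rewrite -f0 mulr0 (le_trans (CP f))// -f0 mulr0.
  pose c := (Num.sqrt (dot f f))^-1.
  have c2 : c ^+ 2 = (dot f f)^-1 by rewrite exprVn sqr_sqrtr// ltW.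
  have : b (c *: f) (c *: f) <= M.
    apply: sup_upper_bound => //; exists (c *: f) => //=.
    by rewrite formZl formZr mulrA -expr2 c2 mulVf ?gt_eqF.
  by rewrite formZl formZr mulrA -expr2 c2 mulrC ler_pdivrMr.
move: M0; rewrite le_eqVlt => /predU1P[M0|M0].
  exists 0, M; rewrite -M0; split => //; first by rewrite ltxx.
  - by move=> g; rewrite !form0l mulr0.
  - by move=> f; rewrite [X in X * _]M0; exact: bM.
(* q is positive by the choice of M, and a unit vector maximizes b when q
vanishes at it *)
pose q_ f g := M * dot f g - b f g.
have q_sym f g : q_ f g = q_ g f by rewrite /q_ !(form_sym _ f).
have q_lin a f g h : q_ (a *: f + g) h = a * q_ f h + q_ g h.
  by rewrite /q_ !form_lin; ring.
have q_ge0 f : 0 <= q_ f f by rewrite subr_ge0.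
pose q : psd_form E := PSDForm q_sym q_lin q_ge0.
suff [f qf0 f0] : exists2 f, q f f = 0 & 0 < dot f f.
  have eigf : form_eigen dot b M f.
    move=> g; have := form_null g qf0.
    by rewrite /= /q_ => /eqP; rewrite subr_eq0 => /eqP.
  pose c := (Num.sqrt (dot f f))^-1.
  exists (c *: f), M; split => //; first exact: ltW.
  - move=> _; rewrite formZl formZr mulrA -expr2 exprVn sqr_sqrtr ?ltW//.
    by rewrite mulVf ?gt_eqF.
  - by move=> M0'; rewrite M0' ltxx in M0.
  - by move=> g; rewrite !formZl eigf; ring.
(* the quality M / 2 leaves M / 2 * dot in front of the square in vP *)
have [n [v vP]] := bC (divr_gt0 M0 (ltr0n R 2)).
pose d k : R := 16^-1 ^+ k.
have d0 k : 0 < d k by rewrite exprn_gt0// invr_gt0.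
have d1 k : d k <= 1 by rewrite exprn_ile1// ?invr_ge0// invf_le1// ler1n.
have dS k : d k.+1 <= d k by rewrite /d exprSr ler_piMr ?exprn_ge0 ?invf_le1 ?ler1n.
have /choice[f fP] k : exists f, dot f f <= 1 /\ M - d k <= b f f.
  have [_ [f /= f1 <-] fM] := sup_adherent (d0 k) supA.
  by exists f; split => //; exact: ltW.
pose p k : 'rV[R]_n := \row_i dot (f k) (v i).
pose B := [set w : 'rV[R]_n | forall i,
  w ord0 i \in `[- (1 + dot (v i) (v i)), 1 + dot (v i) (v i)]].
have pB k : B (p k).
  move=> i; rewrite mxE in_itv/= -ler_norml.
  have v0 := form_ge0 dot (v i).
  rewrite -(@ler_pXn2r _ 2)// ?nnegrE ?addr_ge0// real_normK ?num_real//.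
  apply: (le_trans (form_cauchy_schwarz dot _ _)).
  apply: (le_trans (ler_wpM2r v0 (proj1 (fP k)))).
  by nra.
have Bcompact : compact B.
  by apply: (rV_compact (A := fun i => `[- (1 + dot (v i) (v i)),
    1 + dot (v i) (v i)]%classic)) => i; exact: segment_compact.
(* the vectors of the inner products with the v_i stay in a compact box *)
have [w [_ wcl]] : B `&` cluster (p @ \oo) !=set0.
  by apply: Bcompact; exists 0%N => // k _; exact: pB.
have /choice[m mP] k : exists m, (k <= m)%N /\ `|p m - w| <= d k.
  have Pm : (p @ \oo) [set p m | m in [set m | (k <= m)%N]].
    by exists k => // l kl; exists l.
  have [_ [[m km <-] wm]] := wcl _ _ Pm (nbhsx_ballx w _ (d0 k)).
  by exists m; split => //; rewrite distrC ltW//; move: wm; rewrite -ball_normE.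
pose g k := f (m k).
have dm k : d (m k) <= d k.
  by apply: ler_wiXn2l (proj1 (mP k)); rewrite ?invr_ge0 ?invf_le1 ?ler1n.
have bg k : M - d k <= b (g k) (g k).
  by apply: le_trans (proj2 (fP _)); rewrite lerD2l lerN2.
have qg k : q (g k) (g k) <= d k.
  have : M * dot (g k) (g k) <= M.
    by rewrite -[leRHS]mulr1 ler_wpM2l ?(ltW M0)//; exact: (proj1 (fP _)).
  by have := bg k; rewrite /q /= /q_; lra.
pose K := 2 / M * (4 + 4 * n%:R).
have gcauchy k : dot (g k.+1 - g k) (g k.+1 - g k) <= K * 16^-1 ^+ k.
  set h := g k.+1 - g k.
  have qh : q h h <= 4 * d k.
    apply: (le_trans (form_subsq_le _ _ _)).
    by have := qg k; have := qg k.+1; have := dS k; lra.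
  have vh : \sum_i dot h (v i) ^+ 2 <= 4 * n%:R * d k.
    have -> : 4 * n%:R * d k = \sum_(i < n) 4 * d k.
      by rewrite sumr_const card_ord -[RHS]mulr_natr; ring.
    apply: ler_sum => i _.
    have -> : dot h (v i) = (p (m k.+1) - w) ord0 i - (p (m k) - w) ord0 i.
      by rewrite !mxE formBl; ring.
    have wi j : `|(p (m j) - w) ord0 i| <= d j.
      apply: le_trans (proj2 (mP j)).
      rewrite [leRHS]mx_normrE.
      exact: (le_bigmax _ (fun ij => `|(p (m j) - w) ij.1 ij.2|) (ord0, i)).
    have := wi k; have := wi k.+1; have := dS k; have := d1 k; have := d0 k.
    set x := _ ord0 i; set y := (_ - w) ord0 i.
    move=> dk0 dk1 dSk /(le_trans)/(_ dSk); rewrite !ler_norml.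
    move=> /andP[x1 x2] /andP[y1 y2].
    have : (x - y) ^+ 2 <= (2 * d k) ^+ 2.
      by rewrite -subr_ge0 subr_sqr mulr_ge0//; lra.
    by move/le_trans; apply; nra.
  have := vP h; have : M * dot h h - b h h <= 4 * d k by exact: qh.
  rewrite -/(d k) /K => H1 H2.
  rewrite -(@ler_pM2l _ (M / 2)) ?divr_gt0//.
  rewrite (_ : M / 2 * (_ * _) = 4 * d k + 4 * n%:R * d k); last first.
    by field; rewrite gt_eqF.
  lra.
have [f' f'P] := dotC gcauchy.
have f'_near (e : R) : 0 < e -> exists k, dot (g k - f') (g k - f') < e /\ d k < e.
  move=> e0; have [k0 k0P] := f'P _ e0.
  have : d k @[k --> \oo] --> (0 : R) by apply: cvg_expr; rewrite ger0_norm ?invr_ge0 ?invf_lt1 ?ltr1n.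
  move=> /cvgr_lt/(_ _ e0)[k1 _ k1P].
  exists (maxn k0 k1); split; first exact/k0P/leq_maxl.
  exact/k1P/leq_maxr.
exists f'.
  suff small (e : R) : 0 < e -> q f' f' <= e.
    apply/eqP; rewrite eq_le form_ge0 andbT; apply/ler_addgt0Pr => e e0.
    by rewrite add0r; exact: small.
  move=> e0.
  have [e' e'0 e'e] : exists2 e' : R, 0 < e' & e' * (2 + 2 * M) = e.
    by exists (e / (2 + 2 * M)); [rewrite divr_gt0//|rewrite divfK// gt_eqF//]; lra.
  have [k [k1 k2]] := f'_near _ e'0; rewrite -e'e.
  have -> : f' = g k - (g k - f') by rewrite opprB addrCA subrr addr0.
  apply: (le_trans (form_subsq_le _ _ _)).
  have := qg k; have : q (g k - f') (g k - f') <= M * dot (g k - f') (g k - f').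
    by rewrite /q/= /q_ gerBl form_ge0.
  have := ler_wpM2l (ltW M0) (ltW k1); lra.
(* a null limit would make b (g k) (g k) at most M / 2 for large k, while it
tends to M *)
rewrite lt_def form_ge0 andbT; apply/negP => /eqP f'0.
have [k [k1 k2]] : exists k, dot (g k - f') (g k - f') < 4^-1 /\ d k < M / 4.
  have e0 : 0 < Num.min 4^-1 (M / 4) by rewrite lt_min invr_gt0 ltr0n divr_gt0.
  have [k [k1 k2]] := f'_near _ e0.
  by exists k; move: k1 k2; rewrite !lt_min => /andP[-> _] /andP[].
have : dot (g k) (g k) <= 2 * 4^-1.
  have -> : g k = (g k - f') + f' by rewrite subrK.
  apply: (le_trans (form_addsq_le _ _ _)).
  by rewrite f'0; lra.
have := bM (g k); have := bg k; nra.
Qed.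

End maximum.

(** * Eigenvalues of a compact form *)

Section eigen_system.
Context {R : realType} {E : lmodType R}.
Variable dot : psd_form E.

(** A finite sequence of eigenvectors is completed by eigenvalues 0, for which
e_n need not be normalized. *)
Record eigen_system (b : psd_form E) (e : nat -> E) (lam : nat -> R) := {
  eigen_val_ge0 : forall n, 0 <= lam n ;
  eigen_val_noninc : forall m n, (m <= n)%N -> lam n <= lam m ;
  eigen_vec_norm : forall n, 0 < lam n -> dot (e n) (e n) = 1 ;
  eigen_vec_orth : forall i j, i != j -> dot (e i) (e j) = 0 ;
  eigen_vecP : forall n, form_eigen dot b (lam n) (e n) ;
  eigen_val_max : forall n f, (forall i, (i < n)%N -> dot f (e i) = 0) ->
    b f f <= lam n * dot f f }.

(** The new form at (f, f) is b at (g, g) for g = f - <f, e> e, the part of f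
orthogonal to e; whence its positivity. *)
Lemma deflation (b : psd_form E) (e : E) (M : R) :
  0 <= M -> (0 < M -> dot e e = 1) -> form_eigen dot b M e ->
  exists b' : psd_form E, forall f g, b' f g = b f g - M * dot f e * dot g e.
Proof.
move=> M0 e1 eigM; pose b' f g := b f g - M * dot f e * dot g e.
have sym f g : b' f g = b' g f by rewrite /b' (form_sym b); ring.
have lin a f g h : b' (a *: f + g) h = a * b' f h + b' g h.
  by rewrite /b' !form_lin; ring.
suff ge0 f : 0 <= b' f f by exists (PSDForm sym lin ge0).
move: M0; rewrite le_eqVlt => /predU1P[M0|M0].
  by rewrite /b' -M0 !mul0r subr0 form_ge0.
have := form_ge0 b (f - dot f e *: e).
rewrite /b' formBl !formBr !formZl !formZr (form_sym b f e) !eigM.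
rewrite e1// (form_sym dot e f).
by move/le_trans; apply; rewrite le_eqVlt; apply/orP; left; apply/eqP; ring.
Qed.

(** The eigenvectors are found one at a time: subtracting
lam <., e> <., e> from b moves e into the kernel, keeps the form positive and
only makes it smaller, so the maximum of the new form is the next eigenvalue. *)
Lemma exists_eigen_system (b : psd_form E) : dot_complete dot ->
  (forall eps : R, 0 < eps -> exists n, approximable dot b n eps) ->
  exists e lam, eigen_system b e lam.
Proof.
move=> dotC bC.
pose compact_form (b : psd_form E) :=
  forall eps : R, 0 < eps -> exists n, approximable dot b n eps.
have /choice[F FP] (c : psd_form E) : exists p : E * R * psd_form E,
    compact_form c ->
  [/\ 0 <= p.1.2, 0 < p.1.2 -> dot p.1.1 p.1.1 = 1, p.1.2 = 0 -> p.1.1 = 0,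
      form_eigen dot c p.1.2 p.1.1 &
      forall f, c f f <= p.1.2 * dot f f] /\
  (forall f g, p.2 f g = c f g - p.1.2 * dot f p.1.1 * dot g p.1.1).
  have [cC|] := pselect (compact_form c); last by exists (0, 0, c).
  have [e [M [M0 e1 e0 eigM maxM]]] := max_eigenvector dotC cC.
  have [b' b'P] := deflation M0 e1 eigM.
  by exists (e, M, b').
pose B n := iter n (fun c => (F c).2) b.
have BC n : compact_form (B n).
  elim: n => [//|n IH eps eps0]; have [m [v vP]] := IH _ eps0.
  have [[l0 _ _ _ _] BS] := FP _ IH.
  exists m, v => f; rewrite /= BS; apply: le_trans (vP f).
  by rewrite gerBl -mulrA mulr_ge0// -expr2 sqr_ge0.
pose e n := (F (B n)).1.1; pose lam n := (F (B n)).1.2.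
have l0 n : 0 <= lam n by have [[]] := FP _ (BC n).
have e1 n : 0 < lam n -> dot (e n) (e n) = 1 by have [[]] := FP _ (BC n).
have e0 n : lam n = 0 -> e n = 0 by have [[]] := FP _ (BC n).
have eig n : form_eigen dot (B n) (lam n) (e n) by have [[]] := FP _ (BC n).
have lmax n f : B n f f <= lam n * dot f f by have [[_ _ _ _]] := FP _ (BC n).
have BS n f g : B n.+1 f g = B n f g - lam n * dot f (e n) * dot g (e n).
  by have [_] := FP _ (BC n); exact.
have ker i n g : (i < n)%N -> B n (e i) g = 0.
  elim: n g => // n IH g; rewrite ltnS leq_eqVlt BS => /predU1P[->|ilen].
    have := l0 n; rewrite le_eqVlt => /predU1P[ln0|ln0].
      by rewrite eig -ln0; ring.
    by rewrite eig e1// (form_sym dot g); ring.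
  have eni : lam n * dot (e i) (e n) = 0.
    by rewrite (form_sym dot) -eig form_sym IH.
  by rewrite eni mul0r subr0 IH.
have orth i j : (i < j)%N -> dot (e j) (e i) = 0.
  move=> ij; have := l0 j; rewrite le_eqVlt => /predU1P[lj0|lj0].
    by rewrite e0// form0l.
  have := eig j (e i); rewrite form_sym ker// => /esym/eqP.
  by rewrite mulf_eq0 gt_eqF//= => /eqP.
have Borth n f : (forall i, (i < n)%N -> dot f (e i) = 0) ->
    forall g, B n f g = b f g.
  elim: n => // n IH fe g; rewrite BS fe// mulr0 mul0r subr0 IH// => i ilen.
  by rewrite fe// (ltn_trans ilen).
exists e, lam; split => //.
- apply/nonincreasing_seqP => n.
  have [->|ln0] : lam n.+1 = 0 \/ 0 < lam n.+1.
  + by have := l0 n.+1; rewrite le_eqVlt => /predU1P[<-|]; [left|right].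
  + exact: l0.
  rewrite -[leLHS]mulr1 -(e1 _ ln0) -eig BS.
  rewrite -mulrA -expr2; apply: (@le_trans _ _ (B n (e n.+1) (e n.+1))).
    by rewrite gerBl mulr_ge0// sqr_ge0.
  by apply: (le_trans (lmax _ _)); rewrite e1// mulr1.
- move=> i j; case: ltngtP => // ij _; last exact: orth.
  by rewrite form_sym orth.
- by move=> n g; rewrite -eig Borth// => i; exact: orth.
- by move=> n f fe; rewrite -(Borth n)// lmax.
Qed.

Section bounds.
Variables (b : psd_form E) (e : nat -> E) (lam : nat -> R).
Hypothesis sys : eigen_system b e lam.

Lemma dot_eigen_comb n (c : 'I_n -> R) (u : 'I_n -> nat) (j : 'I_n) :
  injective u -> dot (\sum_i c i *: e (u i)) (e (u j)) =
    c j * dot (e (u j)) (e (u j)).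
Proof.
move=> uinj; rewrite form_lincombl (bigD1 j)//= big1 ?addr0// => i ij.
by rewrite (eigen_vec_orth sys) ?mulr0// (inj_eq uinj).
Qed.

Lemma eigen_vec_free n (u : 'I_n -> nat) :
  injective u -> (forall i, 0 < lam (u i)) -> form_free dot (fun i => e (u i)).
Proof.
move=> uinj u0 c cnull j; have := form_null (e (u j)) cnull.
by rewrite dot_eigen_comb// (eigen_vec_norm sys)// mulr1.
Qed.

(** If lam_n > 0, the eigenvectors e_0, ..., e_n span a space of dimension n + 1,
which contains a nonzero f orthogonal to the m <= n vectors of the
approximation; for it lam_n <f, f> <= b f f <= eps <f, f>. *)
Lemma eigen_val_le_approx n m (eps : R) : 0 <= eps -> (m <= n)%N ->
  approximable dot b m eps -> lam n <= eps.
Proof.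
move=> eps0 mn [v vP]; rewrite leNgt; apply/negP => leps.
have l0 : 0 < lam n by exact: le_lt_trans leps.
have [c [i0 ci0] cv] := @nontrivial_relation R n.+1 m
  (fun i j => dot (e i) (v j)) mn.
pose f := \sum_(i < n.+1) c i *: e i.
have lpos (i : 'I_n.+1) : 0 < lam i.
  by apply: (lt_le_trans l0); apply: (eigen_val_noninc sys); rewrite -ltnS.
have fe (j : 'I_n.+1) : dot f (e j) = c j.
  by rewrite (dot_eigen_comb _ _ (@ord_inj _)) (eigen_vec_norm sys)// mulr1.
have ff : dot f f = \sum_(i < n.+1) c i ^+ 2.
  by rewrite {1}/f form_lincombl; apply: eq_bigr => i _; rewrite form_sym fe.
have ff0 : 0 < dot f f.
  rewrite ff (bigD1 i0)//= ltr_pwDl//; first by rewrite exprn_even_gt0.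
  by rewrite sumr_ge0// => i _; exact: sqr_ge0.
have bff : lam n * dot f f <= b f f.
  have -> : b f f = \sum_(i < n.+1) c i * b (e i) f.
    by rewrite {1}/f form_lincombl.
  rewrite ff mulr_sumr ler_sum// => i _.
  rewrite (eigen_vecP sys) (form_sym dot) fe.
  rewrite [leRHS]mulrCA -expr2.
  rewrite ler_wpM2r ?sqr_ge0//.
  by apply: (eigen_val_noninc sys); rewrite -ltnS.
have := vP f; rewrite big1 ?addr0 => [|i _]; last first.
  by rewrite form_lincombl cv expr0n.
move=> /(le_trans bff); rewrite ler_pM2r// leNgt.
by rewrite leps.
Qed.

(** A space of dimension n + 1 contains a nonzero f orthogonal to
e_0, ..., e_(n-1), for which b f f <= lam_n <f, f>. *)
Lemma eigen_val_ge n (w : 'I_n.+1 -> E) (t : R) : form_free dot w ->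
  (forall c : 'I_n.+1 -> R, let f := \sum_i c i *: w i in
     t * dot f f <= b f f) -> t <= lam n.
Proof.
move=> wfree tb.
have [c [i0 ci0] ce] := @nontrivial_relation R n.+1 n
  (fun i j => dot (w i) (e j)) (ltnSn n).
pose f := \sum_i c i *: w i.
have ff0 : 0 < dot f f.
  rewrite lt_def form_ge0 andbT; apply/negP => /eqP/wfree/(_ i0) c0.
  by rewrite c0 eqxx in ci0.
rewrite -(ler_pM2r ff0); apply: (le_trans (tb c)).
apply: (eigen_val_max sys) => i ilen.
by rewrite form_lincombl -[RHS](ce (Ordinal ilen)).
Qed.

End bounds.

Section multiplicity.
Variables (b : psd_form E) (e : nat -> E) (lam : nat -> R).
Hypothesis sys : eigen_system b e lam.
Hypothesis bC : forall eps : R, 0 < eps -> exists n, approximable dot b n eps.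

Lemma eigen_val_cvg0 (t : R) : 0 < t -> exists P, lam P < t.
Proof.
move=> t0; have [n nP] := bC (divr_gt0 t0 (ltr0n R 2)); exists n.
apply: le_lt_trans (eigen_val_le_approx sys _ (leqnn n) nP) _; lra.
Qed.

(** The e_n with lam_n = t span the eigenspace of t: an eigenvector orthogonal to
all of them is orthogonal to every e_n, and lam_n -> 0 makes it null. *)
Lemma form_has_dim_eigen (t : R) : 0 < t ->
  exists2 s : seq nat, uniq s /\ (forall n, n \in s = (lam n == t)) &
    form_has_dim dot (form_eigen dot b t) (size s).
Proof.
move=> t0; have [P lP] := eigen_val_cvg0 t0.
pose s := [seq n <- iota 0 P | lam n == t].
have memP n : n \in s = (lam n == t).
  rewrite mem_filter mem_iota add0n andb_idr//= => /eqP lnt.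
  rewrite ltnNge; apply/negP => /(eigen_val_noninc sys).
  by rewrite lnt leNgt lP.
have us : uniq s by rewrite filter_uniq ?iota_uniq.
exists s => //; split.
  exists (fun i => e (nth 0%N s i)).
  have snt (i : 'I_(size s)) : lam (nth 0%N s i) = t.
    by apply/eqP; rewrite -memP mem_nth.
  split=> [i|]; first by rewrite -(snt i); exact: (eigen_vecP sys).
  apply: (eigen_vec_free sys (u := fun i : 'I_(size s) => nth 0%N s i)).
    by move=> i j /eqP; rewrite nth_uniq// => /eqP/ord_inj.
  by move=> i; rewrite snt.
move=> f eigf ffree.
have [c [i0 ci0] ce] := @nontrivial_relation R _ (size s)
  (fun i j => dot (f i) (e (nth 0%N s j))) (ltnSn _).
pose g := \sum_i c i *: f i.
have eigg : form_eigen dot b t g.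
  move=> h; rewrite !form_lincombl mulr_sumr; apply: eq_bigr => i _.
  by rewrite eigf mulrCA.
have ge n : dot g (e n) = 0.
  have [ns|ns] := boolP (n \in s).
    have := ce (Ordinal (etrans (index_mem n s) ns)) => /=.
    by rewrite nth_index// -form_lincombl.
  (* eigenvectors for distinct eigenvalues are orthogonal *)
  have : t * dot g (e n) = lam n * dot g (e n).
    by rewrite -eigg form_sym (eigen_vecP sys) (form_sym dot g).
  move/eqP; rewrite -subr_eq0 -mulrBl mulf_eq0 subr_eq0 eq_sym -memP.
  by rewrite (negbTE ns) => /eqP.
have gg0 : dot g g = 0.
  have := eigen_val_max sys (n := P) (fun i _ => ge i).
  rewrite eigg => H; apply/eqP; rewrite eq_le form_ge0 andbT.
  rewrite leNgt; apply/negP => g0.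
  by move: H; rewrite ler_pM2r// leNgt lP.
by have := ffree _ gg0 i0; move/eqP; rewrite (negbTE ci0).
Qed.

End multiplicity.
End eigen_system.

Lemma form_has_dim_uniq (R : realType) (E : lmodType R) (dot : psd_form E)
    (V : set E) m n :
  form_has_dim dot V m -> form_has_dim dot V n -> m = n.
Proof.
suff le k l : form_has_dim dot V k -> form_has_dim dot V l -> (k <= l)%N.
  by move=> hm hn; apply/eqP; rewrite eqn_leq !le.
move=> [[f [fV ffree]] _] [_ /(_ _ _)H]; rewrite leqNgt; apply/negP => lk.
apply: (H (fun i => f (widen_ord lk i))) => [i|c cnull i]; first exact: fV.
pose c' (j : 'I_k) := if insub (j : nat) is Some i then c i else 0.
have c'w i' : c' (widen_ord lk i') = c i'.
  rewrite /c' insubT ?ltn_ord//= => Hi; congr c; exact: val_inj.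
have c'sum : \sum_j c' j *: f j = \sum_i c i *: f (widen_ord lk i).
  rewrite (bigID (fun j : 'I_k => (j < l.+1)%N))/= [X in _ + X]big1 ?addr0.
    by rewrite (big_ord_narrow lk); apply: eq_bigr => i' _; rewrite c'w.
  by move=> j jl; rewrite /c' insubF ?scale0r//; exact: negbTE.
by rewrite -c'w; apply: ffree; rewrite c'sum.
Qed.

(** A nonincreasing sequence is determined by the multiplicities of its positive
values: at the first place where two such sequences differ, the larger of the
two values would occur more often in one of them. *)
Lemma noninc_multiplicity_eq (R : realType) (s t : nat -> R) :
  (forall n, (0 < n)%N -> 0 <= s n) -> (forall n, (0 < n)%N -> 0 <= t n) ->
  (forall m n, (0 < m)%N -> (m <= n)%N -> s n <= s m) ->
  (forall m n, (0 < m)%N -> (m <= n)%N -> t n <= t m) ->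
  (forall lam : R, 0 < lam -> exists m,
     ([set n | (0 < n)%N /\ s n ^+ 2 = lam] #= `I_m)%card /\
     ([set n | (0 < n)%N /\ t n ^+ 2 = lam] #= `I_m)%card) ->
  forall n, (0 < n)%N -> s n = t n.
Proof.
suff wlog_lt (u v : nat -> R) :
    (forall n, (0 < n)%N -> 0 <= u n) -> (forall n, (0 < n)%N -> 0 <= v n) ->
    (forall m n, (0 < m)%N -> (m <= n)%N -> v n <= v m) ->
    (forall lam : R, 0 < lam -> exists m,
      ([set n | (0 < n)%N /\ u n ^+ 2 = lam] #= `I_m)%card /\
      ([set n | (0 < n)%N /\ v n ^+ 2 = lam] #= `I_m)%card) ->
    forall n, (0 < n)%N -> (forall k, (0 < k < n)%N -> u k = v k) ->
    u n <= v n.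
  move=> s0 t0 sd td st; elim/ltn_ind => n IH n0; apply/eqP; rewrite eq_le.
  apply/andP; split; apply: wlog_lt => //.
  - by move=> k /andP[k0 kn]; exact: IH.
  - by move=> l /st[m []]; exists m.
  - by move=> k /andP[k0 kn]; rewrite IH.
move=> u0 v0 vd uv n n0 IH; rewrite leNgt; apply/negP => vu.
have un0 : 0 < u n by apply: le_lt_trans vu; exact: v0.
have [m [um vm]] := uv _ (exprn_gt0 2 un0).
set A := [set k | (0 < k)%N /\ u k ^+ 2 = u n ^+ 2] in um.
set B := [set k | (0 < k)%N /\ v k ^+ 2 = u n ^+ 2] in vm.
have BA : B `<=` A `\ n.
  move=> k [k0 /eqP]; rewrite eqrXn2 ?(ltW un0) ?v0// => /eqP vk.
  have kn : (k < n)%N.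
    by rewrite ltnNge; apply/negP => /(vd _ _ n0); rewrite vk leNgt vu.
  split; last by move=> /= kn'; rewrite kn' ltnn in kn.
  by split => //; rewrite IH ?k0// vk.
have finA : finite_set A by exists m.
have finB : finite_set B by exists m.
have cardAB : #|` fset_set B| = #|` fset_set A|.
  by rewrite (card_fset_set um) (card_fset_set vm).
have sub : (fset_set B `<=` fset_set A)%fset.
  by rewrite -fset_set_sub// => k /BA[].
have /(_ n) := fsubset_cardP cardAB sub.
rewrite !in_fset_set//; rewrite [in RHS]mem_set// => /set_mem/BA[_].
by apply.
Qed.

(** * The space of square integrable functions *)

Lemma le1_2e (R : realType) : (1 <= 2%:E :> \bar R)%E.
Proof. by rewrite lee1n. Qed.

Lemma poweR2_ge0 (R : realType) (x : \bar R) :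
  (0 <= x)%E -> (x `^ 2 = x ^+ 2)%E.
Proof.
case: x => [x| |]//; last by move=> _; rewrite poweRyr// expe2 mulyy.
by rewrite lee_fin => x0; rewrite poweR_EFin powR_mulrn// -EFin_expe.
Qed.

Section L2_space.
Context d (X : measurableType d) {R : realType}.
Variable mu : {measure set X -> \bar R}.
Local Notation Lfun2 := (Lfun mu 2%:E).

Lemma Lnorm2_sqr (f : X -> R) :
  ('N[mu]_2%:E[EFin \o f] ^+ 2 = \int[mu]_x (f x ^+ 2)%:E)%E.
Proof.
rewrite -poweR2_ge0 ?Lnorm_ge0// powR_Lnorm//.
apply: eq_integral => x _ /=.
by rewrite powR_mulrn// real_normK// num_real.
Qed.

Lemma integral_sqr_ge0 (D : set X) (f : X -> R) :
  (0 <= \int[mu]_(x in D) (f x ^+ 2)%:E)%E.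
Proof. by apply: integral_ge0 => x _; rewrite lee_fin sqr_ge0. Qed.

Lemma Lfun2P (f : X -> R) :
  f \in Lfun2 <->
  measurable_fun setT f /\ (\int[mu]_x (f x ^+ 2)%:E < +oo)%E.
Proof.
rewrite -Lnorm2_sqr; split=> [|[mf foo]].
  rewrite inE => /andP[/[!inE]/= mf foo]; split => //.
  by rewrite lte_mul_pinfty ?Lnorm_ge0// ge0_fin_numE ?Lnorm_ge0.
apply/andP; split; first by rewrite inE.
rewrite !inE/= /finite_norm ltNge leye_eq; apply/negP => /eqP f_oo.
by move: foo; rewrite f_oo expe2 mulyy ltxx.
Qed.

Lemma Lfun2_measurable (f : X -> R) : f \in Lfun2 -> measurable_fun setT f.
Proof. by case/Lfun2P. Qed.

Lemma Lfun2_dominated (f g : X -> R) : measurable_fun setT f -> g \in Lfun2 ->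
  (forall x, `|f x| <= `|g x|) -> f \in Lfun2.
Proof.
move=> mf /Lfun2P[mg g2] fg; apply/Lfun2P; split => //.
apply: le_lt_trans g2; apply: ge0_le_integral => //.
- by move=> x _; rewrite lee_fin sqr_ge0.
- exact/measurable_EFinP/measurable_funX.
- exact/measurable_EFinP/measurable_funX.
- by move=> x _; rewrite lee_fin -ler_sqrt ?sqr_ge0// !sqrtr_sqr.
Qed.

Lemma Lfun2_restrict (D : set X) (f : X -> R) : measurable D ->
  f \in Lfun2 -> f \_ D \in Lfun2.
Proof.
move=> mD fL; apply: Lfun2_dominated (fL) _ => [|x].
  apply/(measurable_restrictT _ mD).
  exact: measurable_funTS (Lfun2_measurable fL).
by rewrite patchE; case: ifPn => // _; rewrite normr0.
Qed.

Lemma Lfun2_integrableM (f g : X -> R) (D : set X) : measurable D ->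
  f \in Lfun2 -> g \in Lfun2 -> mu.-integrable D (EFin \o (fun x => f x * g x)).
Proof.
move=> mD fL gL; apply: (@integrableS _ _ _ mu setT) => //.
by apply/Lfun1_integrable; exact: Lfun2_mul_Lfun1.
Qed.

Lemma Lfun2_integrable_sq (f : X -> R) (D : set X) : measurable D ->
  f \in Lfun2 -> mu.-integrable D (EFin \o (fun x => f x ^+ 2)).
Proof.
move=> mD fL; apply: (@integrableS _ _ _ mu setT) => //.
exact: Lfun2_integrable_sqr.
Qed.

Lemma L2dotE (D : set X) (f g : X -> R) :
  L2dot mu D f g = L2dot mu setT (f \_ D) (g \_ D).
Proof.
rewrite /L2dot Rintegral_mkcond; apply: eq_Rintegral => x _.
by rewrite !patchE; case: ifPn; rewrite ?mulr0.
Qed.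

Lemma L2dot_sqr (D : set X) (f : X -> R) :
  L2dot mu D f f = fine (\int[mu]_(x in D) (f x ^+ 2)%:E)%E.
Proof. by congr fine; apply: eq_integral => x _; rewrite expr2. Qed.

Local Notation E := (LfunType mu (le1_2e R)).

Definition Lfun2_elt (f : X -> R) (fL : f \in Lfun2) : E := Lfun_Sub (le1_2e R) fL.

Lemma Lfun2_linE a (f g : E) x : (a *: f + g) x = a * f x + g x.
Proof. by []. Qed.

Lemma Lfun2_subE (f g : E) x : (f - g) x = f x - g x.
Proof. by []. Qed.

Lemma Lfun2D (f g : X -> R) : f \in Lfun2 -> g \in Lfun2 ->
  (fun x => f x + g x) \in Lfun2.
Proof. by move=> fL gL; exact: (LfunP (Lfun2_elt fL + Lfun2_elt gL)). Qed.

Lemma Lfun2B (f g : X -> R) : f \in Lfun2 -> g \in Lfun2 ->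
  (fun x => f x - g x) \in Lfun2.
Proof. by move=> fL gL; exact: (LfunP (Lfun2_elt fL - Lfun2_elt gL)). Qed.

Lemma Lfun2Z a (f : X -> R) : f \in Lfun2 -> (fun x => a * f x) \in Lfun2.
Proof. by move=> fL; exact: (LfunP (a *: Lfun2_elt fL)). Qed.

Lemma Lfun2_sum I (s : seq I) (F : I -> X -> R) : (forall i, F i \in Lfun2) ->
  (fun x => \sum_(i <- s) F i x) \in Lfun2.
Proof.
move=> FL; elim: s => [|i s IH].
  under eq_fun do rewrite big_nil.
  exact: (LfunP (0 : E)).
under eq_fun do rewrite big_cons.
exact: Lfun2D.
Qed.

Section dot.
Variable D : set X.
Hypothesis mD : measurable D.

Definition L2dotD (f g : E) : R := L2dot mu D f g.

Let dot_sym f g : L2dotD f g = L2dotD g f.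
Proof. by apply: eq_Rintegral => x _; rewrite mulrC. Qed.

Let dot_lin a f g h : L2dotD (a *: f + g) h = a * L2dotD f h + L2dotD g h.
Proof.
rewrite /L2dotD /L2dot -RintegralZl//; last exact: Lfun2_integrableM (LfunP _) (LfunP _).
rewrite -RintegralD//.
- by apply: eq_Rintegral => x _; rewrite Lfun2_linE; ring.
- rewrite (_ : _ \o _ = (fun x => a%:E * (f x * h x)%:E)%E)//.
  by apply: integrableZl => //; exact: Lfun2_integrableM (LfunP _) (LfunP _).
- exact: Lfun2_integrableM (LfunP _) (LfunP _).
Qed.

Let dot_ge0 f : 0 <= L2dotD f f.
Proof. by apply: Rintegral_ge0 => x _; rewrite -expr2 sqr_ge0. Qed.

Definition L2form : psd_form E := PSDForm dot_sym dot_lin dot_ge0.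

End dot.
End L2_space.

(** * Completeness *)

Lemma geometric_cvgn (R : realType) (a : nat -> R) (S : R) : 0 <= S ->
  (forall k, `|a k.+1 - a k| <= S * 2^-1 ^+ k) ->
  cvgn a /\ forall k, `|limn a - a k| <= 2 * S * 2^-1 ^+ k.
Proof.
move=> S0 aS; pose g k : R := 2 * S * 2^-1 ^+ k.
have gS k : g k - g k.+1 = S * 2^-1 ^+ k by rewrite /g exprS; field.
have g0 k : 0 <= g k by rewrite !mulr_ge0.
have agm k n : (k <= n)%N -> `|a n - a k| <= g k - g n.
  elim: n => [|n IH]; first by rewrite leqn0 => /eqP->; rewrite !subrr normr0.
  rewrite leq_eqVlt => /predU1P[->|]; first by rewrite !subrr normr0.
  rewrite ltnS => /IH kn; rewrite (_ : _ - _ = (a n.+1 - a n) + (a n - a k)).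
    by apply: (le_trans (ler_normD _ _)); have := aS n; have := gS n; lra.
  by rewrite subrKA.
have cvga : cvgn a.
  have cg : cvgn g.
    apply: cvgP (cvg_geometric (2 * S) _).
    by rewrite ger0_norm ?invr_ge0// invf_lt1 ?ltr1n.
  have -> : a = (a \+ g) \- g by apply/funext => n /=; rewrite addrK.
  apply: is_cvgB => //; apply: nonincreasing_is_cvgn.
    move=> k n /agm; rewrite ler_norml => /andP[_] /=; lra.
  exists (a 0%N - g 0%N) => _ [n _ <-] /=.
  by have := agm 0%N n (leq0n _); rewrite ler_norml => /andP[+ _]; have := g0 n; lra.
split=> // k.
have : `|a n - a k| @[n --> \oo] --> `|limn a - a k|.
  by apply: cvg_norm; apply: cvgB => //; exact: cvg_cst.
move=> /cvg_lim <-//; apply: limr_le.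
  by apply: is_cvg_norm; apply: is_cvgB => //; exact: is_cvg_cst.
near=> n; have kn : (k <= n)%N by near: n; exact: nbhs_infty_ge.
by have := agm k n kn; have := g0 n; rewrite -/(g k); lra.
Unshelve. all: by end_near. Qed.

Section completeness.
Context d (X : measurableType d) {R : realType}.
Variable mu : {measure set X -> \bar R}.
Variable D : set X.
Hypothesis mD : measurable D.

(** The Riesz-Fischer theorem. If the differences u_(k+1) - u_k decay like
4^-k, then S = sum_k 4^k (u_(k+1) - u_k)^2 is integrable; where S is finite the
sequence converges, at a rate that S controls pointwise. *)
Lemma L2form_complete : dot_complete (L2form mu mD).
Proof.
move=> C u uC; pose w k := (u k : X -> R) \_ D.
have wL k : w k \in Lfun mu 2%:E by apply: Lfun2_restrict => //; exact: LfunP.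
have mw k : measurable_fun setT (w k) by exact: Lfun2_measurable.
pose h k x := 4 ^+ k * (w k.+1 x - w k x) ^+ 2.
have h0 k x : 0 <= h k x by rewrite mulr_ge0 ?sqr_ge0 ?exprn_ge0.
have mh k : measurable_fun setT (h k).
  apply: measurable_funM => //; apply: measurable_funX.
  exact: measurable_funB.
pose S x := (\sum_(0 <= k <oo) (h k x)%:E)%E.
have S0 x : (0 <= S x)%E by apply: nneseries_ge0 => k _ _; rewrite lee_fin.
have mS : measurable_fun setT S.
  apply: ge0_emeasurable_sum => [k x _ _|k _]; first by rewrite lee_fin.
  exact/measurable_EFinP.
have intu k : (\int[mu]_x ((w k.+1 x - w k x) ^+ 2)%:E =
    (L2form mu mD (u k.+1 - u k) (u k.+1 - u k))%:E)%E.
  rewrite /= /L2dotD L2dot_sqr fineK; last first.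
    exact/integral_fune_fin_num/Lfun2_integrable_sq/LfunP.
  rewrite [RHS]integral_mkcond; apply: eq_integral => x _.
  rewrite /w !patchE Lfun2_subE; case: ifPn => // _.
  by rewrite subrr expr0n.
have intS : (\int[mu]_x S x <= (C * (4 / 3))%:E)%E.
  rewrite integral_nneseries//; last 2 first.
  - by move=> k; exact/measurable_EFinP.
  - by move=> k x _; rewrite lee_fin.
  apply: lime_le.
    by apply: is_cvg_nneseries => k _ _; apply: integral_ge0 => x _; rewrite lee_fin.
  apply: nearW => n.
  apply: (@le_trans _ _ (\sum_(0 <= k < n) (C * 4^-1 ^+ k)%:E)%E).
    apply: lee_sum => k _.
    rewrite (eq_integral (fun x => (4 ^+ k)%:E * ((w k.+1 x - w k x) ^+ 2)%:E)%E)//.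
    rewrite ge0_integralZl ?lee_fin ?exprn_ge0//; last 2 first.
    - exact/measurable_EFinP/measurable_funX/measurable_funB.
    - by move=> x _; rewrite lee_fin sqr_ge0.
    rewrite intu -EFinM lee_fin; apply: (le_trans (ler_wpM2l _ (uC k))).
      by rewrite exprn_ge0.
    rewrite mulrCA -exprMn (_ : 4 * 16^-1 = 4^-1 :> R)//; by field.
  rewrite sumEFin lee_fin -mulr_sumr.
  have C0 : 0 <= C.
    have := le_trans (form_ge0 (L2form mu mD) _) (uC 0%N).
    by rewrite expr0 mulr1.
  apply: ler_wpM2l => //.
  have -> : \sum_(0 <= i < n) 4^-1 ^+ i = (1 - 4^-1 ^+ n) * (4 / 3) :> R.
    elim: n => [|n IH]; first by rewrite big_nil expr0 subrr mul0r.
    by rewrite big_nat_recr//= IH exprS; field.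
  have : 0 <= (4^-1 : R) ^+ n by rewrite exprn_ge0.
  by move: (_ ^+ n) => q q0; lra.
pose A := [set x | (S x < +oo)%E].
have mA : measurable A.
  by rewrite -[A]setTI; exact: emeasurable_fun_infty_o.
pose v k := w k \_ A.
have mv k : measurable_fun setT (v k).
  apply/(measurable_restrictT (w k) mA); apply: measurable_funTS; exact: mw.
have vgeo x k : `|v k.+1 x - v k x| <= Num.sqrt (fine (S x)) * 2^-1 ^+ k.
  rewrite /v !patchE; case: ifPn => [/set_mem /= Sfin|_]; last first.
    by rewrite subrr normr0 mulr_ge0 ?sqrtr_ge0 ?exprn_ge0.
  have Sx : S x = (fine (S x))%:E by rewrite fineK// ge0_fin_numE.
  have : ((h k x)%:E <= S x)%E.
    apply: le_trans (nneseries_lim_ge k.+1 _); last first.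
      by move=> n _; rewrite lee_fin.
    by rewrite big_nat_recr//= leeDr// sume_ge0// => i _; rewrite lee_fin.
  rewrite Sx lee_fin /h /= -ler_pdivlMl ?exprn_gt0// => hS.
  rewrite -sqrtr_sqr -[X in _ * X]ger0_norm ?exprn_ge0// -sqrtr_sqr -sqrtrM.
    rewrite ler_sqrt ?mulr_ge0 ?fine_ge0 ?sqr_ge0//.
    rewrite (_ : (2^-1 ^+ k) ^+ 2 = (4 ^+ k)^-1) 1?mulrC//.
    by rewrite -exprVn exprAC; congr (_ ^+ k); field.
  by rewrite fine_ge0.
pose f x := limn (v ^~ x).
have mf : measurable_fun setT f.
  apply: (measurable_fun_cvg mv) => x _.
  by have [] := @geometric_cvgn _ (v ^~ x) _ (sqrtr_ge0 _) (vgeo x).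
have fw k x : (((w k x - f x) ^+ 2)%:E <= (4 * 4^-1 ^+ k)%:E * S x)%E.
  have [xA|/negP] := boolP (S x < +oo)%E; last first.
    rewrite ltey => /negP; rewrite negbK => /eqP ->.
    by rewrite gt0_muley ?leey// lte_fin mulr_gt0 ?exprn_gt0.
  have Sx : S x = (fine (S x))%:E by rewrite fineK// ge0_fin_numE.
  have [_ /(_ k)] := @geometric_cvgn _ (v ^~ x) _ (sqrtr_ge0 _) (vgeo x).
  rewrite -/(f x) /v patchE mem_set// Sx -EFinM lee_fin distrC => wf.
  rewrite -real_normK ?num_real//.
  apply: (@le_trans _ _ ((2 * Num.sqrt (fine (S x)) * 2^-1 ^+ k) ^+ 2)).
    by rewrite ler_pXn2r ?nnegrE ?mulr_ge0 ?sqrtr_ge0 ?exprn_ge0.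
  rewrite !exprMn sqr_sqrtr ?fine_ge0//.
  rewrite (_ : (2^-1 ^+ k) ^+ 2 = 4^-1 ^+ k); last first.
    by rewrite exprAC; congr (_ ^+ k); field.
  by rewrite le_eqVlt; apply/orP; left; apply/eqP; ring.
have intwf k : (\int[mu]_x ((w k x - f x) ^+ 2)%:E <=
    (4 * 4^-1 ^+ k * (C * (4 / 3)))%:E)%E.
  apply: (@le_trans _ _ (\int[mu]_x ((4 * 4^-1 ^+ k)%:E * S x))%E).
    apply: ge0_le_integral => //.
    - by move=> x _; rewrite lee_fin sqr_ge0.
    - exact/measurable_EFinP/measurable_funX/measurable_funB.
    - exact: measurable_funeM.
  rewrite ge0_integralZl// ?lee_fin ?mulr_ge0 ?exprn_ge0//.
  by rewrite [leRHS]EFinM lee_wpmul2l// lee_fin mulr_ge0 ?exprn_ge0.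
have fL : f \in Lfun mu 2%:E.
  rewrite (_ : f = fun x => w 0%N x - (w 0%N x - f x)); last first.
    by apply/funext => x; rewrite subKr.
  apply: Lfun2B => //.
  apply/Lfun2P; split; first exact: measurable_funB.
  by apply: le_lt_trans (intwf 0%N) _; rewrite ltry.
exists (Lfun2_elt fL) => e e0.
have cvgK : 4 * (C * (4 / 3)) * 4^-1 ^+ k @[k --> \oo] --> (0 : R).
  by apply: cvg_geometric; rewrite ger0_norm ?invr_ge0// invf_lt1 ?ltr1n.
have [k0 _ k0P] := cvgr_lt (0 : R) cvgK e e0.
exists k0 => k /k0P; apply: le_lt_trans.
rewrite /= /L2dotD L2dot_sqr -lee_fin fineK; last first.
  exact/integral_fune_fin_num/Lfun2_integrable_sq/LfunP.
rewrite mulrAC; apply: le_trans (intwf k).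
rewrite integral_mkcond; apply: ge0_le_integral => //.
- by move=> x _; rewrite patchE; case: ifPn => //; rewrite lee_fin sqr_ge0.
- apply/(measurable_restrictT _ mD)/measurable_EFinP/measurable_funX.
  exact/measurable_funTS/Lfun2_measurable/LfunP.
- exact/measurable_EFinP/measurable_funX/measurable_funB.
- move=> x _; rewrite patchE Lfun2_subE /= /w patchE; case: ifPn => //= _.
  by rewrite lee_fin sqr_ge0.
Qed.

End completeness.

(** * Hilbert-Schmidt operators and their adjoints *)

Section Hilbert_Schmidt.
Context d1 d2 (X : measurableType d1) (Y : measurableType d2) {R : realType}.
Variables (mu : {sigma_finite_measure set X -> \bar R}).
Variables (nu : {sigma_finite_measure set Y -> \bar R}).
Variable kap : Y * X -> R.
Hypothesis kapL : kap \in Lfun (nu \x mu)%E 2%:E.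

Let mkap : measurable_fun setT kap := Lfun2_measurable kapL.

Let mkap1 y : measurable_fun setT (fun x => kap (y, x)).
Proof. exact: measurableT_comp mkap (measurable_pair1 y). Qed.

Definition hs_op (f : X -> R) (y : Y) : R := \int[mu]_x (kap (y, x) * f x).

Lemma hs_kernel_ae : {ae nu, forall y, (fun x => kap (y, x)) \in Lfun mu 2%:E}.
Proof.
have := ae_integrable1 (Lfun2_integrable_sqr kapL).
apply: filterS => y /integrableP[_] k2; apply/Lfun2P; split => //.
rewrite (eq_integral (fun x => `|(EFin \o (fun z => kap z ^+ 2)%R) (y, x)|)%E)//.
by move=> x _ /=; rewrite ger0_norm ?sqr_ge0.
Qed.

Lemma hs_kernel_sqr :
  (\int[nu]_y \int[mu]_x (kap (y, x) ^+ 2)%:E =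
   \int[nu \x mu]_z (kap z ^+ 2)%:E)%E.
Proof.
rewrite (fubini_tonelli1 (fun z => (kap z ^+ 2)%:E))//.
  exact/measurable_EFinP/measurable_funX.
by move=> z; rewrite lee_fin sqr_ge0.
Qed.

Lemma measurable_hs_op (f : X -> R) : measurable_fun setT f ->
  measurable_fun setT (hs_op f).
Proof.
move=> mf; pose g (z : Y * X) := (kap z * f z.2)%:E.
have mg : measurable_fun setT g.
  apply/measurable_EFinP/measurable_funM => //.
  by apply: (measurableT_comp mf); exact: measurable_snd.
apply: measurableT_comp => //.
rewrite (_ : (fun y => _) =
  (fun y => fubini_F mu g^\+ y - fubini_F mu g^\- y)%E); last first.
  apply/funext => y; rewrite [LHS]integralE.
  by congr (_ - _)%E; apply: eq_integral => x _; rewrite ?funeposE ?funenegE.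
apply: emeasurable_funB; apply: measurable_fun_fubini_tonelli_F => //.
- exact: measurable_funepos.
- exact: measurable_funeneg.
Qed.

(** The Cauchy-Schwarz inequality in x, for almost every y, integrated over y. *)
Lemma hs_op_sqr_le (f : X -> R) : f \in Lfun mu 2%:E ->
  (\int[nu]_y (hs_op f y ^+ 2)%:E <=
   \int[nu \x mu]_z (kap z ^+ 2)%:E * \int[mu]_x (f x ^+ 2)%:E)%E.
Proof.
move=> fL; rewrite muleC -hs_kernel_sqr.
have fin (g : X -> R) : g \in Lfun mu 2%:E -> (\int[mu]_x (g x ^+ 2)%:E \is a fin_num)%E.
  by move=> gL; exact/integral_fune_fin_num/Lfun2_integrable_sqr.
have mF : measurable_fun setT (fun y => \int[mu]_x (kap (y, x) ^+ 2)%:E)%E.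
  apply: (measurable_fun_fubini_tonelli_F (fun z => (kap z ^+ 2)%:E)).
    exact/measurable_EFinP/measurable_funX.
  by move=> z; rewrite lee_fin sqr_ge0.
rewrite -ge0_integralZl//; last 2 first.
- by move=> y _; exact: integral_sqr_ge0.
- exact: integral_sqr_ge0.
apply: ae_ge0_le_integral => //.
- by move=> y _; rewrite lee_fin sqr_ge0.
- apply/measurable_EFinP/measurable_funX/measurable_hs_op.
  exact: Lfun2_measurable fL.
- by move=> y _; rewrite mule_ge0// integral_sqr_ge0.
- exact: measurable_funeM.
apply: filterS hs_kernel_ae => y kyL _.
have := form_cauchy_schwarz (L2form mu measurableT) (Lfun2_elt kyL) (Lfun2_elt fL).
rewrite /= /L2dotD !L2dot_sqr -lee_fin [X in (_ <= X)%E -> _]EFinM !fineK; last 2 first.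
- exact: fin fL.
- exact: fin kyL.
by rewrite muleC.
Qed.

Lemma hs_op_Lfun (f : X -> R) : f \in Lfun mu 2%:E -> hs_op f \in Lfun nu 2%:E.
Proof.
move=> fL; apply/Lfun2P; split; first exact: measurable_hs_op (Lfun2_measurable fL).
apply: le_lt_trans (hs_op_sqr_le fL) _.
have [_ k2] := proj1 (Lfun2P _ _) kapL; have [_ f2] := proj1 (Lfun2P _ _) fL.
by rewrite lte_mul_pinfty ?integral_sqr_ge0// ge0_fin_numE ?integral_sqr_ge0.
Qed.

End Hilbert_Schmidt.

Section adjoint.
Context d1 d2 (X : measurableType d1) (Y : measurableType d2) {R : realType}.
Variables (mu : {sigma_finite_measure set X -> \bar R}).
Variables (nu : {sigma_finite_measure set Y -> \bar R}).
Variable kap : Y * X -> R.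
Hypothesis kapL : kap \in Lfun (nu \x mu)%E 2%:E.

Definition transpose_kernel (z : X * Y) := kap (z.2, z.1).

Lemma transpose_kernel_Lfun : transpose_kernel \in Lfun (mu \x nu)%E 2%:E.
Proof.
have [mk k2] := proj1 (Lfun2P _ _) kapL.
have mt : measurable_fun setT transpose_kernel.
  by apply: (measurableT_comp mk); exact: measurable_swap.
apply/Lfun2P; split => //; move: k2.
rewrite -(hs_kernel_sqr kapL) (fubini_tonelli (fun z => (kap z ^+ 2)%:E)).
- rewrite (fubini_tonelli1 (fun z => (transpose_kernel z ^+ 2)%:E))//.
    exact/measurable_EFinP/measurable_funX.
  by move=> z; rewrite lee_fin sqr_ge0.
- exact/measurable_EFinP/measurable_funX.
- by move=> z; rewrite lee_fin sqr_ge0.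
Qed.

Lemma Lfun2_tensor (g : Y -> R) (f : X -> R) : g \in Lfun nu 2%:E ->
  f \in Lfun mu 2%:E -> (fun z => g z.1 * f z.2) \in Lfun (nu \x mu)%E 2%:E.
Proof.
move=> /Lfun2P[mg g2] /Lfun2P[mf f2]; apply/Lfun2P.
have mgf : measurable_fun setT (fun z : Y * X => g z.1 * f z.2).
  apply: measurable_funM; first by apply: (measurableT_comp mg); exact: measurable_fst.
  by apply: (measurableT_comp mf); exact: measurable_snd.
split=> //; rewrite (fubini_tonelli1 (fun z => ((g z.1 * f z.2) ^+ 2)%:E)).
- rewrite (eq_integral (fun y => (\int[mu]_x (f x ^+ 2)%:E) * (g y ^+ 2)%:E))%E.
    rewrite ge0_integralZl ?integral_sqr_ge0//.
    + by rewrite lte_mul_pinfty ?integral_sqr_ge0// ge0_fin_numE ?integral_sqr_ge0.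
    + exact/measurable_EFinP/measurable_funX.
    + by move=> y _; rewrite lee_fin sqr_ge0.
  move=> y _; rewrite /fubini_F muleC -ge0_integralZl ?lee_fin ?sqr_ge0//.
  + by apply: eq_integral => x _; rewrite -EFinM exprMn.
  + exact/measurable_EFinP/measurable_funX.
  + by move=> x _; rewrite lee_fin sqr_ge0.
- exact/measurable_EFinP/measurable_funX.
- by move=> z; rewrite lee_fin sqr_ge0.
Qed.

(** Fubini for the integrable function kap (y, x) g (y) f (x). *)
Lemma hs_op_adjoint (f : X -> R) (g : Y -> R) :
  f \in Lfun mu 2%:E -> g \in Lfun nu 2%:E ->
  L2dot nu setT (hs_op mu kap f) g =
  L2dot mu setT f (hs_op nu transpose_kernel g).
Proof.
move=> fL gL.
have tL := transpose_kernel_Lfun.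
pose h (z : Y * X) := kap z * (g z.1 * f z.2).
have hI : (nu \x mu)%E.-integrable setT (EFin \o h).
  by apply: Lfun2_integrableM => //; exact: Lfun2_tensor.
rewrite /L2dot /Rintegral; congr fine.
transitivity (\int[nu]_y \int[mu]_x (h (y, x))%:E)%E.
  apply: ae_eq_integral => //.
  - apply/measurable_EFinP/measurable_funM; last exact: Lfun2_measurable gL.
    by apply: measurable_hs_op kapL _ _; exact: Lfun2_measurable fL.
  - by case/integrableP: (integrable_fubini_F hI).
  apply: filterS (hs_kernel_ae kapL) => y kyL _.
  rewrite /hs_op -RintegralZr//; last exact: Lfun2_integrableM.
  rewrite /Rintegral fineK; last first.
    apply/integral_fune_fin_num => //.
    rewrite (_ : (fun x => _) = (fun x => (kap (y, x) * f x)%:E * (g y)%:E)%E)//.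
    by apply: integrableZr => //; exact: Lfun2_integrableM.
  by apply: eq_integral => x _; rewrite /h /=; congr EFin; ring.
rewrite (Fubini hI); apply/esym; apply: ae_eq_integral => //.
- apply/measurable_EFinP/measurable_funM; first exact: Lfun2_measurable fL.
  by apply: measurable_hs_op tL _ _; exact: Lfun2_measurable gL.
- exact: measurable_fubini_G hI.
apply: filterS (hs_kernel_ae tL) => x kxL _.
rewrite /hs_op -RintegralZl//; last exact: Lfun2_integrableM.
rewrite /Rintegral fineK; last first.
  apply/integral_fune_fin_num => //.
  rewrite (_ : (fun y => _) =
    (fun y => (f x)%:E * (transpose_kernel (x, y) * g y)%:E)%E)//.
  by apply: integrableZl => //; exact: Lfun2_integrableM.
by apply: eq_integral => y _; rewrite /h /transpose_kernel /=; congr EFin; ring.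
Qed.

End adjoint.

(** * Singular values of an integral operator *)

Section integral_operators.
Context d1 d2 (X : measurableType d1) (Y : measurableType d2) {R : realType}.
Variables (mu : {sigma_finite_measure set X -> \bar R}) (D : set X).
Variables (nu : {sigma_finite_measure set Y -> \bar R}) (D' : set Y).
Hypothesis mD : measurable D.
Variable k : Y -> X -> R.
Hypothesis kL2 : L2 (nu \x mu)%E (D' `*` D) (fun z => k z.1 z.2).

Local Notation E := (LfunType mu (le1_2e R)).
Local Notation dot := (L2form mu mD).

(** Extending kernels and functions by 0 reduces operators between domains to
operators between whole spaces. *)
Definition restricted_kernel : Y * X -> R := (fun z => k z.1 z.2) \_ (D' `*` D).

Definition kernel_op (f : X -> R) (y : Y) : R := \int[mu]_(x in D) (k y x * f x).

Definition kernel_adj (g : Y -> R) (x : X) : R := \int[nu]_(y in D') (k y x * g y).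

Lemma kernel_op_restrict (f : X -> R) :
  kernel_op f \_ D' = hs_op mu restricted_kernel (f \_ D).
Proof.
apply/funext => y; rewrite /hs_op patchE; case: ifPn => yD'.
  rewrite /kernel_op Rintegral_mkcond; apply: eq_Rintegral => x _.
  rewrite /restricted_kernel !patchE in_setX /= yD' /=.
  by case: ifPn; rewrite ?mulr0.
rewrite -[LHS](@Rintegral_set0 _ _ _ mu (fun=> 0)) Rintegral_mkcond.
apply: eq_Rintegral => x _.
by rewrite /restricted_kernel !patchE in_setX /= (negbTE yD') mul0r if_same.
Qed.

Lemma kernel_adj_restrict (g : Y -> R) :
  kernel_adj g \_ D = hs_op nu (transpose_kernel restricted_kernel) (g \_ D').
Proof.
apply/funext => x; rewrite /hs_op patchE; case: ifPn => xD.
  rewrite /kernel_adj Rintegral_mkcond; apply: eq_Rintegral => y _.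
  rewrite /transpose_kernel /restricted_kernel !patchE in_setX /= xD andbT.
  by case: ifPn; rewrite ?mulr0.
rewrite -[LHS](@Rintegral_set0 _ _ _ nu (fun=> 0)) Rintegral_mkcond.
apply: eq_Rintegral => y _; rewrite /transpose_kernel /restricted_kernel.
by rewrite !patchE in_setX /= (negbTE xD) andbF mul0r if_same.
Qed.

Lemma kernel_adjP : L2adjoint mu D nu D' kernel_op kernel_adj.
Proof.
have tL := transpose_kernel_Lfun kL2.
split.
- by move=> f fL; rewrite /L2/= kernel_op_restrict; exact: hs_op_Lfun.
- by move=> g gL; rewrite /L2/= kernel_adj_restrict; exact: hs_op_Lfun.
- move=> f g fL gL; rewrite L2dotE kernel_op_restrict (hs_op_adjoint kL2)//.
  by rewrite -kernel_adj_restrict -L2dotE.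
Qed.

Lemma L2_Lfun (f : E) : L2 mu D f.
Proof. exact: Lfun2_restrict (LfunP _). Qed.

Lemma L2dot_sym (f g : X -> R) : L2dot mu D f g = L2dot mu D g f.
Proof. by apply: eq_Rintegral => x _; rewrite mulrC. Qed.

Lemma L2dot_restrictr (f g : X -> R) : L2dot mu D f (g \_ D) = L2dot mu D f g.
Proof. by apply: eq_Rintegral => x xD; rewrite patchE xD. Qed.

Definition kernel_formE (f g : E) : R := L2dot nu D' (kernel_op f) (kernel_op g).

Lemma kernel_formE_adj B (f g : E) : L2adjoint mu D nu D' kernel_op B ->
  kernel_formE f g = L2dot mu D f (B (kernel_op g)).
Proof. by case=> A2 _; apply; [|apply: A2]; exact: L2_Lfun. Qed.

Let kernel_form_sym f g : kernel_formE f g = kernel_formE g f.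
Proof. by apply: eq_Rintegral => x _; rewrite mulrC. Qed.

Let kernel_form_lin a f g h :
  kernel_formE (a *: f + g) h = a * kernel_formE f h + kernel_formE g h.
Proof.
have adjP := kernel_adjP; have [A2 B2 _] := adjP.
rewrite !(kernel_formE_adj _ _ adjP).
have hL := B2 _ (A2 _ (L2_Lfun h)).
rewrite -!(L2dot_restrictr _ (kernel_adj _)).
exact: (form_lin dot a f g (Lfun2_elt hL)).
Qed.

Let kernel_form_ge0 f : 0 <= kernel_formE f f.
Proof. by apply: Rintegral_ge0 => x _; rewrite -expr2 sqr_ge0. Qed.

(** (f, g) |-> <K f, K g>, through which the eigenspaces of K^* K are described
without choosing an adjoint. *)
Definition kernel_form : psd_form E :=
  PSDForm kernel_form_sym kernel_form_lin kernel_form_ge0.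

Lemma L2null (f : X -> R) : L2 mu D f ->
  L2dot mu D f f = 0 <-> f = (fun=> 0) %[ae mu in D].
Proof.
move=> fL; have mf : measurable_fun D (fun x => (f x ^+ 2)%:E).
  apply/measurable_EFinP/measurable_funX/(measurable_restrictT _ mD).
  exact: Lfun2_measurable fL.
have fsq : (\int[mu]_(x in D) `|(f x ^+ 2)%:E| = (L2dot mu D f f)%:E)%E.
  rewrite L2dot_sqr fineK.
    by apply: eq_integral => x _; rewrite /= ger0_norm ?sqr_ge0.
  rewrite (eq_integral (fun x => ((f \_ D) x ^+ 2)%:E)).
    exact/integral_fune_fin_num/Lfun2_integrable_sq.
  by move=> x xD; rewrite patchE xD.
have [H1 H2] := @ae_eq_integral_abs _ _ _ mu D mD _ mf; split.
  move=> f0; have := H1; rewrite fsq f0 => /(_ erefl).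
  by apply: filterS => x fx Dx; have [/eqP] := fx Dx; rewrite sqrf_eq0 => /eqP.
move=> f0; apply: EFin_inj; rewrite -fsq; apply: H2.
by apply: filterS f0 => x fx Dx; rewrite fx// expr0n.
Qed.

Lemma Lfun2_sum_elt n (c : 'I_n -> R) (F : 'I_n -> E) x :
  (\sum_i c i *: F i) x = \sum_i c i * F i x.
Proof.
exact: (big_morph (fun f : E => f x) (fun _ _ => erefl) erefl).
Qed.

Lemma L2freeP n (f : 'I_n -> X -> R) (F : 'I_n -> E) :
  (forall i x, D x -> F i x = f i x) -> L2free mu D f <-> form_free dot F.
Proof.
move=> fF.
have E c : (fun x => \sum_(i < n) c i * f i x) = (fun=> 0) %[ae mu in D] <->
    dot (\sum_i c i *: F i) (\sum_i c i *: F i) = 0.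
  rewrite -[X in _ <-> X]/(L2dot mu D _ _ = 0) L2null; last exact: L2_Lfun.
  have eqF x : D x -> (\sum_i c i *: F i : E) x = \sum_(i < n) c i * f i x.
    by move=> Dx; rewrite Lfun2_sum_elt; apply: eq_bigr => i _; rewrite fF.
  by split; apply: filterS => x H Dx; [rewrite eqF// H|rewrite -eqF// H].
by split=> free c /E; exact: free.
Qed.

(** K^* K f = lam f holds almost everywhere as soon as it holds against every g,
and <g, K^* K f> = <K g, K f>. *)
Lemma L2eigenspaceP B (lam : R) (f : X -> R) (F : E) :
  L2adjoint mu D nu D' kernel_op B -> (forall x, D x -> F x = f x) ->
  L2eigenspace mu D (B \o kernel_op) lam f <->
  form_eigen dot kernel_form lam F.
Proof.
move=> adjB fF.
have fFD : f \_ D = F \_ D.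
  by apply/funext => x; rewrite !patchE; case: ifPn => // /set_mem/fF.
have fL : L2 mu D f by rewrite /L2/= fFD; exact: L2_Lfun.
have opF : kernel_op F = kernel_op f.
  apply/funext => y; apply: eq_Rintegral => x /set_mem xD.
  by rewrite fF.
have [A2 B2 _] := adjB.
pose h x := B (kernel_op f) x - lam * f x.
have BfL : L2 mu D (B (kernel_op f)) by apply/B2/A2.
have hL : L2 mu D h.
  rewrite /L2/= (_ : h \_ D =
    fun x => (B (kernel_op f) \_ D) x - lam * (f \_ D) x).
    by apply: Lfun2B => //; exact: Lfun2Z.
  by apply/funext => x; rewrite !patchE; case: ifPn => //; rewrite mulr0 subr0.
have key (g : E) :
    kernel_form g F - lam * dot g F = dot g (Lfun2_elt hL).
  rewrite -[kernel_form g F]/(kernel_formE g F) (kernel_formE_adj _ _ adjB) opF.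
  rewrite -(L2dot_restrictr _ (B _)).
  pose H1 := Lfun2_elt BfL.
  rewrite -[L2dot _ _ _ _]/(dot g H1) -formZr -formBr /=.
  apply: eq_Rintegral => x /set_mem xD; congr (_ * _).
  rewrite Lfun2_subE /= patchE mem_set// patchE mem_set// /h.
  by rewrite -fF.
split=> [[_ eigf] g|eigF].
  apply/eqP; rewrite -subr_eq0 form_sym (form_sym dot) key.
  rewrite form_sym; apply/eqP/form_null/(L2null (L2_Lfun _)).
  apply: filterS eigf => x /= xeig Dx.
  by rewrite patchE mem_set// /h /= xeig// subrr.
split=> //.
have := key (Lfun2_elt hL).
rewrite (form_sym kernel_form) eigF (form_sym dot F) subrr => /esym h0.
have hh : L2dot mu D h h = 0 
  by rewrite -[RHS]h0 -(L2dot_restrictr _ h) L2dot_sym -(L2dot_restrictr _ h).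
have := (L2null hL).1 hh; apply: filterS => x + Dx => /(_ Dx)/eqP.
by rewrite /h subr_eq0 => /eqP.
Qed.

Lemma L2has_dimP B (lam : R) m : L2adjoint mu D nu D' kernel_op B ->
  L2has_dim mu D (L2eigenspace mu D (B \o kernel_op) lam) m <->
  form_has_dim dot (form_eigen dot kernel_form lam) m.
Proof.
move=> adjB.
have to_form n (f : 'I_n -> X -> R) :
    (forall i, L2eigenspace mu D (B \o kernel_op) lam (f i)) ->
    exists F : 'I_n -> E, (forall i, form_eigen dot kernel_form lam (F i)) /\
      (L2free mu D f <-> form_free dot F).
  move=> eigf; have fL i : L2 mu D (f i) by have [] := eigf i.
  have FD i x : D x -> Lfun2_elt (fL i) x = f i x.
    by move=> Dx; rewrite /= patchE mem_set.
  exists (fun i => Lfun2_elt (fL i)); split; last exact: L2freeP.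
  by move=> i; apply/(L2eigenspaceP lam adjB (FD i)).
have from_form n (F : 'I_n -> E) :
    (forall i, form_eigen dot kernel_form lam (F i)) ->
    (forall i, L2eigenspace mu D (B \o kernel_op) lam (F i)) /\
    (L2free mu D (fun i => F i : X -> R) <-> form_free dot F).
  by move=> eigF; split; [move=> i; exact/(L2eigenspaceP lam adjB)|exact: L2freeP].
split=> -[[f [eigf ffree]] nofree]; split.
- have [F [eigF free]] := to_form _ _ eigf.
  by exists F; split => //; exact/free.
- by move=> F /from_form[eigF <-]; exact: nofree.
- have [eigF free] := from_form _ _ eigf.
  by exists (fun i => f i : X -> R); split => //; exact/free.
- by move=> F /to_form[G [eigG ->]]; exact: nofree.
Qed.

Hypothesis compactk :
  forall eps : R, 0 < eps -> exists n, approximable dot kernel_form n eps.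

Section system.
Variables (e : nat -> E) (lam : nat -> R).
Hypothesis sys : eigen_system dot kernel_form e lam.

Definition form_singular_value n : R := Num.sqrt (lam n.-1).

Let sv_multiplicity (t : R) : 0 < t -> exists2 m,
  form_has_dim dot (form_eigen dot kernel_form t) m &
  ([set n | (0 < n)%N /\ form_singular_value n ^+ 2 = t] #= `I_m)%card.
Proof.
move=> t0; have [s [us sP] sdim] := form_has_dim_eigen sys compactk t0.
exists (size s) => //.
rewrite (_ : [set n | _] = [set` [fset n.+1 | n in s]%fset]).
  apply/card_eq_fsetP; rewrite card_imfset/=; last exact: succn_inj.
  by rewrite undup_id.
apply/seteqP; split => [[|n] []//= _|n /imfsetP[i /= si ->]].
  rewrite /form_singular_value sqr_sqrtr ?(eigen_val_ge0 sys)// => nt.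
  by apply/imfsetP; exists n => //=; rewrite sP; apply/eqP.
split => //; rewrite /form_singular_value sqr_sqrtr ?(eigen_val_ge0 sys)//.
by apply/eqP; rewrite -sP.
Qed.

Let sv_noninc m n : (0 < m)%N -> (m <= n)%N ->
  form_singular_value n <= form_singular_value m.
Proof.
move=> m0 mn; rewrite ler_wsqrtr// (eigen_val_noninc sys)//.
by rewrite -!subn1 leq_sub2r.
Qed.

Lemma singular_values_exist :
  singular_values mu D nu D' kernel_op form_singular_value.
Proof.
exists kernel_adj; first exact: kernel_adjP.
split=> [n _|m n|t t0]; [exact: sqrtr_ge0|exact: sv_noninc|].
have [m mdim mcard] := sv_multiplicity t0; exists m => //.
by apply/L2has_dimP => //; exact: kernel_adjP.
Qed.

(** Any adjoint gives the same eigenspaces, so the multiplicities of s are those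
of the eigenvalues of the form, and they determine s. *)
Lemma singular_values_unique s : singular_values mu D nu D' kernel_op s ->
  forall n, (0 < n)%N -> s n = form_singular_value n.
Proof.
move=> [B adjB [s0 snoninc smult]].
apply: noninc_multiplicity_eq => //; first by move=> n _; exact: sqrtr_ge0.
move=> t t0; have [m /(L2has_dimP _ _ adjB) mdim mcard] := smult _ t0.
have [m' m'dim m'card] := sv_multiplicity t0.
by exists m; split => //; rewrite (form_has_dim_uniq mdim m'dim).
Qed.

End system.
End integral_operators.

(** * Kernels close to finite sums of products *)

Lemma sqr_sum_le (R : realType) (I : Type) (s : seq I) (x : I -> R) :
  (\sum_(i <- s) x i) ^+ 2 <= 2 ^+ size s * \sum_(i <- s) x i ^+ 2.
Proof.
elim: s => [|i s IH]; first by rewrite !big_nil expr0n mulr0.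
rewrite !big_cons /= (exprS 2); move: IH; set S := \sum_(_ <- _) _ => IH.
have x0 : x i ^+ 2 <= 2 ^+ size s * x i ^+ 2.
  by rewrite ler_peMl ?sqr_ge0// exprn_ege1// ler1n.
have := sqr_ge0 (x i - S); move: IH x0.
move: (2 ^+ size s) (\sum_(_ <- _) _) (x i) S => A B xi S0 H1 H2 H3.
by lra.
Qed.

Lemma approximable_fin (R : realType) (E : lmodType R) (dot b : psd_form E)
    (I : finType) (v : I -> E) (eps : R) :
  (forall f, b f f <= eps * dot f f + \sum_i dot f (v i) ^+ 2) ->
  approximable dot b #|I| eps.
Proof.
move=> vP; exists (fun i => v (enum_val i)) => f.
apply: le_trans (vP f) _; rewrite lerD2l le_eqVlt; apply/orP; left; apply/eqP.
by rewrite (big_enum_val (fun i => dot f (v i) ^+ 2)).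
Qed.

Section kernel_approximation.
Context d1 d2 (X : measurableType d1) (Y : measurableType d2) {R : realType}.
Variables (mu : {sigma_finite_measure set X -> \bar R}) (D : set X).
Variables (nu : {sigma_finite_measure set Y -> \bar R}) (D' : set Y).
Hypothesis mD : measurable D.
Variable k : Y -> X -> R.
Hypothesis kL2 : L2 (nu \x mu)%E (D' `*` D) (fun z => k z.1 z.2).

Local Notation E := (LfunType mu (le1_2e R)).
Local Notation dot := (L2form mu mD).
Local Notation kap := (restricted_kernel D D' k).

(** A Hilbert-Schmidt norm bound for the difference of the kernel and a finite
sum of products controls the operator: on functions orthogonal to all the v_i
the two kernels act in the same way. *)
Lemma approximable_of_kernel (I : finType) (a : I -> Y -> R) (v : I -> X -> R)
    (eps : R) :
  (forall i, a i \in Lfun nu 2%:E) -> (forall i, v i \in Lfun mu 2%:E) ->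
  (\int[nu \x mu]_z ((kap z - \sum_i a i z.1 * (v i \_ D) z.2) ^+ 2)%:E
     <= eps%:E)%E ->
  approximable dot (kernel_form mD kL2) #|I| (2 * eps).
Proof.
move=> aL vL epsP.
pose gam z := kap z - \sum_i a i z.1 * (v i \_ D) z.2.
have vDL i : v i \_ D \in Lfun mu 2%:E by exact: Lfun2_restrict.
have gamL : gam \in Lfun (nu \x mu)%E 2%:E.
  by apply: Lfun2B => //; apply: Lfun2_sum => i; exact: Lfun2_tensor.
pose c i := 2 * 2 ^+ #|I| * L2dot nu setT (a i) (a i).
have c0 i : 0 <= c i by rewrite mulr_ge0// (form_ge0 (L2form nu measurableT) (Lfun2_elt (aL i))).
apply: (approximable_fin (v := fun i => Num.sqrt (c i) *: Lfun2_elt (vL i))) => f.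
pose F : X -> R := f \_ D.
have FL : F \in Lfun mu 2%:E by apply: Lfun2_restrict => //; exact: LfunP.
pose l i := dot f (Lfun2_elt (vL i)).
have w0 i : 0 <= 2 * 2 ^+ #|I| * l i ^+ 2.
  by rewrite mulr_ge0 ?sqr_ge0// mulr_ge0 ?exprn_ge0.
have splitF : {ae nu, forall y,
    hs_op mu kap F y = hs_op mu gam F y + \sum_i a i y * l i}.
  apply: filterS (hs_kernel_ae kL2) => y kyL.
  have gamyL : (fun x => gam (y, x)) \in Lfun mu 2%:E.
    by apply: Lfun2B => //; apply: Lfun2_sum => i; exact: (Lfun2Z (a i y) (vDL i)).
  pose S x := \sum_i a i y * (v i \_ D) x.
  have SL : S \in Lfun mu 2%:E by apply: Lfun2_sum => i; exact: (Lfun2Z (a i y) (vDL i)).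
  rewrite /hs_op; transitivity (\int[mu]_x (gam (y, x) * F x + S x * F x)).
    by apply: eq_Rintegral => x _; rewrite -mulrDl /gam subrK.
  rewrite RintegralD//; [|exact: Lfun2_integrableM|exact: Lfun2_integrableM].
  congr (_ + _).
  pose SE : E := \sum_i a i y *: Lfun2_elt (vDL i).
  transitivity (L2form mu measurableT SE (Lfun2_elt FL)).
    by apply: eq_Rintegral => x _; rewrite /SE /S (big_morph (fun f : E => f x) (fun _ _ => erefl) erefl).
  rewrite (big_morph ((L2form mu measurableT)^~ _) (fun _ _ => formDl _ _ _ _) (form0l _ _)).
  apply: eq_bigr => i _; rewrite formZl /l form_sym.
  by congr (_ * _); rewrite /= /L2dotD [RHS]L2dotE.
have opE : kernel_form mD kL2 f f = L2dot nu setT (hs_op mu kap F) (hs_op mu kap F).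
  by rewrite /= /kernel_formE L2dotE kernel_op_restrict.
have opL : hs_op mu kap F \in Lfun nu 2%:E by exact: hs_op_Lfun.
have gamF : hs_op mu gam F \in Lfun nu 2%:E by exact: hs_op_Lfun.
pose rhs y := 2 * hs_op mu gam F y ^+ 2 + \sum_i 2 * 2 ^+ #|I| * l i ^+ 2 * a i y ^+ 2.
have fin (g : Y -> R) : g \in Lfun nu 2%:E -> (\int[nu]_x (g x ^+ 2)%:E \is a fin_num)%E.
  by move=> gL; exact/integral_fune_fin_num/Lfun2_integrable_sqr.
have msq (g : Y -> R) : g \in Lfun nu 2%:E -> measurable_fun setT (fun y => (g y ^+ 2)%:E).
  by move=> gL; apply/measurable_EFinP/measurable_funX; exact: Lfun2_measurable gL.
have le1 : (\int[nu]_y (hs_op mu kap F y ^+ 2)%:E <=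
    \int[nu]_y (2%:E * (hs_op mu gam F y ^+ 2)%:E +
      \sum_i (2 * 2 ^+ #|I| * l i ^+ 2)%:E * (a i y ^+ 2)%:E))%E.
  apply: ae_ge0_le_integral => //.
  - by move=> y _; rewrite lee_fin sqr_ge0.
  - exact: msq.
  - move=> y _; rewrite adde_ge0// ?mule_ge0 ?lee_fin ?sqr_ge0// sume_ge0// => i _.
    by rewrite mule_ge0 ?lee_fin ?sqr_ge0//; exact: w0.
  - apply: emeasurable_funD; first by apply: measurable_funeM; exact: msq.
    by apply: emeasurable_sum => i; apply: measurable_funeM; exact: msq.
  apply: filterS splitF => y -> _.
  rewrite [X in (_ <= _ + X)%E](_ : _ =
      (\sum_i 2 * 2 ^+ #|I| * l i ^+ 2 * a i y ^+ 2)%:E); last first.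
    by rewrite -sumEFin; apply: eq_bigr => i _; rewrite EFinM.
  rewrite -EFinM -EFinD lee_fin.
  have := sqr_sum_le (index_enum I) (fun i => a i y * l i).
  have -> : size (index_enum I) = #|I| by rewrite cardE enumT.
  have -> : \sum_i 2 * 2 ^+ #|I| * l i ^+ 2 * a i y ^+ 2 =
      2 * (2 ^+ #|I| * \sum_i (a i y * l i) ^+ 2).
    by rewrite !mulr_sumr; apply: eq_bigr => i _; ring.
  set T := \sum_i _ * l i; set Q := hs_op _ _ _ _; set W := _ * \sum_i _.
  by have := sqr_ge0 (Q - T); move: T Q W => T Q W; nra.
rewrite opE L2dot_sqr -lee_fin fineK ?fin//; apply: (le_trans le1).
rewrite ge0_integralD//; last 4 first.
- by move=> y _; rewrite mule_ge0 ?lee_fin ?sqr_ge0.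
- by apply: measurable_funeM; exact: msq.
- move=> y _; rewrite sume_ge0// => i _.
  by rewrite mule_ge0 ?lee_fin ?sqr_ge0//; exact: w0.
- by apply: emeasurable_sum => i; apply: measurable_funeM; exact: msq.
rewrite [leRHS]EFinD; apply: leeD.
  rewrite ge0_integralZl//; [|exact: msq|by move=> y _; rewrite lee_fin sqr_ge0].
  rewrite -mulrA [leRHS]EFinM lee_wpmul2l//.
  apply: (le_trans (hs_op_sqr_le gamL FL)).
  rewrite EFinM; apply: lee_pmul => //.
  - exact: integral_sqr_ge0.
  - exact: integral_sqr_ge0.
  rewrite /= /L2dotD L2dotE L2dot_sqr fineK//.
  exact/integral_fune_fin_num/Lfun2_integrable_sqr.
rewrite ge0_integral_sum//; last 2 first.
- by move=> i; apply: measurable_funeM; exact: msq.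
- by move=> i y _; rewrite mule_ge0 ?lee_fin ?sqr_ge0//; exact: w0.
rewrite -sumEFin; apply: lee_sum => i _.
rewrite ge0_integralZl//; last 3 first.
- exact: msq.
- by move=> y _; rewrite lee_fin sqr_ge0.
- by rewrite lee_fin; exact: w0.
rewrite formZr exprMn sqr_sqrtr// -/(l i) /c L2dot_sqr.
rewrite -[X in (_ * X <= _)%E]fineK ?fin// -EFinM lee_fin.
by rewrite le_eqVlt; apply/orP; left; apply/eqP; ring.
Qed.

End kernel_approximation.

(** * Measurable sets and measures in dimension n *)

Section rV_topology.
Context {R : realType} (n : nat).
Implicit Types v : 'rV[R]_n.

Lemma rV_norm_coord v i : `|v ord0 i| <= `|v|.
Proof.
rewrite [leRHS]mx_normrE.
exact: (le_bigmax _ (fun ij => `|v ij.1 ij.2|) (ord0, i)).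
Qed.

Lemma rV_norm_lt v (e : R) : 0 < e -> (forall i, `|v ord0 i| < e) -> `|v| < e.
Proof.
move=> e0 ve; rewrite [ltLHS]mx_normrE; apply: bigmax_lt => // -[i j] _ /=.
by rewrite (ord1 i).
Qed.

Definition rV_box (A : 'I_n -> set R) : set 'rV[R]_n :=
  [set v | forall i, A i (v ord0 i)].

Lemma measurable_rV_box (A : 'I_n -> set R) :
  (forall i, measurable (A i)) -> measurable (rV_box A).
Proof.
move=> mA; rewrite (_ : rV_box A =
    \bigcap_(i in [set: 'I_n]) ((fun v => v ord0 i) @^-1` A i)).
  apply: fin_bigcap_measurable => // i _.
  by rewrite -[X in measurable X]setTI; exact: measurable_coord.
by apply/seteqP; split=> v /= H i; [move=> _|]; exact: H.
Qed.

Let rat_cube (c : {ffun 'I_n -> rat} * rat) : set 'rV[R]_n :=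
  rV_box (fun i => `](ratr (c.1 i) - ratr c.2), (ratr (c.1 i) + ratr c.2)[%classic).

Lemma open_rV_cube (U : set 'rV[R]_n) v : open U -> U v ->
  exists2 e : R, 0 < e & forall w : 'rV[R]_n,
    (forall i, `|w ord0 i - v ord0 i| < e) -> U w.
Proof.
move=> oU Uv; have /nbhs_ballP[e /= e0 eU] : nbhs v U by exact: open_nbhs_nbhs.
exists e => // w wv; apply: eU; rewrite -ball_normE /=.
by apply: rV_norm_lt => // i; rewrite !mxE distrC.
Qed.

(** The sigma-algebra is generated by the coordinates, so an open set has to be
written as a countable union of boxes; cubes with rational centre and radius
serve. *)
Lemma open_measurable_rV (U : set 'rV[R]_n) : open U -> measurable U.
Proof.
move=> oU.
have -> : U = \bigcup_(c in [set c | rat_cube c `<=` U]) rat_cube c.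
  apply/seteqP; split => [v Uv|v [c cU] /cU//].
  have [e e0 eU] := open_rV_cube oU Uv.
  have [r] : exists r, ratr r \in `](0 : R), (e / 2)[.
    by apply: rat_in_itvoo; rewrite divr_gt0.
  rewrite in_itv /= => /andP[r0 re].
  have /choice[c cP] (i : 'I_n) : exists c,
      ratr c \in `](v ord0 i - ratr r), (v ord0 i + ratr r)[.
    by apply: rat_in_itvoo; lra.
  exists ([ffun i => c i], r).
    move=> w /= wc; apply: eU => i; have := cP i; have := wc i.
    by rewrite /= ffunE !in_itv/= ltr_norml => /andP[? ?] /andP[? ?]; lra.
  move=> i; have := cP i.
  by rewrite /= ffunE !in_itv/= => /andP[? ?]; lra.
rewrite bigcup_mkcond; apply: countable_bigcupT_measurable.
  exact: countableP.
move=> c; case: ifPn => // _; apply: measurable_rV_box => i.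
exact: measurable_itv.
Qed.

Lemma bounded_lebesgue_rV_lty (A : set 'rV[R]_n) : measurable A ->
  bounded_set A -> (lebesgue_rV n A < +oo)%E.
Proof.
move=> mA [M [_ AM]].
pose I (i : 'I_n) := `[- (M + 1), M + 1]%classic.
have mI i : measurable (I i) by exact: measurable_itv.
apply: (@le_lt_trans _ _ (lebesgue_rV n (rV_box I))).
  apply: le_measure; rewrite ?inE//; first exact: measurable_rV_box.
  move=> v Av i; rewrite /I /= in_itv/= -ler_norml.
  apply: (le_trans (rV_norm_coord v i)).
  by apply: (AM _ _ v Av); rewrite ltrDl.
rewrite lebesgue_rV_box//.
have [c cE] : exists c : R, lebesgue_measure `[- (M + 1), M + 1]%classic = c%:E.
  by rewrite lebesgue_measure_itv; case: ifPn => _; eexists; rewrite -?EFinD.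
by rewrite (eq_bigr (fun=> c%:E)) ?prodEFin ?ltry.
Qed.

End rV_topology.

(** * Norms and multi-indices *)

Lemma big_fset_subD (V : nmodType) (I : choiceType) (F G : {fset I}) (u : I -> V) :
  (F `<=` G)%fset ->
  \sum_(i <- G) u i = \sum_(i <- F) u i + \sum_(i <- (G `\` F)%fset) u i.
Proof.
move=> FG; rewrite (big_fsetID _ (fun i => i \in F)) /=.
congr (_ + _); apply: eq_fbigl => i; rewrite !inE /=; last by rewrite andbC.
by apply/andP/idP => [[]//|iF]; split => //; exact: (fsubsetP FG).
Qed.

Section L2norm_theory.
Context d (X : measurableType d) {R : realType}.
Variables (mu : {measure set X -> \bar R}) (D : set X).

Lemma restrictD (f g : X -> R) :
  (fun x => f x + g x) \_ D = (fun x => (f \_ D) x + (g \_ D) x).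
Proof. by apply/funext => x; rewrite !patchE; case: ifPn; rewrite ?addr0. Qed.

Lemma restrictZ a (f : X -> R) :
  (fun x => a * f x) \_ D = (fun x => a * (f \_ D) x).
Proof. by apply/funext => x; rewrite !patchE; case: ifPn; rewrite ?mulr0. Qed.

Lemma L2D (f g : X -> R) : L2 mu D f -> L2 mu D g ->
  L2 mu D (fun x => f x + g x).
Proof. by move=> fL gL; rewrite /L2/= restrictD; exact: Lfun2D. Qed.

Lemma L2Z a (f : X -> R) : L2 mu D f -> L2 mu D (fun x => a * f x).
Proof. by move=> fL; rewrite /L2/= restrictZ; exact: Lfun2Z. Qed.

Lemma L2B (f g : X -> R) : L2 mu D f -> L2 mu D g ->
  L2 mu D (fun x => f x - g x).
Proof.
move=> fL /(L2Z (-1)) gL; have := L2D fL gL.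
by under [X in L2 mu D X -> _]funext => x do rewrite mulN1r.
Qed.

Lemma L2_sum I (s : seq I) (u : I -> X -> R) : (forall i, L2 mu D (u i)) ->
  L2 mu D (fun x => \sum_(i <- s) u i x).
Proof.
move=> uL; elim: s => [|i s IH].
  rewrite (_ : (fun _ => _) = fun=> 0 * 0); last first.
    by apply/funext => x; rewrite big_nil mul0r.
  rewrite /L2/= (_ : _ \_ D = fun=> 0); last first.
    by apply/funext => x; rewrite patchE mul0r if_same.
  exact: (LfunP (0 : LfunType mu (le1_2e R))).
by under eq_fun do rewrite big_cons; exact: L2D.
Qed.

Lemma L2norm_ge0 (f : X -> R) : (0 <= L2norm mu D f)%E.
Proof. exact: Lnorm_ge0. Qed.

Lemma L2norm_sqr (f : X -> R) :
  (L2norm mu D f ^+ 2 = \int[mu]_x ((f \_ D) x ^+ 2)%:E)%E.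
Proof. exact: Lnorm2_sqr. Qed.

Lemma L2normD (f g : X -> R) : L2 mu D f -> L2 mu D g ->
  (L2norm mu D (fun x => f x + g x)%R <= L2norm mu D f + L2norm mu D g)%E.
Proof.
move=> fL gL; rewrite /L2norm restrictD.
apply: minkowski_EFin; last by rewrite ler1n.
- exact: Lfun2_measurable fL.
- exact: Lfun2_measurable gL.
Qed.

Lemma L2normZ a (f : X -> R) : L2 mu D f ->
  (L2norm mu D (fun x => a * f x)%R = `|a|%:E * L2norm mu D f)%E.
Proof.
by move=> fL; rewrite /L2norm restrictZ; exact: (LnormZ (Lfun2_elt fL) a).
Qed.

Lemma L2norm_sum I (s : seq I) (u : I -> X -> R) : (forall i, L2 mu D (u i)) ->
  (L2norm mu D (fun x => \sum_(i <- s) u i x)%R <=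
   \sum_(i <- s) L2norm mu D (u i))%E.
Proof.
move=> uL; elim: s => [|i s IH].
  rewrite big_nil (_ : (fun _ => _) = fun=> 0 * 0); last first.
    by apply/funext => x; rewrite big_nil mul0r.
  rewrite /L2norm (_ : _ \_ D = fun=> 0); last first.
    by apply/funext => x; rewrite patchE mul0r if_same.
  by rewrite (_ : EFin \o _ = cst 0%E)// Lnorm0.
rewrite big_cons; under eq_fun do rewrite big_cons.
apply: le_trans (L2normD (uL i) (L2_sum s uL)) _.
by rewrite leeD2l.
Qed.

Lemma L2is_sum_tail (I : choiceType) (u : I -> X -> R) (f : X -> R)
    (B : {fset I}) (t : \bar R) :
  (forall i, L2 mu D (u i)) -> L2 mu D f -> L2is_sum mu D u f ->
  (forall F : {fset I}, (B `<=` F)%fset ->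
    (\sum_(i <- (F `\` B)%fset) L2norm mu D (u i) <= t)%E) ->
  (L2norm mu D (fun x => f x - \sum_(i <- B) u i x)%R <= t)%E.
Proof.
move=> uL fL fsum tP; apply/lee_addgt0Pr => e e0.
have [F0 /(_ (F0 `|` B)%fset (fsubsetUl _ _)) F0P] := fsum _ e0.
set F := (F0 `|` B)%fset in F0P.
have BF : (B `<=` F)%fset by exact: fsubsetUr.
have -> : (fun x => f x - \sum_(i <- B) u i x) = (fun x =>
    \sum_(i <- (F `\` B)%fset) u i x + (f x - \sum_(i <- F) u i x)).
  apply/funext => x.
  rewrite (big_fset_subD _ BF).
  by ring.
apply: le_trans (L2normD (L2_sum _ uL) (L2B fL (L2_sum _ uL))) _.
apply: leeD; last exact: ltW.
by apply: le_trans (L2norm_sum _ uL) _; exact: tP.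
Qed.

Lemma Lfun2_bounded (f : X -> R) (A : set X) (M : R) :
  measurable_fun setT f -> measurable A -> (mu A < +oo)%E ->
  (forall x, A x -> `|f x| <= M) -> (forall x, ~ A x -> f x = 0) ->
  f \in Lfun mu 2%:E /\ (\int[mu]_x (f x ^+ 2)%:E <= (M ^+ 2)%:E * mu A)%E.
Proof.
move=> mf mA Afin fM f0.
suff le : (\int[mu]_x (f x ^+ 2)%:E <= (M ^+ 2)%:E * mu A)%E.
  split=> //; apply/Lfun2P; split => //; apply: le_lt_trans le _.
  by rewrite lte_mul_pinfty ?lee_fin ?sqr_ge0.
rewrite -integral_cst// [leRHS]integral_mkcond.
apply: ge0_le_integral => //.
- by move=> x _; rewrite lee_fin sqr_ge0.
- exact/measurable_EFinP/measurable_funX.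
- by apply/(measurable_restrictT _ mA); exact: measurable_cst.
- move=> x _; rewrite patchE; case: ifPn => [/set_mem Ax|xA].
    rewrite lee_fin -real_normK ?num_real// ler_pXn2r ?nnegrE//; first exact: fM.
    exact: le_trans (fM _ Ax).
  by rewrite f0 ?expr0n// => Ax; move: xA; rewrite mem_set.
Qed.

Lemma L2norm_lty (f : X -> R) : L2 mu D f -> (L2norm mu D f < +oo)%E.
Proof. by rewrite /L2/= inE => /andP[_ /[!inE]]. Qed.

Lemma L2norm_le (f g : X -> R) (c : R) :
  measurable D -> measurable_fun setT f -> L2 mu D g -> 0 <= c ->
  (forall x, `|f x| <= c * `|g x|) ->
  L2 mu D f /\ (L2norm mu D f <= c%:E * L2norm mu D g)%E.
Proof.
move=> mD mf gL c0 fg.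
have cgL := L2Z c gL.
have le x : `|(f \_ D) x| <= `|((fun x => c * g x) \_ D) x|.
  by rewrite !patchE; case: ifPn => // _; rewrite normrM (ger0_norm c0).
have mfD : measurable_fun setT (f \_ D).
  by apply/(measurable_restrictT _ mD); exact: measurable_funTS.
split; first exact: (Lfun2_dominated mfD cgL).
rewrite -[X in (X%:E * _)%E](ger0_norm c0) -L2normZ//.
have p0 := L2norm_ge0 f; have q0 := L2norm_ge0 (fun x => c * g x).
rewrite -(@lee_sqr R _ _ p0 q0) !L2norm_sqr; apply: ge0_le_integral => //.
- by move=> x _; rewrite lee_fin sqr_ge0.
- exact/measurable_EFinP/measurable_funX.
- exact/measurable_EFinP/measurable_funX/(Lfun2_measurable cgL).
- by move=> x _; rewrite lee_fin -ler_sqrt ?sqr_ge0// !sqrtr_sqr.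
Qed.

End L2norm_theory.

Lemma fsum_le_esum (R : realType) (I : choiceType) (a : I -> \bar R) (F : {fset I}) :
  (\sum_(i <- F) a i <= \esum_(i in [set: I]) a i)%E.
Proof.
apply: esum_ge; exists [set` F]; first by split.
by rewrite fsbig_finite//= set_fsetK.
Qed.

Section multi_indices.
Context {R : realType} (d : nat).
Implicit Types (I : {ffun 'I_d -> nat}) (v : 'rV[R]_d).

Lemma monomial_le v I (rho : R) : (forall i, `|v ord0 i| <= rho) ->
  `|monomial v I| <= rho ^+ mdegree I.
Proof.
move=> vr; rewrite /monomial normr_prod /mdegree -prodrXr.
apply: ler_prod => i _; rewrite normr_ge0 normrX /=.
by rewrite lerXn2r// ?nnegrE// (le_trans _ (vr i)).
Qed.

Definition index_of_bounded N (J : {ffun 'I_d -> 'I_N}) : {ffun 'I_d -> nat} :=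
  [ffun i => val (J i)].

Lemma index_of_bounded_inj N : injective (@index_of_bounded N).
Proof.
move=> J J' /ffunP JJ'; apply/ffunP => i; apply: val_inj.
by have := JJ' i; rewrite !ffunE.
Qed.

Definition index_cube N : {fset {ffun 'I_d -> nat}} :=
  [fset index_of_bounded J | J in {ffun 'I_d -> 'I_N}]%fset.

Lemma in_index_cube N I : (I \in index_cube N) = [forall i, (I i < N)%N].
Proof.
apply/imfsetP/forallP => [[J _ -> i]|IN]; first by rewrite ffunE; exact: ltn_ord.
exists [ffun i => Ordinal (IN i)] => //.
by apply/ffunP => i; rewrite !ffunE.
Qed.

Lemma big_index_cube N (F : {ffun 'I_d -> nat} -> R) :
  \sum_(I <- index_cube N) F I =
  \sum_(J : {ffun 'I_d -> 'I_N}) F (index_of_bounded J).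
Proof.
rewrite big_imfset/=; last by move=> J J' _ _; exact: index_of_bounded_inj.
by rewrite big_enum.
Qed.

Lemma mdegree_notin_cube N I : I \notin index_cube N -> (N <= mdegree I)%N.
Proof.
rewrite in_index_cube negb_forall => /existsP[i]; rewrite -leqNgt => NI.
by apply: leq_trans NI _; rewrite /mdegree (bigD1 i)//= leq_addr.
Qed.

End multi_indices.

(** * Analytic kernels are approximable *)

Lemma compact_finite_cover (R : realType) d (K : set 'rV[R]_d) (r : 'rV[R]_d -> R) :
  compact K -> (forall y, K y -> 0 < r y) ->
  exists s : seq 'rV[R]_d, (forall y, y \in s -> K y) /\
    forall x, K x -> exists2 y, y \in s & `|x - y| < r y.
Proof.
rewrite compact_cover => Kc r0.
have [|x Kx|F FK Fcov] := Kc _ K (fun y => ball y (r y)).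
- by move=> y _; exact: ball_open.
- by exists x => //; apply: ballxx; exact: r0.
exists (enum_fset F); split=> [y yF|x /Fcov[y yF]].
  by have := FK y yF; rewrite inE.
by rewrite -ball_normE /= distrC; exists y.
Qed.

Lemma measurable_monomial (R : realType) d (c : 'rV[R]_d) I :
  measurable_fun setT (fun y : 'rV[R]_d => monomial (y - c) I).
Proof.
rewrite /monomial; apply: measurable_prod => i _.
apply: measurable_funX.
rewrite (_ : (fun _ => _) = fun y : 'rV[R]_d => y ord0 i - c ord0 i).
  by apply: measurable_funB => //; exact: measurable_coord.
by apply/funext => y; rewrite !mxE.
Qed.

Section analytic_kernels.
Context {R : realType} (d' d : nat).
Variables (Om' : set 'rV[R]_d') (Om : set 'rV[R]_d).
Variable k : 'rV[R]_d' -> 'rV[R]_d -> R.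
Hypotheses (oOm : open Om) (bOm : bounded_set Om).
Hypothesis kL2 : L2kernel Om' Om k.

Local Notation mu := (lebesgue_rV d).
Local Notation nu := (lebesgue_rV d').
Local Notation mOm := (open_measurable_rV oOm).
Local Notation kap := (restricted_kernel Om Om' k).

Let mOm_lty : (mu Om < +oo)%E.
Proof. exact: bounded_lebesgue_rV_lty mOm bOm. Qed.

Section expansion.
Variable kt : 'rV[R]_d' -> 'rV[R]_d -> R.
Variables (a : {ffun 'I_d -> nat} -> 'rV[R]_d' -> R) (r : R) (y0 : 'rV[R]_d).
Hypothesis aL2 : forall I, L2 nu Om' (a I).
Let A : \bar R := (\esum_(I in [set: {ffun 'I_d -> nat}])
  (L2norm nu Om' (a I) * (r ^+ mdegree I)%:E))%E.

(** On the ball of half the radius of convergence the remainder of order N is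
at most 2^-N times the sum of the norms of all the terms. *)
Lemma analytic_remainder N (y : 'rV[R]_d) : 0 < r -> `|y - y0| < r / 2 ->
  L2 nu Om' (kt ^~ y) ->
  L2is_sum nu Om' (fun I x => a I x * monomial (y - y0) I) (kt ^~ y) ->
  (L2norm nu Om' (fun x => kt x y -
     \sum_(I <- index_cube d N) a I x * monomial (y - y0) I)%R
   <= (2^-1 ^+ N)%:E * A)%E.
Proof.
move=> r0 yr ktL ktsum.
have uL I : L2 nu Om' (fun x => a I x * monomial (y - y0) I).
  by under eq_fun do rewrite mulrC; exact: L2Z.
apply: (L2is_sum_tail uL ktL ktsum) => F _.
have term I : I \notin index_cube d N ->
    (L2norm nu Om' (fun x => a I x * monomial (y - y0) I)%R <=
     (2^-1 ^+ N)%:E * (L2norm nu Om' (a I) * (r ^+ mdegree I)%:E))%E.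
  move=> IN; under eq_fun do rewrite mulrC.
  rewrite L2normZ// muleCA muleC; apply: lee_wpmul2l; first exact: L2norm_ge0.
  rewrite -EFinM lee_fin; apply: (@le_trans _ _ ((r / 2) ^+ mdegree I)).
    apply: monomial_le => i; apply: ltW; apply: le_lt_trans yr.
    exact: rV_norm_coord.
  rewrite exprMn mulrC ler_wpM2r ?exprn_ge0 ?(ltW r0)//.
  apply: ler_wiXn2l; rewrite ?invr_ge0 ?invf_le1 ?ler1n//.
  exact: mdegree_notin_cube.
have N0 I : (0 <= L2norm nu Om' (a I) * (r ^+ mdegree I)%:E)%E.
  by rewrite mule_ge0 ?L2norm_ge0// lee_fin exprn_ge0 ?ltW.
apply: (@le_trans _ _ (\sum_(I <- (F `\` index_cube d N)%fset)
    (2^-1 ^+ N)%:E * (L2norm nu Om' (a I) * (r ^+ mdegree I)%:E))%E).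
  rewrite big_seq [leRHS]big_seq; apply: lee_sum => I.
  by rewrite !inE => /andP[+ _]; exact: term.
rewrite -ge0_sume_distrr; last by move=> I _; exact: N0.
by apply: lee_wpmul2l; [rewrite lee_fin exprn_ge0|exact: fsum_le_esum].
Qed.

End expansion.

Hypothesis ana : analytic_kernel Om' Om k.

(** By compactness finitely many of the balls on which k is expanded cover Om;
cutting Om into disjoint pieces along them and truncating each expansion at
order N gives a kernel with L * N^d terms, at distance O(2^-N) from k. *)
Lemma approximable_analytic : exists (L : nat) (C : R), (0 < L)%N /\ 0 <= C /\
  forall N, exists2 m, (m <= L * N ^ d)%N &
    approximable (L2form mu mOm) (kernel_form mOm kL2) m (C * 4^-1 ^+ N).
Proof.
have [U [kt [[oU clU] ktL ktk expan]]] := ana.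
have /choice[p pP] (y0 : 'rV[R]_d) :
    exists p : ({ffun 'I_d -> nat} -> 'rV[R]_d' -> R) * R, U y0 ->
    [/\ 0 < p.2, forall I, L2 nu Om' (p.1 I),
      (\esum_(I in [set: {ffun 'I_d -> nat}])
         (L2norm nu Om' (p.1 I) * (p.2 ^+ mdegree I)%:E) < +oo)%E &
      forall y, `|y - y0| < p.2 -> U y /\
        L2is_sum nu Om' (fun I x => p.1 I x * monomial (y - y0) I) (kt ^~ y)].
  have [Uy0|] := pselect (U y0); last by exists (fun _ _ => 0, 1).
  by have [a [r [? ? ? ?]]] := expan _ Uy0; exists (a, r).
pose a y0 := (p y0).1; pose r y0 := (p y0).2.
pose A y0 := (\esum_(I in [set: {ffun 'I_d -> nat}])
         (L2norm nu Om' (a y0 I) * (r y0 ^+ mdegree I)%:E))%E.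
have cpt : compact (closure Om).
  apply: bounded_closed_compact; last exact: closed_closure.
  have [M [Mreal OmM]] := bOm; exists (M + 1); split; first by rewrite num_real.
  move=> M' MM' y cy; apply/ler_addgt0Pr => e e0.
  have [z [Oz /=]] := cy _ (nbhsx_ballx y e e0).
  rewrite -ball_normE /= => yz; rewrite -[y](subrK z).
  apply: (le_trans (ler_normD _ _)); rewrite addrC lerD// ?(ltW yz)//.
  by apply: (OmM _ _ z Oz); apply: lt_trans MM'; rewrite ltrDl.
have r0 y : closure Om y -> 0 < r y / 2.
  by move=> /clU/pP[ry0 _ _ _]; rewrite divr_gt0.
have [s [sOm scov]] := compact_finite_cover cpt r0.
pose c (l : nat) := nth 0 s l.
have cU l : (l < size s)%N -> U (c l).
  by move=> ls; apply/clU/sOm; exact: mem_nth.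
have A0 y0 : U y0 -> (0 <= A y0)%E.
  move=> /pP[ry0 _ _ _]; apply: esum_ge0 => I _.
  by rewrite mule_ge0 ?L2norm_ge0// lee_fin exprn_ge0 ?ltW.
pose T : R := \sum_(y <- s) fine (A y).
have AT l : (l < size s)%N -> (A (c l) <= T%:E)%E.
  move=> ls; have [_ _ Afin _] := pP _ (cU _ ls).
  have AE : A (c l) = (fine (A (c l)))%:E.
    by rewrite fineK// ge0_fin_numE//; apply: A0; exact: cU.
  rewrite [leLHS]AE lee_fin.
  rewrite /T (big_rem (c l)) ?mem_nth//= lerDl.
  rewrite big_seq sumr_ge0// => y /mem_rem ys.
  by apply/fine_ge0/A0/clU/sOm.
have T0 : 0 <= T.
  by rewrite /T big_seq sumr_ge0// => y ys; apply/fine_ge0/A0/clU/sOm.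
(* seqDU makes the balls disjoint, so that each y uses one expansion only *)
pose F (l : nat) := if (l < size s)%N then ball (c l) (r (c l) / 2) else set0.
pose P l := seqDU F l `&` Om.
have mP l : measurable (P l).
  have mF i : measurable (F i).
    rewrite /F; case: ifPn => // _; apply: open_measurable_rV; exact: ball_open.
  apply: measurableI; last exact: mOm.
  rewrite /seqDU; apply: measurableD; first exact: mF.
  by apply: bigsetU_measurable => i _; exact: mF.
have PF l y : P l y -> (l < size s)%N /\ `|y - c l| < r (c l) / 2.
  move=> [[]]; rewrite /F; case: ifPn => // ls.
  by rewrite -ball_normE /= distrC.
have Pcov y : Om y -> exists l : 'I_(size s), P l y.
  move=> Oy; have [y0 y0s yy0] := scov y (subset_closure Oy).
  have : (\bigcup_l F l) y.
    exists (index y0 s) => //; rewrite /F index_mem y0s /c nth_index//.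
    by rewrite -ball_normE /= distrC.
  rewrite seqDU_bigcup_eq => -[l _ Fl]; have Ply : P l y by [].
  by have [ls _] := PF _ _ Ply; exists (Ordinal ls).
have Puniq l l' y : P l y -> P l' y -> l = l'.
  move=> [Fl _] [Fl' _]; apply/eqP/negPn/negP => ll'.
  have := @trivIset_seqDU _ F; move=> /trivIsetP/(_ l l' I I ll').
  by move=> /seteqP[/(_ y)+ _]; apply.
exists (size s).+1, (2 * (T ^+ 2 * fine (mu Om))); split => //; split.
  by rewrite mulr_ge0// mulr_ge0 ?sqr_ge0 ?fine_ge0.
move=> N.
pose al (i : 'I_(size s) * {ffun 'I_d -> 'I_N}) : 'rV[R]_d' -> R :=
  a (c i.1) (index_of_bounded i.2) \_ Om'.
pose v (i : 'I_(size s) * {ffun 'I_d -> 'I_N}) : 'rV[R]_d -> R :=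
  (fun y => monomial (y - c i.1) (index_of_bounded i.2)) \_ (P i.1).
have alL i : al i \in Lfun nu 2%:E.
  by have [_ aL _ _] := pP _ (cU _ (ltn_ord i.1)); exact: aL.
have vL i : v i \in Lfun mu 2%:E.
  have Pfin : (mu (P i.1) < +oo)%E.
    apply: le_lt_trans mOm_lty; apply: le_measure; rewrite ?inE; last exact: subIsetr.
    - exact: mP.
    - exact: mOm.
  have mv : measurable_fun setT (v i).
    apply/(measurable_restrictT _ (mP _)); apply: measurable_funTS.
    exact: measurable_monomial.
  have [] := @Lfun2_bounded _ _ _ mu (v i) (P i.1)
    ((r (c i.1) / 2) ^+ mdegree (index_of_bounded i.2)) mv (mP _) Pfin => //.
  - move=> y Py; rewrite /v patchE mem_set//; apply: monomial_le => j.
    have [_ /ltW] := PF _ _ Py; apply: le_trans; exact: rV_norm_coord.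
  - by move=> y Py; rewrite /v patchE memNset.
exists #|{: 'I_(size s) * {ffun 'I_d -> 'I_N}}|.
  by rewrite card_prod card_ffun !card_ord leq_mul2r leqnSn orbT.
pose q : R := 2^-1 ^+ N.
rewrite -mulrA; apply: (approximable_of_kernel _ _ alL vL).
pose gam z := kap z - \sum_i al i z.1 * (v i \_ Om) z.2.
have kapL := kL2 : kap \in Lfun (nu \x mu)%E 2%:E.
have gamL : gam \in Lfun (nu \x mu)%E 2%:E.
  apply: Lfun2B => //; apply: Lfun2_sum => i; apply: Lfun2_tensor; first exact: alL.
  exact: Lfun2_restrict mOm (vL i).
have mgam := Lfun2_measurable gamL.
have mgam2 : measurable_fun setT (fun z => (gam z ^+ 2)%:E).
  exact/measurable_EFinP/measurable_funX.
rewrite (fubini_tonelli2 (fun z => (gam z ^+ 2)%:E))//; last first.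
  by move=> z; rewrite lee_fin sqr_ge0.
have point y : (\int[nu]_x (gam (x, y) ^+ 2)%:E <=
    ((fun=> ((q * T) ^+ 2)%:E) \_ Om) y)%E.
  rewrite patchE; case: ifPn => [/set_mem Oy|yO]; last first.
    rewrite (eq_integral (fun=> 0%E)) ?integral0// => x _.
    rewrite /gam /restricted_kernel patchE in_setX /= (negbTE yO) andbF.
    rewrite big1 ?subr0 ?expr0n// => i _.
    by rewrite patchE (negbTE yO) mulr0.
  have [l Ply] := Pcov _ Oy; have [_ yl] := PF _ _ Ply.
  have [rl aL _ sumP] := pP _ (cU _ (ltn_ord l)).
  have yr : `|y - c l| < r (c l) by lra.
  have [Uy ysum] := sumP _ yr.
  have := analytic_remainder aL N rl yl (ktL _ Uy) ysum.
  rewrite -/(A (c l)) -/q => rem.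
  have {}rem : (L2norm nu Om' (fun x => kt x y - \sum_(I <- index_cube d N)
      a (c l) I x * monomial (y - c l) I)%R <= (q * T)%:E)%E.
    apply: le_trans rem _; rewrite EFinM; apply: lee_wpmul2l; last exact: AT.
    by rewrite lee_fin exprn_ge0.
  have : (L2norm nu Om' (fun x => kt x y - \sum_(I <- index_cube d N)
      a (c l) I x * monomial (y - c l) I)%R ^+ 2 <= ((q * T) ^+ 2)%:E)%E.
    by rewrite expe2 expr2 EFinM; apply: lee_pmul => //; exact: L2norm_ge0.
  rewrite L2norm_sqr; apply: le_trans; rewrite le_eqVlt; apply/orP; left; apply/eqP.
  apply: ae_eq_integral => //.
  - exact: (measurableT_comp mgam2 (measurable_pair2 y)).
  - apply/measurable_EFinP/measurable_funX; apply: Lfun2_measurable.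
    apply: L2B; first exact: ktL.
    by apply: L2_sum => I; under eq_fun do rewrite mulrC; apply: L2Z; exact: aL.
  apply: filterS (ktk _ Oy) => x ktkx _; congr (_ ^+ 2)%:E.
  rewrite /gam /restricted_kernel !patchE in_setX /= (mem_set Oy) andbT.
  case: ifPn => [xO|xO]; last first.
    rewrite big1 ?subr0// => i _.
    by rewrite /al patchE (negbTE xO) mul0r.
  rewrite ktkx; last exact/set_mem.
  congr (_ - _); rewrite big_index_cube.
  pose G l' J := al (l', J) x * (v (l', J) \_ Om) y.
  rewrite (eq_bigr (fun i => G i.1 i.2)); last by move=> [].
  rewrite -(pair_bigA _ G) (bigD1 l)//= [X in _ + X]big1 ?addr0 => [|l' ll'].
    apply: eq_bigr => J _; rewrite /G /al /v !patchE xO (mem_set Oy) /=.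
    by rewrite (mem_set Ply).
  apply: big1 => J _; rewrite /G /v !patchE (mem_set Oy) /= memNset ?mulr0// => Pl'y.
  by move/eqP: ll'; apply; apply/val_inj/(Puniq _ _ _ Pl'y Ply).
apply: (@le_trans _ _ (\int[mu]_y ((fun=> ((q * T) ^+ 2)%:E) \_ Om) y)%E).
  apply: ge0_le_integral => //.
  - by move=> y _; exact: integral_sqr_ge0.
  - apply: (measurable_fun_fubini_tonelli_G (fun z => (gam z ^+ 2)%:E)) => //.
    by move=> z; rewrite lee_fin sqr_ge0.
  - by apply/(measurable_restrictT _ mOm); exact: measurable_cst.
  - by move=> y _; exact: point.
rewrite -integral_mkcond integral_cst; last exact: mOm.
rewrite -[X in (_ * X <= _)%E]fineK ?ge0_fin_numE//.
rewrite -EFinM lee_fin le_eqVlt; apply/orP; left; apply/eqP.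
rewrite exprMn /q exprAC (_ : 2^-1 ^+ 2 = 4^-1 :> R); last by field.
by ring.
Qed.

End analytic_kernels.

(** * Upper bounds for the singular values *)

Section stretched_exponential.
Context {R : realType}.

Lemma root_le_of_nat_pow (d n m : nat) : (0 < d)%N -> (n <= m ^ d)%N ->
  n%:R `^ (d%:R)^-1 <= m%:R :> R.
Proof.
move=> d0 nm; apply: (@le_trans _ _ ((m ^ d)%:R `^ (d%:R)^-1)).
  by apply: ge0_ler_powR; rewrite ?invr_ge0 ?nnegrE ?ler0n// ler_nat.
rewrite natrX -powR_mulrn// -powRrM mulfV ?powRr1//.
by rewrite pnatr_eq0 -lt0n.
Qed.

Lemma nat_le_root (d n m : nat) : (0 < d)%N -> (m ^ d <= n)%N ->
  m%:R <= n%:R `^ (d%:R)^-1 :> R.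
Proof.
move=> d0 mn; apply: (@le_trans _ _ ((m ^ d)%:R `^ (d%:R)^-1)); last first.
  by apply: ge0_ler_powR; rewrite ?invr_ge0 ?nnegrE ?ler0n// ler_nat.
rewrite natrX -powR_mulrn// -powRrM mulfV ?powRr1//.
by rewrite pnatr_eq0 -lt0n.
Qed.

(** For n > 0 the largest N with L * N^d < n satisfies n <= (L (N + 1))^d,
so 2^-(N + 1) <= tau^(n^(1/d)) for tau = 2^(-1/L). *)
Lemma stretched_exponential_bound (d L : nat) (C : R) (t : nat -> R) :
  (0 < d)%N -> (0 < L)%N -> 0 <= C ->
  (forall N n, (L * N ^ d <= n)%N -> t n <= C * 4^-1 ^+ N) ->
  exists tau C' : R, [/\ 0 < tau < 1, 0 < C' &
    forall n, (0 < n)%N ->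
      Num.sqrt (t n.-1) <= C' * tau `^ (n%:R `^ (d%:R)^-1)].
Proof.
move=> d0 L0 C0 tN; pose tau : R := 2^-1 `^ (L%:R)^-1.
have L0R : 0 < L%:R :> R by rewrite ltr0n.
have tau0 : 0 < tau by rewrite powR_gt0.
have tau1 : tau < 1.
  rewrite /tau /powR gt_eqF// expR_lt1 pmulr_rlt0 ?invr_gt0//.
  by rewrite ln_lt0// invr_gt0 ltr0n invf_lt1 ?ltr1n.
exists tau, (2 * Num.sqrt C + 1); split=> [||n n0].
- by rewrite tau0.
- by rewrite ltr_pwDr// mulr_ge0 ?sqrtr_ge0.
have ex : exists N, (L * N ^ d <= n.-1)%N.
  by exists 0%N; rewrite exp0n// muln0.
have ub N : (L * N ^ d <= n.-1)%N -> (N <= n)%N.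
  move=> h; apply: leq_trans (leq_trans h (leq_pred n)).
  apply: (@leq_trans (N ^ d)); last by rewrite leq_pmull.
  by case: N {h} => // N; rewrite -{1}(expn1 N.+1) leq_pexp2l.
have [N NP Nmax] := ex_maxnP ex ub.
have nN : (n <= (L * N.+1) ^ d)%N.
  have : (n.-1 < L * N.+1 ^ d)%N.
    by rewrite ltnNge; apply/negP => /Nmax; rewrite ltnn.
  rewrite prednK// => /leq_trans; apply; rewrite expnMn leq_mul2r.
  by rewrite -{1}(expn1 L) leq_pexp2l ?orbT.
have tauN : 2^-1 ^+ N.+1 <= tau `^ (n%:R `^ (d%:R)^-1).
  apply: (@le_trans _ _ (tau `^ (L * N.+1)%:R)).
    by rewrite /tau -powRrM natrM mulKf ?gt_eqF// powR_mulrn ?invr_ge0.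
  apply: ger_powR; first by rewrite tau0 ltW.
  exact: root_le_of_nat_pow.
apply: (@le_trans _ _ (2 * Num.sqrt C * 2^-1 ^+ N.+1)).
  have -> : 2 * Num.sqrt C * 2^-1 ^+ N.+1 = Num.sqrt (C * (2^-1 ^+ N) ^+ 2).
    rewrite sqrtrM// sqrtr_sqr ger0_norm ?exprn_ge0 ?invr_ge0// exprS.
    by field.
  rewrite ler_wsqrtr//; apply: le_trans (tN _ _ NP) _.
  by rewrite exprAC (_ : 2^-1 ^+ 2 = 4^-1 :> R)//; field.
apply: ler_pM => //; rewrite ?exprn_ge0 ?invr_ge0 ?mulr_ge0 ?sqrtr_ge0//.
by rewrite lerDl.
Qed.

Lemma approximable_le_eps (E : lmodType R) (dot b : psd_form E) n (e e' : R) :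
  e <= e' -> approximable dot b n e -> approximable dot b n e'.
Proof.
move=> ee' [v vP]; exists v => f; apply: le_trans (vP f) _.
by rewrite lerD2r ler_wpM2r ?form_ge0.
Qed.

End stretched_exponential.

Section analytic_singular_values.
Context {R : realType} (d' d : nat).
Variables (Om' : set 'rV[R]_d') (Om : set 'rV[R]_d).
Variable k : 'rV[R]_d' -> 'rV[R]_d -> R.
Hypotheses (oOm : open Om) (bOm : bounded_set Om).
Hypothesis kL2 : L2kernel Om' Om k.
Hypothesis ana : analytic_kernel Om' Om k.

Local Notation mu := (lebesgue_rV d).
Local Notation nu := (lebesgue_rV d').
Local Notation mOm := (open_measurable_rV oOm).

Lemma analytic_form_compact (eps : R) : 0 < eps ->
  exists n, approximable (L2form mu mOm) (kernel_form mOm kL2) n eps.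
Proof.
move=> e0; have [L [C [L0 [C0 LC]]]] := approximable_analytic oOm bOm kL2 ana.
have : C * 4^-1 ^+ N @[N --> \oo] --> (0 : R).
  by apply: cvg_geometric; rewrite ger0_norm ?invr_ge0// invf_lt1 ?ltr1n.
move=> /cvgr_lt/(_ _ e0)[N _ /(_ N (leqnn N)) CN].
have [m _ mP] := LC N; exists m; apply: approximable_le_eps mP.
exact: ltW.
Qed.

Lemma analytic_eigen_system : exists e lam,
  eigen_system (L2form mu mOm) (kernel_form mOm kL2) e lam.
Proof.
apply: exists_eigen_system; first exact: L2form_complete.
by move=> eps; exact: analytic_form_compact.
Qed.

Lemma analytic_singular_values_exist :
  exists s, singular_values mu Om nu Om' (integral_operator Om k) s.
Proof.
have [e [lam sys]] := analytic_eigen_system.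
exists (form_singular_value lam).
exact: (singular_values_exist analytic_form_compact sys).
Qed.

Lemma analytic_singular_values_decay : (0 < d)%N -> exists tau C : R,
  [/\ 0 < tau < 1, 0 < C &
    forall s, singular_values mu Om nu Om' (integral_operator Om k) s ->
    forall n, (0 < n)%N -> s n <= C * tau `^ (n%:R `^ (d%:R)^-1)].
Proof.
move=> d0; have [e [lam sys]] := analytic_eigen_system.
have [L [C [L0 [C0 LC]]]] := approximable_analytic oOm bOm kL2 ana.
have [|tau [C' [tau01 C'0 lamP]]] := stretched_exponential_bound d0 L0 C0 (t := lam).
  move=> N n Nn; have [m mN mP] := LC N.
  apply: (eigen_val_le_approx sys _ (leq_trans mN Nn) mP).
  by rewrite mulr_ge0 ?exprn_ge0.
exists tau, C'; split => // s sP n n0.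
rewrite (singular_values_unique analytic_form_compact sys sP n0).
exact: lamP.
Qed.

Lemma analytic_singular_values_ge (n : nat) (t : R)
    (w : 'I_n.+1 -> LfunType mu (le1_2e R)) (s : nat -> R) : 0 <= t ->
  form_free (L2form mu mOm) w ->
  (forall c : 'I_n.+1 -> R, let f := \sum_i c i *: w i in
     t ^+ 2 * L2form mu mOm f f <= kernel_form mOm kL2 f f) ->
  singular_values mu Om nu Om' (integral_operator Om k) s -> t <= s n.+1.
Proof.
move=> t0 wfree wt sP; have [e [lam sys]] := analytic_eigen_system.
rewrite (singular_values_unique analytic_form_compact sys sP (ltn0Sn n)).
rewrite -(ger0_norm t0) -sqrtr_sqr ler_wsqrtr//.
exact: (eigen_val_ge sys wfree wt).
Qed.

End analytic_singular_values.

(** * Integrals of products over coordinates *)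

Section product_integrals.
Context {R : realType}.

Lemma integrable_tensor d1 d2 (T1 : measurableType d1) (T2 : measurableType d2)
    (m1 : {sigma_finite_measure set T1 -> \bar R})
    (m2 : {sigma_finite_measure set T2 -> \bar R}) (g : T1 -> R) (h : T2 -> R) :
  m1.-integrable setT (EFin \o g) -> m2.-integrable setT (EFin \o h) ->
  (m1 \x m2)%E.-integrable setT (fun z => (g z.1 * h z.2)%:E) /\
  \int[(m1 \x m2)%E]_z (g z.1 * h z.2) = \int[m1]_x g x * \int[m2]_y h y.
Proof.
move=> gI hI.
have mg : measurable_fun setT g by case/integrableP: gI => /measurable_EFinP.
have mh : measurable_fun setT h by case/integrableP: hI => /measurable_EFinP.
have mgh : measurable_fun setT (fun z : T1 * T2 => (g z.1 * h z.2)%:E).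
  apply/measurable_EFinP/measurable_funM.
    by apply: (measurableT_comp mg); exact: measurable_fst.
  by apply: (measurableT_comp mh); exact: measurable_snd.
have ghI : (m1 \x m2)%E.-integrable setT (fun z => (g z.1 * h z.2)%:E).
  apply/(integrable12ltyP m1 m2 mgh).
  rewrite (eq_integral (fun x => (\int[m2]_y `|(h y)%:E|) * `|(g x)%:E|))%E.
    have /integrableP[_ gfin] := gI; have /integrableP[_ hfin] := hI.
    rewrite ge0_integralZl//.
    - rewrite lte_mul_pinfty//; first exact: integral_ge0.
      by rewrite ge0_fin_numE//; exact: integral_ge0.
    - by apply: measurableT_comp => //; exact/measurable_EFinP.
    - exact: integral_ge0.
  move=> x _; rewrite muleC -ge0_integralZl//.
  - by apply: eq_integral => y _; rewrite /= normrM.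
  - by apply: measurableT_comp => //; exact/measurable_EFinP.
split=> //; rewrite /Rintegral -(integral12_prod_meas1 ghI) /fubini_F /=.
rewrite (eq_integral (fun x => (g x)%:E * (fine (\int[m2]_y (h y)%:E))%:E)%E).
  by rewrite integralZr// fineM//; exact: integrable_fin_num.
move=> x _; rewrite fineK; last exact: integrable_fin_num.
by rewrite -integralZl.
Qed.

(** The measure in dimension n + 1 is the image of the product of the measures in
dimensions 1 and n, which gives an induction on the dimension. *)
Lemma lebesgue_rV_integral_prod n (g : 'I_n -> R -> R) :
  (forall i, lebesgue_measure.-integrable setT (EFin \o g i)) ->
  (lebesgue_rV n).-integrable setT (fun v => (\prod_i g i (v ord0 i))%:E) /\
  \int[lebesgue_rV n]_v (\prod_i g i (v ord0 i)) =
    \prod_i \int[lebesgue_measure]_x g i x.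
Proof.
elim: n g => [|n IH] g gI.
  have e1 : (fun v : 'rV[R]_0 => (\prod_(i < 0) g i (v ord0 i))%:E) = cst 1%E.
    by apply/funext => v; rewrite big_ord0.
  have int1 : (\int[@lebesgue_rV R 0]_v (cst 1%:E v) = 1%:E)%E.
    apply: etrans (integral_cst (lebesgue_rV 0) measurableT 1%:E) _.
    by rewrite mul1e /= diracT.
  rewrite e1; split; last first.
    by rewrite big_ord0 /Rintegral e1 int1.
  apply/integrableP; split; first exact: measurable_cst.
  rewrite (eq_integral (cst 1%:E)); last by move=> v _ /=; rewrite normr1.
  by rewrite int1 ltry.
have [hI hE] := IH (fun i => g (lift ord0 i)) (fun i => gI _).
have [] := integrable_tensor (gI ord0) hI.
pose m := (@lebesgue_measure R \x lebesgue_rV n)%E; pose f (v : 'rV[R]_n.+1) : R := \prod_i g i (v ord0 i).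
have fcons (z : R * 'rV[R]_n) :
    f (rVcons z) = g ord0 z.1 * \prod_i g (lift ord0 i) (z.2 ord0 i).
  rewrite /f big_ord_recl !mxE unlift_none; congr (_ * _).
  by apply: eq_bigr => i _; rewrite mxE liftK.
move=> tI tE.
have mf : measurable_fun setT f.
  apply: measurable_prod => i _; apply: measurableT_comp; last exact: measurable_coord.
  by have /integrableP[/measurable_EFinP] := gI i.
have fI : m.-integrable (@rVcons R n @^-1` setT) ((EFin \o f) \o @rVcons R n).
  rewrite preimage_setT (_ : (EFin \o f) \o _ = (fun z : R * 'rV[R]_n =>
    (g ord0 z.1 * \prod_i g (lift ord0 i) (z.2 ord0 i))%:E))//.
  by apply/funext => z /=; rewrite fcons.
have mEf : measurable_fun setT (EFin \o f) by exact/measurable_EFinP.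
have pushI := integrable_pushforward (mu := m) _ mEf fI measurableT.
have pushE := integral_pushforward (mu := m) _ mEf fI measurableT.
have pI : (\int[lebesgue_rV n.+1]_v `|(EFin \o f) v| < +oo)%E.
  have /integrableP[_] := pushI (@measurable_rVcons R n).
  by congr (_ < _)%E; apply: eq_measure_integral.
have pE := pushE (@measurable_rVcons R n).
split; first by apply/integrableP.
rewrite big_ord_recl -hE -tE /Rintegral; congr fine.
apply: etrans (etrans pE _).
  by apply: eq_measure_integral; first exact: (@measurable_rVcons R n).
rewrite preimage_setT; apply: eq_integral => z _ /=.
by rewrite fcons.
Qed.

End product_integrals.

(** * Orthogonality of cosines *)

Section cosine_integrals.
Context {R : realType}.
Variables (a l : R).
Hypothesis l0 : 0 < l.
Local Notation w := (pi / l).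

(** The cosines with j half-periods on [a, a + l] are orthogonal there without
being accompanied by sines, so that natural numbers index them. *)
Definition cosine (j : nat) (t : R) : R := cos (j%:R * w * (t - a)).

Lemma continuous_cosine j : continuous (cosine j).
Proof.
move=> t; apply: continuous_comp; last exact: continuous_cos.
apply: continuousM; first exact: cst_continuous.
by apply: continuousB => //; exact: cst_continuous.
Qed.

Lemma cosine_measurable j : measurable_fun setT (cosine j).
Proof.
apply: (measurableT_comp (continuous_measurable_fun (@continuous_cos R))).
by apply: measurable_funM => //; exact: measurable_funB.
Qed.

Lemma integral_cosine j :
  \int[@lebesgue_measure R]_(t in `[a, a + l]) cosine j t = if j == 0%N then l else 0.
Proof.
case: j => [|j] /=.
  rewrite (@eq_Rintegral _ _ _ _ _ (fun=> 1)); last first.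
    by move=> t _; rewrite /cosine !mul0r cos0.
  rewrite Rintegral_cst// mul1r.
  have e : lebesgue_measure `[a, a + l]%classic = l%:E.
    rewrite lebesgue_measure_itv /= lte_fin ltrDl l0 -EFinB.
    by congr EFin; rewrite addrAC subrr add0r.
  by rewrite -[RHS]/(fine l%:E) -e.
pose F t := sin (j.+1%:R * w * (t - a)) / (j.+1%:R * w).
have w0 : j.+1%:R * w != 0 by rewrite mulf_neq0// mulf_neq0 ?invr_neq0 ?gt_eqF ?pi_gt0.
have dF (t : R) : is_derive t (1 : R) F (cosine j.+1 t).
  set c := j.+1%:R * w in w0 *.
  have dg : is_derive t 1 (c \*: (id \- cst a)) c.
    by apply: is_derive_eq; rewrite subr0 /GRing.scale /= mulr1.
  have ds : is_derive ((c \*: (id \- cst a)) t) 1 (c^-1 \*: sin) (c^-1 * cos (c * (t - a))).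
    exact: is_deriveZ.
  have := is_derive1_comp ds dg.
  rewrite (_ : _ \o _ = F); last first.
    by apply/funext => u; rewrite /F /= mulrC.
  by rewrite mulrAC mulVf// mul1r.
have cF : continuous F.
  by move=> t; apply/differentiable_continuous/derivable1_diffP; have [] := dF t.
rewrite /Rintegral (@continuous_FTC2 _ _ F).
- rewrite /F subrr mulr0 sin0 mul0r (addrC a) addrK -mulrA divfK ?gt_eqF//.
  suff -> : sin (j.+1%:R * pi) = 0 :> R by rewrite mul0r -EFinB subrr.
  elim: j.+1 => [|m IH]; first by rewrite mul0r sin0.
  by rewrite -natr1 mulrDl mul1r sinDpi IH oppr0.
- by rewrite ltrDl.
- exact/continuous_subspaceT/continuous_cosine.
- split=> [t _| |].
  + by have [] := dF t.
  + by apply: cvg_at_right_filter; exact: cF.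
  + by apply: cvg_at_left_filter; exact: cF.
- by move=> t _; rewrite derive1E; exact: derive_val.
Qed.

Lemma cosine_prod j k t : cosine j t * cosine k t =
  (cosine (maxn j k - minn j k) t + cosine (j + k) t) / 2.
Proof.
have -> : cosine (maxn j k - minn j k) t =
    cos (j%:R * w * (t - a) - k%:R * w * (t - a)).
  rewrite /cosine; case: (leqP j k) => jk; last first.
    by rewrite natrB ?(ltnW jk)// !mulrBl.
  by rewrite -[RHS]cosN opprB natrB// !mulrBl.
have -> : cosine (j + k) t = cos (j%:R * w * (t - a) + k%:R * w * (t - a)).
  by rewrite /cosine natrD !mulrDl.
by rewrite cosB cosD -/(cosine j t) -/(cosine k t); field.
Qed.

Lemma cosine_integrable j : lebesgue_measure.-integrable `[a, a + l] (EFin \o cosine j).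
Proof.
apply: continuous_compact_integrable; first exact: segment_compact.
exact/continuous_subspaceT/continuous_cosine.
Qed.

Lemma cosine_orth j k :
  \int[@lebesgue_measure R]_(t in `[a, a + l]) (cosine j t * cosine k t) =
  if j == k then (l + (if j == 0%N then l else 0)) / 2 else 0.
Proof.
have I n : lebesgue_measure.-integrable `[a, a + l]
    (EFin \o (fun t => cosine n t / 2)).
  rewrite (_ : _ \o _ = (fun t => (cosine n t)%:E * (2^-1)%:E)%E)//.
  by apply: integrableZr => //; exact: cosine_integrable.
under eq_Rintegral do rewrite cosine_prod mulrDl.
rewrite RintegralD// !RintegralZr//; try exact: cosine_integrable.
rewrite !integral_cosine subn_eq0 addn_eq0.
case: (ltngtP j k) => [jk|jk|->].
- rewrite leqNgt jk /= (gtn_eqF (leq_ltn_trans (leq0n j) jk)) andbF.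
  by rewrite mul0r addr0.
- rewrite leqNgt jk /= (gtn_eqF (leq_ltn_trans (leq0n k) jk)).
  by rewrite mul0r addr0.
- by rewrite leqnn andbb mulrDl.
Qed.

End cosine_integrals.

(** * Sums over multi-indices and Taylor expansion of cosines *)

Section multi_index_sums.
Context {R : realType} (d : nat).

Lemma sum_index_cube_prod N (f : 'I_d -> nat -> R) :
  \sum_(I <- index_cube d N) \prod_i f i (I i) =
  \prod_i \sum_(0 <= n < N) f i n.
Proof.
rewrite big_index_cube.
under [RHS]eq_bigr do rewrite big_mkord.
rewrite bigA_distr_bigA; apply: eq_bigr => J _; apply: eq_bigr => i _.
by rewrite ffunE.
Qed.

Lemma fset_sub_index_cube (F : {fset {ffun 'I_d -> nat}}) :
  exists N0, forall N, (N0 <= N)%N -> (F `<=` index_cube d N)%fset.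
Proof.
exists (\sum_(I <- F) mdegree I).+1 => N NF; apply/fsubsetP => I IF.
rewrite in_index_cube; apply/forallP => i; apply: leq_trans NF.
rewrite ltnS (big_rem I)//=; apply: leq_trans (leq_addr _ _).
by rewrite /mdegree (bigD1 i)//= leq_addr.
Qed.

Lemma geometric_sum (q : R) N : q != 1 ->
  \sum_(0 <= n < N) q ^+ n = (1 - q ^+ N) / (1 - q).
Proof.
move=> q1; elim: N => [|N IH]; first by rewrite big_nil expr0 subrr mul0r.
by rewrite big_nat_recr//= IH exprS; field; rewrite subr_eq0 eq_sym.
Qed.

Lemma sum_geometric_cube (q : R) N : q != 1 ->
  \sum_(I <- index_cube d N) q ^+ mdegree I = ((1 - q ^+ N) / (1 - q)) ^+ d.
Proof.
move=> q1; rewrite -geometric_sum//.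
under eq_bigr do rewrite /mdegree -prodrXr.
by rewrite (sum_index_cube_prod N (fun _ n => q ^+ n)) prodr_const card_ord.
Qed.

Lemma sum_geometric_le (q : R) (F : {fset {ffun 'I_d -> nat}}) : 0 <= q < 1 ->
  \sum_(I <- F) q ^+ mdegree I <= (1 - q)^-1 ^+ d.
Proof.
move=> /andP[q0 q1]; have [N /(_ N (leqnn N)) FN] := fset_sub_index_cube F.
apply: (@le_trans _ _ (\sum_(I <- index_cube d N) q ^+ mdegree I)).
  rewrite (big_fset_subD _ FN) lerDl sumr_ge0// => I _.
  by rewrite exprn_ge0.
rewrite sum_geometric_cube ?lt_eqF//.
have q1' : 0 < 1 - q by rewrite subr_gt0.
have qN : q ^+ N <= 1 by rewrite exprn_ile1// ltW.
apply: lerXn2r.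
- by rewrite nnegrE divr_ge0 ?subr_ge0// ltW.
- by rewrite nnegrE invr_ge0 ltW.
- by rewrite ler_pdivrMr// mulVf ?gt_eqF// gerBl exprn_ge0.
Qed.

Lemma half_sum_le (F : {fset {ffun 'I_d -> nat}}) :
  \sum_(I <- F) 2^-1 ^+ mdegree I <= 2 ^+ d :> R.
Proof.
rewrite [X in _ <= X ^+ d](_ : _ = (1 - 2^-1)^-1); last by field.
by apply: sum_geometric_le; rewrite invr_ge0 ler0n invf_lt1 ?ltr1n.
Qed.

Lemma cvg_prod_seq (I : Type) (s : seq I) (f : I -> nat -> R) (l : I -> R) :
  (forall i, f i n @[n --> \oo] --> l i) ->
  \prod_(i <- s) f i n @[n --> \oo] --> \prod_(i <- s) l i.
Proof.
move=> fl; elim: s => [|i s IH].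
  by rewrite big_nil; under eq_fun do rewrite big_nil; exact: cvg_cst.
by rewrite big_cons; under eq_fun do rewrite big_cons; exact: cvgM.
Qed.

(** If |c_I| <= B 2^-|I| and the sums over cubes converge to S, the error of any
finite partial sum is at most B times the missing part of sum_I 2^-|I| = 2^d. *)
Lemma partial_sum_error (c : {ffun 'I_d -> nat} -> R) (B S : R) :
  (forall I, `|c I| <= B * 2^-1 ^+ mdegree I) ->
  \sum_(I <- index_cube d N) c I @[N --> \oo] --> S ->
  forall F : {fset {ffun 'I_d -> nat}},
  `|S - \sum_(I <- F) c I| <= B * (2 ^+ d - \sum_(I <- F) 2^-1 ^+ mdegree I).
Proof.
move=> cB cS F; have [N0 N0P] := fset_sub_index_cube F.
have B0 : 0 <= B.
  have := le_trans (normr_ge0 _) (cB [ffun=> 0%N]).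
  by rewrite pmulr_lge0// exprn_gt0.
have : `|\sum_(I <- index_cube d N) c I - \sum_(I <- F) c I| @[N --> \oo]
    --> `|S - \sum_(I <- F) c I|.
  by apply: cvg_norm; apply: cvgB => //; exact: cvg_cst.
move=> cv; rewrite -(cvg_lim _ cv)//; apply: limr_le; first exact: cvgP cv.
near=> N; have FN : (F `<=` index_cube d N)%fset.
  by apply: N0P; near: N; exact: nbhs_infty_ge.
rewrite (big_fset_subD c FN) addrAC subrr add0r.
apply: (le_trans (ler_norm_sum _ _ _)).
apply: (@le_trans _ _ (\sum_(I <- (index_cube d N `\` F)%fset) B * 2^-1 ^+ mdegree I)).
  by apply: ler_sum => I _; exact: cB.
rewrite -mulr_sumr ler_wpM2l// lerBrDl.
rewrite -(big_fset_subD (fun I => 2^-1 ^+ mdegree I) FN).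
exact: half_sum_le.
Unshelve. all: by end_near. Qed.

Lemma half_sum_cube_cvg (e : R) : 0 < e -> exists N, forall F : {fset {ffun 'I_d -> nat}},
  (index_cube d N `<=` F)%fset ->
  2 ^+ d - \sum_(I <- F) 2^-1 ^+ mdegree I < e.
Proof.
move=> e0.
have : \prod_(i <- index_enum 'I_d) ((1 - 2^-1 ^+ N) / (1 - 2^-1)) @[N --> \oo]
    --> \prod_(i <- index_enum 'I_d) ((1 - 0) / (1 - 2^-1) : R).
  apply: cvg_prod_seq => _; apply: cvgM; last exact: cvg_cst.
  apply: cvgB; first exact: cvg_cst.
  by apply: cvg_expr; rewrite ger0_norm ?invr_ge0// invf_lt1 ?ltr1n.
rewrite prodr_const card_ord subr0 (_ : 1 / (1 - 2^-1) = 2 :> R); last by field.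
move=> /cvgr_gt/(_ (2 ^+ d - e)) [|N _ /(_ N (leqnn N)) /= NP].
  by rewrite gtrBl.
exists N => F NF; rewrite ltrBlDl -ltrBlDr (lt_le_trans NP)//.
rewrite prodr_const card_ord -sum_geometric_cube; last first.
  by rewrite lt_eqF// invf_lt1 ?ltr1n.
by rewrite (big_fset_subD _ NF) lerDl sumr_ge0.
Qed.

End multi_index_sums.

Section cosine_expansion.
Context {R : realType}.
Variables (l s : R).
Hypotheses (l0 : 0 < l) (s0 : 0 < s).
Local Notation w := (pi / l).

(** The n-th Taylor coefficient at t0 of the j-th cosine. *)
Definition cosine_coeff (a : R) (j : nat) (t0 : R) (n : nat) : R :=
  cos (j%:R * w * (t0 - a)) * cos_coeff (j%:R * w) n -
  sin (j%:R * w * (t0 - a)) * sin_coeff (j%:R * w) n.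

Lemma cosine_coeff_cvg a j t0 t :
  \sum_(0 <= n < N) cosine_coeff a j t0 n * (t - t0) ^+ n @[N --> \oo]
    --> cosine a l j t.
Proof.
have -> : cosine a l j t = cos (j%:R * w * (t0 - a)) * cos (j%:R * w * (t - t0)) -
    sin (j%:R * w * (t0 - a)) * sin (j%:R * w * (t - t0)).
  by rewrite -cosD -mulrDr /cosine; congr (cos (_ * _)); ring.
rewrite (_ : (fun N => _) = (fun N =>
   cos (j%:R * w * (t0 - a)) * series (cos_coeff (j%:R * w * (t - t0))) N -
   sin (j%:R * w * (t0 - a)) * series (sin_coeff (j%:R * w * (t - t0))) N)).
  apply: cvgB; apply: cvgM; try exact: cvg_cst.
  - by rewrite unlock; exact: is_cvg_series_cos_coeff.
  - by rewrite unlock; exact: is_cvg_series_sin_coeff.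
apply/funext => N; rewrite /series /= !mulr_sumr -sumrB; apply: eq_bigr => n _.
rewrite /cosine_coeff /cos_coeff /sin_coeff /= !exprMn; ring.
Qed.

(** The n-th derivative of the cosine is at most (j w)^n, and (j w s)^n / n! is a
term of the series of exp (j w s). *)
Lemma cosine_coeff_le a j t0 n :
  `|cosine_coeff a j t0 n| <= expR (j%:R * w * s) * s^-1 ^+ n.
Proof.
have w0 : 0 <= j%:R * w by rewrite mulr_ge0// divr_ge0 ?pi_ge0// ltW.
apply: (@le_trans _ _ ((j%:R * w) ^+ n / n`!%:R)).
  have x0 : 0 <= (j%:R * w) ^+ n / n`!%:R by rewrite divr_ge0 ?exprn_ge0.
  have absx (b : bool) m : `|b%:R * (-1) ^+ m * (j%:R * w) ^+ n / n`!%:R| =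
      b%:R * ((j%:R * w) ^+ n / n`!%:R) :> R.
    rewrite -mulrA normrM (ger0_norm x0) normrM normrX normrN1 expr1n mulr1.
    by rewrite ger0_norm.
  apply: (le_trans (ler_normB _ _)).
  rewrite [X in X + _]normrM [X in _ + X]normrM !absx.
  have := cos_max (j%:R * w * (t0 - a)); have := sin_max (j%:R * w * (t0 - a)).
  by case: (odd n) => /= H1 H2; rewrite ?mul0r ?mul1r ?mulr0 ?addr0 ?add0r ler_piMl.
have : (j%:R * w * s) ^+ n / n`!%:R <= expR (j%:R * w * s).
  have y0 : 0 <= j%:R * w * s by rewrite mulr_ge0 ?(ltW s0).
  case: n => [|n].
    by rewrite expr0 fact0 divr1 (le_trans _ (expR_ge1Dx _))// lerDl.
  by apply: le_trans (expR_ge1Dxn n y0); rewrite lerDr.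
move=> H; rewrite exprVn ler_pdivlMr ?exprn_gt0//.
by rewrite mulrAC -exprMn.
Qed.

End cosine_expansion.

(** * Combinations of indicators of disjoint sets *)

Section glue.
Context dT (T : measurableType dT) {R : realType} (I : countType).
Variable D : I -> set T.
Hypotheses (mD : forall i, measurable (D i)) (tD : trivIset setT D).
Variable g : I -> T -> R.

Definition glue (x : T) : R :=
  if pselect (exists i, D i x) is left Dx then g (projT1 (cid Dx)) x else 0.

Lemma glueE i x : D i x -> glue x = g i x.
Proof.
move=> Dix; rewrite /glue; case: pselect => [Dx|]; last by case; exists i.
by congr (g _ x); apply: tD => //; exists x; split => //; exact: projT2 (cid Dx).
Qed.

Lemma glue_out x : (forall i, ~ D i x) -> glue x = 0.
Proof. by move=> Dx; rewrite /glue; case: pselect => // -[i Dix]; have := Dx i Dix. Qed.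

Lemma glueP x : (exists i, D i x /\ glue x = g i x) \/
  ((forall i, ~ D i x) /\ glue x = 0).
Proof.
have [[i Dix]|Dx] := pselect (exists i, D i x).
  by left; exists i; split => //; exact: glueE.
right; have Dx' i : ~ D i x by move=> Dix; apply: Dx; exists i.
by split=> //; exact: glue_out.
Qed.

Lemma measurable_glue : (forall i, measurable_fun setT (g i)) ->
  measurable_fun setT glue.
Proof.
move=> mg _ Y mY; rewrite setTI.
have -> : glue @^-1` Y = (\bigcup_i (D i `&` g i @^-1` Y)) `|`
    (~` (\bigcup_i D i) `&` [set _ | Y 0]).
  apply/seteqP; split => [x /= Yx|x [[i _ [Dix /= Yx]]|[Dx /= Y0]]].
  - have [[i [Dix gx]]|[Dx gx]] := glueP x; rewrite gx in Yx.
      by left; exists i.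
    by right; split => // -[i _ /Dx].
  - by rewrite /= (glueE Dix).
  - by rewrite /= glue_out// => i Dix; apply: Dx; exists i.
apply: measurableU.
  apply: countable_bigcupT_measurable => [|i]; first exact: countableP.
  by apply: measurableI => //; rewrite -[X in measurable X]setTI; exact: mg.
apply: measurableI.
  apply: measurableC; apply: countable_bigcupT_measurable => [|i]; last exact: mD.
  exact: countableP.
have [Y0|Y0] := pselect (Y 0).
  by rewrite (_ : [set _ | _] = setT); [exact: measurableT|apply/seteqP; split].
by rewrite (_ : [set _ | _] = set0); [exact: measurable0|apply/seteqP; split].
Qed.

End glue.

Section normalized_steps.
Context dT (T : measurableType dT) {R : realType} (I : countType).
Variables (mu : {measure set T -> \bar R}) (D : I -> set T).
Hypotheses (mD : forall i, measurable (D i)) (tD : trivIset setT D).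
Hypothesis muD : forall i, (0 < mu (D i) < +oo)%E.

Definition step_height (i : I) : R := (Num.sqrt (fine (mu (D i))))^-1.

(** The sum of the c_i v_i, where v_i is the indicator of D i divided by its norm
in L^2; these indicators form an orthonormal system. *)
Definition steps (c : I -> R) : T -> R :=
  glue D (fun i _ => c i * step_height i).

Lemma step_height_sqr i : ((step_height i ^+ 2)%:E * mu (D i) = 1%:E)%E.
Proof.
have /andP[m0 mfin] := muD i.
have fm : mu (D i) = (fine (mu (D i)))%:E by rewrite fineK// ge0_fin_numE// ltW.
have f0 : 0 < fine (mu (D i)) by rewrite -lte_fin -fm.
rewrite fm -EFinM /step_height exprVn sqr_sqrtr ?(ltW f0)//.
by rewrite mulVf// gt_eqF.
Qed.

Lemma measurable_steps c : measurable_fun setT (steps c).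
Proof. by apply: measurable_glue => // i; exact: measurable_cst. Qed.

(** At a given point at most one v_i differs from 0, so that identities and
inequalities between coefficients hold pointwise for the sums. *)
Lemma steps_point (i0 : I) x :
  exists i (r : R), 0 <= r /\ forall c, steps c x = c i * r.
Proof.
have [[i Dix]|Dx] := pselect (exists i, D i x).
  exists i, (step_height i); split; first by rewrite invr_ge0 sqrtr_ge0.
  by move=> c; rewrite /steps (glueE tD _ Dix).
exists i0, 0; split => // c; rewrite /steps glue_out ?mulr0// => i Dix.
by apply: Dx; exists i.
Qed.

Let integral_step (r : R) i :
  (\int[mu]_x (r ^+ 2 * step_height i ^+ 2 * \1_(D i) x)%:E = (r ^+ 2)%:E)%E.
Proof.
under eq_integral do rewrite EFinM.
rewrite ge0_integralZl ?lee_fin ?(mulr_ge0 (sqr_ge0 _) (sqr_ge0 _))//; last first.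
  exact/measurable_EFinP/measurable_indic.
by rewrite integral_indic// setIT EFinM -muleA step_height_sqr mule1.
Qed.

Lemma integral_steps_ge c (F : {fset I}) :
  ((\sum_(i <- F) c i ^+ 2)%:E <= \int[mu]_x (steps c x ^+ 2)%:E)%E.
Proof.
have -> : ((\sum_(i <- F) c i ^+ 2)%:E = \int[mu]_x \sum_(i <- F)
    (c i ^+ 2 * step_height i ^+ 2 * \1_(D i) x)%:E)%E.
  rewrite ge0_integral_sum//; last 2 first.
  - move=> i; apply/measurable_EFinP/measurable_funM; [exact: measurable_cst|exact: measurable_indic].
  - by move=> i x _; rewrite lee_fin (mulr_ge0 (mulr_ge0 (sqr_ge0 _) (sqr_ge0 _))).
  by rewrite -sumEFin; apply: eq_bigr => i _; rewrite integral_step.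
apply: ge0_le_integral => //.
- by move=> x _; apply: sume_ge0 => i _; rewrite lee_fin (mulr_ge0 (mulr_ge0 (sqr_ge0 _) (sqr_ge0 _))).
- apply: emeasurable_sum => i; apply/measurable_EFinP/measurable_funM; [exact: measurable_cst|exact: measurable_indic].
- exact/measurable_EFinP/measurable_funX/measurable_steps.
move=> x _; rewrite sumEFin lee_fin /steps.
have [[i [Dix ->]]|[Dx ->]] := glueP tD (fun i _ => c i * step_height i) x.
  have zero j : j != i -> c j ^+ 2 * step_height j ^+ 2 * \1_(D j) x = 0.
    move=> ji; rewrite indicE memNset ?mulr0// => Djx.
    by move/eqP: ji; apply; apply: tD => //; exists x.
  have [iF|iF] := boolP (i \in F).
    rewrite (big_fsetD1 i)//= big_seq big1 => [|j]; last first.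
      by rewrite !inE => /andP[/zero].
    by rewrite addr0 indicE mem_set// mulr1 -exprMn.
  rewrite big_seq big1 ?sqr_ge0// => j jF; apply: zero.
  by apply: contraNneq iF => <-.
rewrite big1 ?expr0n// => j _; rewrite indicE memNset ?mulr0//.
Qed.

Lemma integral_steps_le c (S : R) :
  (forall F : {fset I}, \sum_(i <- F) c i ^+ 2 <= S) ->
  (\int[mu]_x (steps c x ^+ 2)%:E <= S%:E)%E.
Proof.
move=> cS; pose f (p : nat) (x : T) : R := if pickle_inv p is Some i then
  c i ^+ 2 * step_height i ^+ 2 * \1_(D i) x else 0.
have f0 p x : 0 <= f p x.
  by rewrite /f; case: pickle_inv => // i; rewrite (mulr_ge0 (mulr_ge0 (sqr_ge0 _) (sqr_ge0 _))).
have mf p : measurable_fun setT (fun x => (f p x)%:E).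
  apply/measurable_EFinP; rewrite /f; case: pickle_inv => [i|].
    by apply: measurable_funM; [exact: measurable_cst|exact: measurable_indic].
  exact: measurable_cst.
apply: (@le_trans _ _ (\int[mu]_x \sum_(0 <= p <oo) (f p x)%:E)%E).
  apply: ge0_le_integral => //.
  - by move=> x _; rewrite lee_fin sqr_ge0.
  - exact/measurable_EFinP/measurable_funX/measurable_steps.
  - by apply: ge0_emeasurable_sum => // p x _ _; rewrite lee_fin.
  move=> x _; rewrite /steps.
  have [[i [Dix ->]]|[Dx ->]] := glueP tD (fun i _ => c i * step_height i) x.
    apply: le_trans (nneseries_lim_ge (choice.pickle i).+1 _); last first.
      by move=> p _; rewrite lee_fin.
    rewrite big_nat_recr//= [X in (_ <= _ + X)%E](_ : _ = ((c i * step_height i) ^+ 2)%:E).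
      by rewrite leeDr// sume_ge0// => p _; rewrite lee_fin.
    by rewrite /f pickleK_inv indicE mem_set// mulr1 -exprMn.
  by rewrite expr0n; apply: nneseries_ge0 => p _ _; rewrite lee_fin.
rewrite integral_nneseries//; last by move=> p x _; rewrite lee_fin.
apply: lime_le.
  by apply: is_cvg_nneseries => p _ _; apply: integral_ge0 => x _; rewrite lee_fin.
apply: nearW => n.
have -> : (\sum_(0 <= p < n) \int[mu]_x (f p x)%:E)%E =
    (\sum_(i <- pmap pickle_inv (iota 0 n)) c i ^+ 2)%:E.
  rewrite big_pmap -sumEFin /index_iota subn0; apply: eq_bigr => p _.
  rewrite /f; case: (pickle_inv p) => [i|] /=; first exact: integral_step.
  by rewrite integral0.
rewrite lee_fin; apply: le_trans (cS [fset i in pmap pickle_inv (iota 0 n)]%fset).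
rewrite le_eqVlt; apply/orP; left; apply/eqP.
apply: perm_big; apply: uniq_perm => [||i]; last by rewrite !inE.
  by apply: (pmap_uniq (@pickle_invK _)); exact: iota_uniq.
exact: fset_uniq.
Qed.

End normalized_steps.

(** * Products of cosines *)

Section cosine_tensors.
Context {R : realType} (d : nat).
Local Notation J_ := {ffun 'I_d -> nat}.
Variables (a : 'rV[R]_d) (l : R).
Hypothesis l0 : 0 < l.

Definition max_index (J : J_) : nat := \max_i J i.

Lemma mdegree_le_max_index J : (mdegree J <= d * max_index J)%N.
Proof.
rewrite /mdegree -[X in (_ <= X * _)%N]card_ord -sum_nat_const.
by apply: leq_sum => i _; exact: leq_bigmax.
Qed.

Definition cosines (J : J_) (y : 'rV[R]_d) : R :=
  \prod_i cosine (a ord0 i) l (J i) (y ord0 i).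

Lemma cosines_le1 J y : `|cosines J y| <= 1.
Proof.
rewrite /cosines normr_prod; apply: prodr_ile1 => i _.
by rewrite normr_ge0 cos_max.
Qed.

Lemma measurable_cosines J : measurable_fun setT (cosines J).
Proof.
rewrite /cosines; apply: measurable_prod => i _.
apply: measurableT_comp; last exact: measurable_coord.
exact: cosine_measurable.
Qed.

Definition cosine_cube : set 'rV[R]_d :=
  rV_box (fun i => `[a ord0 i, a ord0 i + l]%classic).

Lemma cosines_orth J K :
  \int[lebesgue_rV d]_(y in cosine_cube) (cosines J y * cosines K y) =
  if J == K then \prod_i ((l + (if J i == 0%N then l else 0)) / 2) else 0.
Proof.
pose g i t : R := ((fun t => cosine (a ord0 i) l (J i) t * cosine (a ord0 i) l (K i) t)
  \_ `[a ord0 i, a ord0 i + l]) t.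
have gI i : lebesgue_measure.-integrable setT (EFin \o g i).
  rewrite -restrict_EFin; apply/integrable_restrict => //; rewrite setTI.
  apply: continuous_compact_integrable; first exact: segment_compact.
  by apply: continuous_subspaceT => t; apply: continuousM; exact: continuous_cosine.
rewrite Rintegral_mkcond (@eq_Rintegral _ _ _ _ _ (fun y : 'rV[R]_d => \prod_i g i (y ord0 i))).
  rewrite (lebesgue_rV_integral_prod gI).2.
  under eq_bigr do rewrite -Rintegral_mkcond cosine_orth//.
  case: eqVneq => [->|/eqP JK]; first by apply: eq_bigr => i _; rewrite eqxx.
  have [i Ji] : exists i, J i <> K i.
    by apply: contrapT => H; apply: JK; apply/ffunP => i; apply: contrapT => Ji; apply: H; exists i.
  by rewrite (bigD1 i)//= (introF eqP Ji) mul0r.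
move=> y _; rewrite patchE; case: ifPn => [/set_mem yQ|yQ].
  rewrite /cosines -big_split; apply: eq_bigr => i _ /=.
  by rewrite /g patchE mem_set//; exact: yQ.
have [i yi] : exists i, ~ `[a ord0 i, a ord0 i + l]%classic (y ord0 i).
  apply: contrapT => H; move/negP: yQ; apply; apply: mem_set => i.
  by apply: contrapT => yi; apply: H; exists i.
by rewrite (bigD1 i)//= /g patchE memNset// mul0r.
Qed.

Lemma cosines_norm_ge J :
  (l / 2) ^+ d <= \int[lebesgue_rV d]_(y in cosine_cube) (cosines J y * cosines J y).
Proof.
rewrite cosines_orth eqxx -[X in _ ^+ X]card_ord -prodr_const.
apply: ler_prod => i _; rewrite divr_ge0 ?(ltW l0)//=.
by rewrite ler_pM2r ?invr_gt0// lerDl; case: ifP; rewrite ?(ltW l0).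
Qed.

Section expansion.
Variables (s rho : R).
Hypothesis s0 : 0 < s.
Hypothesis srho : expR (d%:R * (pi / l * s)) = rho^-1.

Definition cosines_coeff (y0 : 'rV[R]_d) (J I : J_) : R :=
  \prod_i cosine_coeff l (a ord0 i) (J i) (y0 ord0 i) (I i).

(** The d factors exp (J_i (pi / l) s) amount to at most rho^-(max J): the radius
s is tied to rho by srho. *)
Lemma cosines_coeff_le y0 J I :
  `|cosines_coeff y0 J I| <= rho ^- max_index J * s^-1 ^+ mdegree I.
Proof.
rewrite /cosines_coeff normr_prod.
have ws0 : 0 <= pi / l * s by rewrite mulr_ge0 ?divr_ge0 ?pi_ge0 ?(ltW l0) ?(ltW s0).
apply: (@le_trans _ _ (\prod_i (expR (pi / l * s) ^+ max_index J * s^-1 ^+ I i))).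
  apply: ler_prod => i _; rewrite normr_ge0 /=.
  apply: (le_trans (cosine_coeff_le l0 s0 _ _ _ _)).
  rewrite ler_wpM2r ?exprn_ge0 ?invr_ge0 ?(ltW s0)// -expRM_natl ler_expR.
  by rewrite -mulrA ler_wpM2r// ler_nat; exact: leq_bigmax.
rewrite big_split /= prodr_const card_ord prodrXr ler_wpM2r//.
  by rewrite exprn_ge0 ?invr_ge0 ?(ltW s0).
by rewrite exprAC -expRM_natl srho exprVn.
Qed.

Lemma cosines_term_le y0 y J I : `|y - y0| < s / 2 ->
  `|cosines_coeff y0 J I * monomial (y - y0) I| <=
  rho ^- max_index J * 2^-1 ^+ mdegree I.
Proof.
move=> ys; rewrite normrM.
apply: (@le_trans _ _ ((rho ^- max_index J * s^-1 ^+ mdegree I) *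
    (s / 2) ^+ mdegree I)).
  apply: ler_pM => //; first exact: cosines_coeff_le.
  apply: monomial_le => i; apply: ltW; apply: le_lt_trans ys; exact: rV_norm_coord.
by rewrite -mulrA -exprMn mulrA mulVf ?mul1r// gt_eqF.
Qed.

Lemma cosines_expansion y0 y J (F : {fset J_}) : `|y - y0| < s / 2 ->
  `|cosines J y - \sum_(I <- F) cosines_coeff y0 J I * monomial (y - y0) I| <=
  rho ^- max_index J * (2 ^+ d - \sum_(I <- F) 2^-1 ^+ mdegree I).
Proof.
move=> ys; apply: partial_sum_error => [I|]; first exact: cosines_term_le.
rewrite (_ : (fun N => _) = (fun N => \prod_i \sum_(0 <= n < N)
    cosine_coeff l (a ord0 i) (J i) (y0 ord0 i) n * (y ord0 i - y0 ord0 i) ^+ n)).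
  apply: cvg_prod_seq => i; exact: cosine_coeff_cvg.
apply/funext => N; rewrite -sum_index_cube_prod; apply: eq_bigr => I _.
rewrite /cosines_coeff /monomial -big_split; apply: eq_bigr => i _ /=.
by rewrite !mxE.
Qed.

End expansion.

(** max J >= |J| / d, so the sum is dominated by the product of d geometric series
of ratio tau^(1/d). *)
Lemma sum_max_index_le (tau : R) : 0 < tau < 1 -> (0 < d)%N ->
  exists S : R, forall F : {fset J_}, \sum_(J <- F) tau ^+ max_index J <= S.
Proof.
move=> /andP[t0 t1] d0; pose q := tau `^ (d%:R)^-1.
have q0 : 0 <= q by exact: powR_ge0.
have qd : q ^+ d = tau.
  rewrite -powR_mulrn// -powRrM mulVf ?powRr1 ?ltW//.
  by rewrite pnatr_eq0 -lt0n.
have q1 : q < 1.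
  rewrite ltNge; apply/negP => q1.
  by have := exprn_ege1 d q1; rewrite qd leNgt t1.
exists ((1 - q)^-1 ^+ d) => F; apply: (@le_trans _ _ (\sum_(J <- F) q ^+ mdegree J)).
  apply: ler_sum => J _; rewrite -qd -exprM.
  by apply: ler_wiXn2l; rewrite ?(ltW q1)//; exact: mdegree_le_max_index.
by apply: sum_geometric_le; rewrite q0.
Qed.

End cosine_tensors.

(** * Boxes inside open sets *)

Section room_in_open_sets.
Context {R : realType}.

Lemma lebesgue_rV_itv_box n (a b : 'I_n -> R) : (forall i, a i < b i) ->
  (0 < lebesgue_rV n (rV_box (fun i => `]a i, b i[%classic)) < +oo)%E.
Proof.
move=> ab; rewrite lebesgue_rV_box => [|i]; last exact: measurable_itv.
rewrite (eq_bigr (fun i => (b i - a i)%:E)) => [|i _]; last first.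
  by rewrite lebesgue_measure_itv/= lte_fin ab.
rewrite prodEFin ltry lte_fin andbT.
by apply: prodr_gt0 => i _; rewrite subr_gt0.
Qed.

(** Boxes whose first coordinate, counted from that of a point of U, runs over
the disjoint intervals ]e / (p + 2), e / (p + 1)[. *)
Lemma open_disjoint_boxes n (U : set 'rV[R]_n) : (0 < n)%N -> open U -> U !=set0 ->
  exists D : nat -> set 'rV[R]_n,
    [/\ forall p, measurable (D p), trivIset setT D,
        forall p, (0 < lebesgue_rV n (D p) < +oo)%E & forall p, D p `<=` U].
Proof.
case: n U => // m U _ oU [v Uv]; have [e e0 eU] := open_rV_cube oU Uv.
pose lo p (i : 'I_m.+1) : R := v ord0 i + (if i == ord0 then e / p.+2%:R else 0).
pose hi p (i : 'I_m.+1) : R := v ord0 i + (if i == ord0 then e / p.+1%:R else e).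
have le_e p : e / p.+1%:R <= e.
  by rewrite ler_pdivrMr// ler_peMr ?ler1n ?(ltW e0).
exists (fun p => rV_box (fun i => `]lo p i, hi p i[%classic)); split.
- by move=> p; apply: measurable_rV_box => i; exact: measurable_itv.
- apply: ltn_trivIset => q p pq; apply/seteqP; split => // w [/(_ ord0) wp /(_ ord0)].
  move: wp; rewrite /= !in_itv/= /lo /hi eqxx => /andP[w1 _] /andP[_ w2].
  have : e / p.+2%:R < e / q.+1%:R.
    rewrite -(ltrD2l (v ord0 ord0)); exact: lt_trans w1 w2.
  rewrite ltr_pM2l// ltf_pV2 ?posrE// ltr_nat ltnNge.
  by move=> /negP; apply; rewrite ltnS.
- move=> p; apply: lebesgue_rV_itv_box => i; rewrite /lo /hi ltrD2l.
  by case: ifP => // _; rewrite ltr_pM2l// ltf_pV2 ?posrE// ltr_nat.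
- move=> p w wp; apply: eU => i; have := wp i.
  rewrite /= in_itv/= /lo /hi ltr_norml; have := le_e p.
  have : 0 < e / p.+2%:R by rewrite divr_gt0.
  move: (e / p.+1%:R) (e / p.+2%:R) => x y.
  by case: ifP => _ ? ? /andP[? ?]; apply/andP; split; lra.
Qed.

Lemma open_cube n (U : set 'rV[R]_n) : open U -> U !=set0 ->
  exists a l, 0 < l /\ @cosine_cube R n a l `<=` U.
Proof.
move=> oU [v Uv]; have [e e0 eU] := open_rV_cube oU Uv.
exists v, (e / 2); split => [|w wv]; first by rewrite divr_gt0.
apply: eU => i; have := wv i; rewrite /= in_itv/= ltr_norml => /andP[? ?].
by apply/andP; split; lra.
Qed.

End room_in_open_sets.

(** * The optimal kernel *)

Section optimal_kernel.
Context {R : realType} (d' d : nat).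
Local Notation J_ := {ffun 'I_d -> nat}.
Variables (Om' : set 'rV[R]_d') (Om : set 'rV[R]_d).
Variables (a : 'rV[R]_d) (l tau : R) (D : J_ -> set 'rV[R]_d').
Hypotheses (oOm : open Om) (bOm : bounded_set Om) (oOm' : open Om').
Hypotheses (d0 : (0 < d)%N) (l0 : 0 < l) (tau01 : 0 < tau < 1).

Local Notation mu := (lebesgue_rV d).
Local Notation nu := (lebesgue_rV d').
Local Notation mOm := (open_measurable_rV oOm).
Local Notation mOm' := (open_measurable_rV oOm').
Hypotheses (mD : forall J, measurable (D J)) (tD : trivIset setT D).
Hypotheses (nuD : forall J, (0 < nu (D J) < +oo)%E) (DOm' : forall J, D J `<=` Om').

Let tau0 : 0 < tau. Proof. by case/andP: tau01. Qed.
Let tau1 : tau < 1. Proof. by case/andP: tau01. Qed.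

(** The operator maps e_J cut off to the cube to tau^(max J) |e_J|^2 v_J. With the
weight tau^(max J) rather than tau^|J| there are (m + 1)^d indices of weight at
least tau^m, as the rate tau^(n^(1/d)) for the given tau requires. *)
Definition optimal_kernel (x : 'rV[R]_d') (y : 'rV[R]_d) : R :=
  steps nu D (fun J => tau ^+ max_index J * cosines a l J y) x.

Let point x : exists (J : J_) (r : R),
  0 <= r /\ forall c : J_ -> R, steps nu D c x = c J * r.
Proof. exact: (steps_point nu tD [ffun=> 0%N] x). Qed.

Let square_sum : exists S : R, forall F : {fset J_},
  \sum_(J <- F) tau ^+ max_index J <= S.
Proof. exact: sum_max_index_le. Qed.

Let measurable_optimal_kernel :
  measurable_fun setT (fun z : 'rV[R]_d' * 'rV[R]_d => optimal_kernel z.1 z.2).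
Proof.
rewrite (_ : (fun _ => _) = glue (fun J => D J `*` setT) (fun J z =>
    tau ^+ max_index J * cosines a l J z.2 * step_height nu D J)).
  apply: measurable_glue => [J||J].
  - by apply: measurableX.
  - apply/trivIsetP => J K _ _ JK; apply/seteqP; split => // -[x y] [[/= Jx _] [Kx _]].
    by move/eqP: JK; apply; apply: tD => //; exists x.
  - apply: measurable_funM; last exact: measurable_cst.
    apply: measurable_funM; first exact: measurable_cst.
    by apply: measurableT_comp; [exact: measurable_cosines|exact: measurable_snd].
have tDX : trivIset setT (fun J => D J `*` [set: 'rV[R]_d]).
  by move=> J K _ _ [[x y] [[/= Jx _] [Kx _]]]; apply: tD => //; exists x.
apply/funext => -[x y] /=; rewrite /optimal_kernel /steps.
have [[J [Dx ->]]|[Dx ->]] := glueP tD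
    (fun J _ => tau ^+ max_index J * cosines a l J y * step_height nu D J) x.
  by rewrite (glueE tDX _ (conj Dx I : (D J `*` [set: _]) (x, y))).
by rewrite glue_out// => J [/= Jx _]; exact: (Dx J).
Qed.

Lemma optimal_L2kernel : L2kernel Om' Om optimal_kernel.
Proof.
have [S SP] := square_sum.
have S0 : 0 <= S by have := SP fset0; rewrite big_seq_fset0.
set f := (fun z => optimal_kernel z.1 z.2) \_ (Om' `*` Om).
have mf : measurable_fun setT f.
  apply/(measurable_restrictT _ (measurableX mOm' mOm)).
  exact: measurable_funTS measurable_optimal_kernel.
have mf2 : measurable_fun setT (fun z => (f z ^+ 2)%:E).
  exact/measurable_EFinP/measurable_funX.
apply/Lfun2P; split => //.
rewrite (fubini_tonelli2 (fun z => (f z ^+ 2)%:E))//; last first.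
  by move=> z; rewrite lee_fin sqr_ge0.
apply: (@le_lt_trans _ _ (\int[mu]_(y in Om) (S%:E))%E); last first.
  rewrite (integral_cst _ mOm); apply: lte_mul_pinfty => //.
  exact: bounded_lebesgue_rV_lty mOm bOm.
rewrite [leRHS]integral_mkcond; apply: ge0_le_integral => //.
- by move=> y _; exact: integral_sqr_ge0.
- apply: (measurable_fun_fubini_tonelli_G (fun z => (f z ^+ 2)%:E)) => //.
  by move=> z; rewrite lee_fin sqr_ge0.
- by apply/(measurable_restrictT _ mOm); exact: measurable_cst.
move=> y _; rewrite /fubini_G patchE; case: ifPn => yOm; last first.
  by rewrite integral0_eq// => x _; rewrite /f patchE in_setX /= (negbTE yOm) andbF expr0n.
apply: (@le_trans _ _ (\int[nu]_x (optimal_kernel x y ^+ 2)%:E)%E).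
  apply: ge0_le_integral => //.
  - by move=> x _; rewrite lee_fin sqr_ge0.
  - exact: measurableT_comp mf2 (measurable_pair2 y).
  - exact/measurable_EFinP/measurable_funX/measurable_steps.
  - by move=> x _; rewrite lee_fin /f patchE; case: ifPn => //; rewrite expr0n sqr_ge0.
apply: integral_steps_le => // F; apply: le_trans (SP F); apply: ler_sum => J _.
rewrite exprMn; apply: (@le_trans _ _ (tau ^+ max_index J ^+ 2 * 1)).
  rewrite ler_wpM2l ?sqr_ge0// -[leRHS](expr1n _ 2) -[leLHS]real_normK ?num_real//.
  by rewrite lerXn2r ?nnegrE// cosines_le1.
by rewrite mulr1 -exprM ler_wiXn2l ?(ltW tau0) ?(ltW tau1)// leq_pmulr.
Qed.

(** With rho = sqrt tau, of each factor tau^(max J) one half pays for the growth of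
the Taylor coefficients and the other makes W square integrable; every
coefficient and every remainder of the expansion is then at most a constant
times W. *)
Lemma optimal_analytic_kernel : analytic_kernel Om' Om optimal_kernel.
Proof.
pose rho := Num.sqrt tau.
have rho0 : 0 < rho by rewrite sqrtr_gt0.
have rho2 : rho ^+ 2 = tau by rewrite sqr_sqrtr ?ltW.
have rho1 : rho < 1 by rewrite -(ltr_pXn2r (n:=2)) ?nnegrE ?ltW// expr1n rho2.
(* s is the radius for which exp (d (pi / l) s) = rho^-1 *)
have w0 : 0 < pi / l by rewrite divr_gt0 ?pi_gt0.
have dw0 : 0 < d%:R * (pi / l) :> R by rewrite mulr_gt0 ?ltr0n.
pose s : R := ln rho^-1 / (d%:R * (pi / l)).
have s0 : 0 < s by rewrite divr_gt0// ln_gt0// invf_gt1.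
have srho : expR (d%:R * (pi / l * s)) = rho^-1.
  by rewrite mulrA mulrCA mulfV ?mulr1 ?lnK ?posrE ?invr_gt0// gt_eqF.
have [S SP] := square_sum.
pose W := steps nu D (fun J => rho ^+ max_index J).
have mW : measurable_fun setT W by exact: measurable_steps.
have WL : L2 nu Om' W.
  apply: (Lfun2_restrict mOm'); apply/Lfun2P; split => //.
  apply: (@le_lt_trans _ _ S%:E); last exact: ltry.
  apply: integral_steps_le => // F; apply: le_trans (SP F); apply: ler_sum => J _.
  by rewrite exprAC rho2.
have Wfin : L2norm nu Om' W = (fine (L2norm nu Om' W))%:E.
  by rewrite fineK// ge0_fin_numE ?L2norm_ge0// L2norm_lty.
have tr m : tau ^+ m * rho ^- m = rho ^+ m.
  by rewrite -rho2 -exprM mul2n -addnn exprD mulfK// expf_eq0 gt_eqF// andbF.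
have Wpoint x (J : J_) (r : R) : W x = rho ^+ max_index J * r -> 0 <= r -> `|W x| = rho ^+ max_index J * r.
  by move=> -> r0; rewrite ger0_norm// mulr_ge0// exprn_ge0// ltW.
pose A y0 I x := steps nu D (fun J => tau ^+ max_index J * cosines_coeff a l y0 J I) x.
have mA y0 I : measurable_fun setT (A y0 I) by exact: measurable_steps.
have AW y0 I x : `|A y0 I x| <= s^-1 ^+ mdegree I * `|W x|.
  have [J [r [r0 rP]]] := point x.
  rewrite (Wpoint x J r (rP _) r0) [A _ _ _]rP normrM (ger0_norm r0) mulrA ler_wpM2r//.
  rewrite normrM ger0_norm ?exprn_ge0 ?(ltW tau0)//.
  apply: le_trans (ler_wpM2l _ (cosines_coeff_le a l0 s0 srho y0 J I)) _.
    by rewrite exprn_ge0 ?ltW.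
  by rewrite mulrA tr mulrC.
have sI0 (I : J_) : 0 <= s^-1 ^+ mdegree I by rewrite exprn_ge0// invr_ge0 ltW.
have AL y0 I := L2norm_le mOm' (mA y0 I) WL (sI0 I) (AW y0 I).
have expan y0 y (F : {fset J_}) x : `|y - y0| < s / 2 ->
    `|optimal_kernel x y - \sum_(I <- F) A y0 I x * monomial (y - y0) I| <=
    (2 ^+ d - \sum_(I <- F) 2^-1 ^+ mdegree I) * `|W x|.
  move=> ys; have [J [r [r0 rP]]] := point x.
  rewrite (Wpoint x J r (rP _) r0) /optimal_kernel rP.
  rewrite (eq_bigr (fun I => (cosines_coeff a l y0 J I * monomial (y - y0) I) *
      (tau ^+ max_index J * r))) => [|I _]; last by rewrite /A rP; ring.
  rewrite -mulr_suml (mulrC (\sum_(_ <- _) _)) mulrAC -mulrBr normrM.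
  rewrite ger0_norm ?mulr_ge0 ?exprn_ge0 ?(ltW tau0)//.
  apply: le_trans (ler_wpM2l _ (cosines_expansion a l0 s0 srho J F ys)) _.
    by rewrite mulr_ge0 ?exprn_ge0 ?(ltW tau0).
  by rewrite -[X in _ <= _ * (X * r)]tr le_eqVlt; apply/orP; left; apply/eqP; ring.
have mk y : measurable_fun setT (optimal_kernel ^~ y) by exact: measurable_steps.
exists setT, optimal_kernel; split => [|y _||y0 _].
- by split; [exact: openT|].
- have kW x : `|optimal_kernel x y| <= 1 * `|W x|.
    have [J [r [r0 rP]]] := point x.
    rewrite (Wpoint x J r (rP _) r0) /optimal_kernel rP mul1r normrM (ger0_norm r0).
    rewrite ler_wpM2r// normrM ger0_norm ?exprn_ge0 ?(ltW tau0)//.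
    apply: (@le_trans _ _ (tau ^+ max_index J)).
      by rewrite ler_piMr ?cosines_le1// exprn_ge0 ?(ltW tau0).
    by rewrite -rho2 -exprM ler_wiXn2l ?(ltW rho0) ?(ltW rho1)// leq_pmull.
  exact: (L2norm_le mOm' (mk y) WL ler01 kW).1.
- by move=> y _; apply/nearW.
exists (A y0), (s / 2); split; first by rewrite divr_gt0.
- by move=> I; have [] := AL y0 I.
- apply: (@le_lt_trans _ _ (L2norm nu Om' W * (2 ^+ d)%:E)%E); last first.
    by rewrite Wfin -EFinM ltry.
  have term I : (L2norm nu Om' (A y0 I) * ((s / 2) ^+ mdegree I)%:E <=
      L2norm nu Om' W * (2^-1 ^+ mdegree I)%:E)%E.
    apply: le_trans (lee_wpmul2r _ (AL y0 I).2) _.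
      by rewrite lee_fin exprn_ge0// divr_ge0// ltW.
    rewrite muleAC muleC -EFinM -exprMn mulKf// gt_eqF//.
  apply: ge_ereal_sup => _ /= [F [finF _] <-].
  rewrite fsbig_finite//=.
  apply: (@le_trans _ _ (\sum_(I <- fset_set F) L2norm nu Om' W * (2^-1 ^+ mdegree I)%:E)%E).
    by apply: lee_sum => I _; exact: term.
  rewrite -ge0_sume_distrr => [|I _]; last by rewrite lee_fin exprn_ge0.
  apply: lee_wpmul2l; first exact: L2norm_ge0.
  by rewrite sumEFin lee_fin half_sum_le.
- move=> y ys; split => // e e0.
  pose N0 := fine (L2norm nu Om' W).
  have N00 : 0 <= N0 by rewrite fine_ge0 ?L2norm_ge0.
  have e10 : 0 < e / (N0 + 1) by rewrite divr_gt0// ltr_wpDl.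
  have [N NP] := half_sum_cube_cvg d e10.
  exists (index_cube d N) => F NF; have ltF := NP F NF.
  set del := 2 ^+ d - _ in ltF.
  have del0 : 0 <= del by rewrite subr_ge0 half_sum_le.
  have mf : measurable_fun setT (fun x => optimal_kernel x y -
      \sum_(I <- F) A y0 I x * monomial (y - y0) I).
    apply: measurable_funB => //; apply: measurable_sum => I.
    by apply: measurable_funM => //; exact: measurable_cst.
  apply: le_lt_trans (L2norm_le mOm' mf WL del0 (fun x => expan y0 y F x ys)).2 _.
  rewrite Wfin -EFinM lte_fin -/N0; apply: (@le_lt_trans _ _ (e / (N0 + 1) * N0)).
    by rewrite ler_wpM2r// ltW.
  by rewrite mulrAC ltr_pdivrMr ?ltr_wpDl// ltr_pM2l// ltrDl.
Qed.

Hypothesis QOm : cosine_cube a l `<=` Om.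
Local Notation E := (LfunType mu (le1_2e R)).
Local Notation dot := (L2form mu mOm).
Local Notation k := optimal_kernel.

Let mOm_fin : (mu Om < +oo)%E := bounded_lebesgue_rV_lty mOm bOm.

Let measurable_cube : measurable (cosine_cube a l).
Proof. by apply: measurable_rV_box => i; exact: measurable_itv. Qed.

Let cosines_restrict_Lfun (A : set 'rV[R]_d) J : measurable A -> A `<=` Om ->
  (cosines a l J) \_ A \in Lfun mu 2%:E.
Proof.
move=> mA AOm; apply: (Lfun2_bounded (A := A) (M := 1) _ mA _ _ _).1.
- apply/(measurable_restrictT _ mA); exact: measurable_funTS (measurable_cosines _ _ _).
- by apply: le_lt_trans mOm_fin; apply: le_measure; rewrite ?inE//; exact: mOm.
- by move=> x Ax; rewrite patchE mem_set// cosines_le1.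
- by move=> x Ax; rewrite patchE memNset.
Qed.

(** The test functions live on the cube, where they are orthogonal, but the
operator integrates the cosines over the whole of Om. *)
Let wave J : E := Lfun2_elt (cosines_restrict_Lfun J measurable_cube QOm).
Let full_wave J : E := Lfun2_elt (cosines_restrict_Lfun J mOm (@subset_refl _ Om)).

Let wave_norm J : R :=
  \int[mu]_(y in cosine_cube a l) (cosines a l J y * cosines a l J y).

Let wave_norm_ge J : (l / 2) ^+ d <= wave_norm J.
Proof. exact: cosines_norm_ge. Qed.

Let half_cube_gt0 : 0 < (l / 2) ^+ d :> R.
Proof. by rewrite exprn_gt0// divr_gt0. Qed.

Let wave_norm_gt0 J : 0 < wave_norm J.
Proof. exact: lt_le_trans (wave_norm_ge J). Qed.

Let wave_orth J K : dot (wave J) (wave K) = if J == K then wave_norm J else 0.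
Proof.
rewrite (_ : dot _ _ =
  \int[mu]_(y in cosine_cube a l) (cosines a l J y * cosines a l K y)).
  by case: eqVneq => [->//|/negbTE JK]; rewrite cosines_orth// JK.
rewrite /= /L2dotD /L2dot [LHS]Rintegral_mkcond [RHS]Rintegral_mkcond.
apply: eq_Rintegral => y _; rewrite !patchE /= !patchE.
have [yQ|yQ] := boolP (y \in cosine_cube a l); last by rewrite ?mulr0 if_same.
by rewrite mem_set//; apply: QOm; exact: set_mem yQ.
Qed.

Let full_wave_orth J K : dot (full_wave J) (wave K) = if J == K then wave_norm J else 0.
Proof.
rewrite -wave_orth; apply: eq_Rintegral => y yOm; rewrite /= !patchE yOm.
by case: ifPn => // _; rewrite !mulr0.
Qed.

Lemma kernel_op_optimal (f : E) x : kernel_op mu Om k f x =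
  steps nu D (fun J => tau ^+ max_index J * dot (full_wave J) f) x.
Proof.
have [J [r [_ rP]]] := point x; rewrite rP /kernel_op mulrAC -(RintegralZl _ mOm); last first.
  exact: (Lfun2_integrableM mOm (LfunP (full_wave J)) (LfunP f)).
apply: eq_Rintegral => y yOm; rewrite /optimal_kernel rP /= patchE yOm; ring.
Qed.

Section finite_family.
Variables (n : nat) (J : 'I_n -> J_).
Hypothesis Jinj : injective J.

Let comb (c : 'I_n -> R) : E := \sum_i c i *: wave (J i).

Let full_wave_comb c i : dot (full_wave (J i)) (comb c) = c i * wave_norm (J i).
Proof.
rewrite form_sym form_lincombl (bigD1 i)// form_sym full_wave_orth eqxx.
rewrite big1 => [|j ji]; first exact: addr0.
rewrite form_sym full_wave_orth ifN ?mulr0//.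
by apply: contra_neqN ji => /eqP/Jinj.
Qed.

Let comb_norm c : dot (comb c) (comb c) = \sum_i c i ^+ 2 * wave_norm (J i).
Proof.
rewrite form_lincombl; apply: eq_bigr => i _.
rewrite form_sym form_lincombl (bigD1 i)// wave_orth eqxx.
rewrite big1 => [|j ji]; first by rewrite /= addr0 mulrA -expr2.
rewrite wave_orth ifN ?mulr0//.
by apply: contra_neqN ji => /eqP/Jinj.
Qed.

Lemma waves_free : form_free dot (fun i => wave (J i)).
Proof.
move=> c; rewrite -/(comb c) comb_norm => /eqP; rewrite psumr_eq0 => [/allP c0 i|i _].
  have := c0 i (mem_index_enum i); rewrite /= mulf_eq0 (gt_eqF (wave_norm_gt0 _)) orbF.
  by rewrite sqrf_eq0 => /eqP.
by rewrite mulr_ge0 ?sqr_ge0// ltW.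
Qed.

(** The coefficients of K f on the orthonormal system of the normalized
indicators are tau^(max J) c_J |e_J|^2, where f = sum c_J e_J and |e_J| is the
norm on the cube. *)
Lemma kernel_form_waves_ge (kL2 : L2kernel Om' Om k) M c :
  (forall i, (max_index (J i) <= M)%N) ->
  (tau ^+ M * Num.sqrt ((l / 2) ^+ d)) ^+ 2 * dot (comb c) (comb c) <=
  kernel_form mOm kL2 (comb c) (comb c).
Proof.
move=> JM; rewrite comb_norm; pose f := comb c; pose b K := dot (full_wave K) f.
have bJ i : b (J i) = c i * wave_norm (J i) by exact: full_wave_comb.
have [opL _ _] := kernel_adjP kL2.
have /Lfun2P[mop opfin] := opL _ (L2_Lfun mOm f).
have opE : kernel_op mu Om k f \_ Om' =
    steps nu D (fun J => tau ^+ max_index J * b J).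
  apply/funext => x; rewrite patchE; case: ifPn => xOm'; first exact: kernel_op_optimal.
  rewrite /steps glue_out// => K DKx; move/negP: xOm'; apply.
  by apply: mem_set; exact: DOm' DKx.
rewrite -[leRHS]/(L2dot nu Om' (kernel_op mu Om k f) (kernel_op mu Om k f)).
rewrite L2dotE L2dot_sqr opE.
apply: (@le_trans _ _ (\sum_(K <- [fset J i | i in 'I_n]%fset)
    (tau ^+ max_index K * b K) ^+ 2)); last first.
  rewrite -lee_fin fineK; last by rewrite ge0_fin_numE ?integral_sqr_ge0// -opE.
  exact: integral_steps_ge.
rewrite big_imfset/= => [|i j _ _]; last exact: Jinj.
rewrite big_enum/= mulr_sumr; apply: ler_sum => i _.
have := half_cube_gt0; have := wave_norm_ge (J i); rewrite bJ.
set q := (l / 2) ^+ d => qJ q0; rewrite !exprMn sqr_sqrtr ?(ltW q0)//.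
have -> : tau ^+ M ^+ 2 * q * (c i ^+ 2 * wave_norm (J i)) =
  tau ^+ M ^+ 2 * (c i ^+ 2 * (q * wave_norm (J i))) by ring.
have J0 := wave_norm_gt0 (J i).
apply: ler_pM; rewrite ?sqr_ge0 ?(mulr_ge0 (sqr_ge0 _) (mulr_ge0 (ltW q0) (ltW J0)))//.
  by rewrite -!exprM ler_wiXn2l ?(ltW tau0) ?(ltW tau1)// leq_mul2r JM orbT.
by rewrite ler_wpM2l ?sqr_ge0// expr2 ler_wpM2r// ltW.
Qed.

End finite_family.

(** The test space for s_n is spanned by n of the (M + 1)^d cosines with
max J <= M; for the least possible M one has M^d < n. *)
Lemma optimal_singular_values_ge s :
  singular_values mu Om nu Om' (integral_operator Om k) s ->
  forall n, (0 < n)%N ->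
  Num.sqrt ((l / 2) ^+ d) * tau `^ (n%:R `^ (d%:R)^-1) <= s n.
Proof.
move=> sP [//|n] _.
have kL2 : L2kernel Om' Om k by exact: optimal_L2kernel.
have ana : analytic_kernel Om' Om k by exact: optimal_analytic_kernel.
have ex : exists N, (n.+1 <= N ^ d)%N.
  by exists n.+1; rewrite -{1}(expn1 n.+1) leq_pexp2l.
have [[|M] NP Nmin] := ex_minnP ex; first by rewrite exp0n in NP.
have Mn : (M ^ d <= n.+1)%N.
  by rewrite leqNgt; apply/negP => /ltnW/Nmin; rewrite ltnn.
have le_card : (n.+1 <= #|{: {ffun 'I_d -> 'I_M.+1}}|)%N.
  by rewrite card_ffun !card_ord.
pose J (i : 'I_n.+1) := index_of_bounded (enum_val (widen_ord le_card i)).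
have Jinj : injective J.
  move=> i j /index_of_bounded_inj/enum_val_inj ij; apply: val_inj.
  by have /(congr1 val) := ij.
have JM i : (max_index (J i) <= M)%N.
  by apply/bigmax_leqP => p _; rewrite ffunE -ltnS ltn_ord.
have t0 : 0 <= tau ^+ M * Num.sqrt ((l / 2) ^+ d).
  by rewrite mulr_ge0 ?sqrtr_ge0// exprn_ge0// ltW.
apply: le_trans (analytic_singular_values_ge bOm ana t0 (waves_free Jinj)
  (fun c => kernel_form_waves_ge Jinj kL2 c JM) sP).
rewrite mulrC ler_wpM2r ?sqrtr_ge0// -powR_mulrn ?(ltW tau0)//.
by apply: ger_powR; [rewrite tau0 ltW|exact: nat_le_root].
Qed.

End optimal_kernel.

(** * Decay of the singular values and its optimality *)

Theorem theorem1p3 (R : realType) (d d' : nat) (d_gt0 : (0 < d)%N)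
    (d'_gt0 : (0 < d')%N) :
  (forall (Om : set 'rV[R]_d) (Om' : set 'rV[R]_d')
      (k : 'rV[R]_d' -> 'rV[R]_d -> R),
    open Om -> bounded_set Om -> open Om' ->
    L2kernel Om' Om k -> analytic_kernel Om' Om k ->
    (exists s, singular_values (lebesgue_rV d) Om (lebesgue_rV d') Om'
                 (integral_operator Om k) s) /\
    exists tau C : R,
      [/\ 0 < tau < 1, 0 < C &
        forall s, singular_values (lebesgue_rV d) Om (lebesgue_rV d') Om'
                    (integral_operator Om k) s ->
        forall n, (0 < n)%N -> s n <= C * tau `^ (n%:R `^ (d%:R)^-1)])
  /\
  (forall (Om : set 'rV[R]_d) (Om' : set 'rV[R]_d') (tau : R),
    open Om -> bounded_set Om -> Om !=set0 ->
    open Om' -> Om' !=set0 -> 0 < tau < 1 ->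
    exists (k : 'rV[R]_d' -> 'rV[R]_d -> R) (c : R),
      [/\ L2kernel Om' Om k, analytic_kernel Om' Om k, 0 < c,
        exists s, singular_values (lebesgue_rV d) Om (lebesgue_rV d') Om'
                    (integral_operator Om k) s &
        forall s, singular_values (lebesgue_rV d) Om (lebesgue_rV d') Om'
                    (integral_operator Om k) s ->
        forall n, (0 < n)%N -> c * tau `^ (n%:R `^ (d%:R)^-1) <= s n]).
Proof.
split=> [Om Om' k oOm bOm oOm' kL2 ana|Om Om' tau oOm bOm Om0 oOm' Om'0 tau01].
  split; first exact: analytic_singular_values_exist.
  exact: analytic_singular_values_decay.
have [B [mB tB nuB BOm']] := open_disjoint_boxes d'_gt0 oOm' Om'0.
have [a [l [l0 QOm]]] := open_cube oOm Om0.
pose D (J : {ffun 'I_d -> nat}) := B (choice.pickle J).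
have mD J : measurable (D J) by exact: mB.
have tD : trivIset setT D.
  by move=> J K _ _ JK; apply: (pcan_inj choice.pickleK); exact: tB JK.
have nuD J : (0 < lebesgue_rV d' (D J) < +oo)%E by exact: nuB.
have DOm' J : D J `<=` Om' by exact: BOm'.
have kL2 : L2kernel Om' Om (optimal_kernel a l tau D) by exact: optimal_L2kernel.
have ana : analytic_kernel Om' Om (optimal_kernel a l tau D).
  exact: optimal_analytic_kernel.
exists (optimal_kernel a l tau D), (Num.sqrt ((l / 2) ^+ d)); split => //.
- by rewrite sqrtr_gt0 exprn_gt0// divr_gt0.
- exact: analytic_singular_values_exist.
- move=> s sP n n0.
  exact: (optimal_singular_values_ge oOm bOm oOm' d_gt0 l0 tau01 mD tD nuD DOm' QOm sP n0).
Qed.
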